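(* Let $\mu$ be a Borel probability measure on $\mathbb{T}=\mathbb{R}/\mathbb{Z}$. If there is an interval $I\subset\mathbb{T}$ of positive length and a constant $C>0$ such that for any continuous function $g\ge0$ on $\mathbb{T}$ $$\int_I g(u)\,du\le C\int_I g(u)\,d\mu(u),$$ then $\mathscr{P}(\mu)\subset\mathscr{P}$. In particular, if $\mu$ admits a density $\varphi$ (with respect to Lebesgue measure) that is continuous and strictly positive on some nonempty open interval $I$ of $\mathbb{T}$, then $\mathscr{P}(\mu)\subset\mathscr{P}$.
   Context: $\mathbb{T}=\mathbb{R}/\mathbb{Z}$, $du$ is the normalized Lebesgue measure on $\mathbb{T}$, and $C(\mathbb{T})$ is the space of continuous functions $f:\mathbb{T}\to\mathbb{C}$. Given a Borel probability measure $\mu$ on $\mathbb{T}$ and $f\in C(\mathbb{T})$, let $f_t(u)=f(t+u)$. Let $(e_n)_{n\in A}$ (with $A\subset\mathbb{Z}$) be an orthonormal basis of $L^2(\mu,\mathbb{C})$, let $(Z_n)_{n\in A}$ be i.i.d. standard complex Gaussian random variables on a probability space $(\Omega,\mathscr{F},\mathbb{P})$ (so $\mathbb{E}Z_n=0$, $\mathbb{E}|Z_n|^2=1$, $\mathbb{E}Z_n^2=0$), and set $$X_f(t)=\sum_{n\in A}\langle f_t,e_n\rangle Z_n,\quad \langle g,e_n\rangle=\int_{\mathbb{T}} g\,\overline{e_n}\,d\mu,$$ the series converging in $L^2(\mathbb{P})$. Then $X_f=\{X_f(t):t\in\mathbb{T}\}$ is a centered complex Gaussian process with $\mathbb{E}(X_f(t)\overline{X_f(s)})=\int_{\mathbb{T}}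 f(t+u)\overline{f(s+u)}\,d\mu(u)$ and $\mathbb{E}|X_f(t)-X_f(s)|^2=\int_{\mathbb{T}}|f(t+u)-f(s+u)|^2\,d\mu(u)$. $\mathscr{P}(\mu)$ is the class of $f\in C(\mathbb{T})$ such that $X_f$ has almost surely bounded paths. Boundedness of paths is understood for a separable version of the process; equivalently, $\sup_F\mathbb{E}\max_{t\in F}|X_f(t)|<\infty$, the supremum being over finite subsets $F$ of $\mathbb{T}$. $\mathscr{P}$ (Pisier's algebra) is $\mathscr{P}(\mu)$ for $\mu$ the Lebesgue measure on $\mathbb{T}$; equivalently, it is the class of $f\in C(\mathbb{T})$ such that the Gaussian process $t\mapsto\sum_{n\in\mathbb{Z}}\hat f(n)Z_n e^{2\pi i n t}$ ($L^2(\mathbb{P})$-sums, $(Z_n)_{n\in\mathbb{Z}}$ i.i.d. standard Gaussian) has almost surely bounded paths. Inclusions are inclusions of sets. *)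

(* Defs.v *)
From HB Require Import structures.
From mathcomp Require Import all_boot all_order all_algebra.
From mathcomp Require Import finmap.
From mathcomp Require Import complex.
From mathcomp Require Import all_classical all_reals all_analysis.
From mathcomp Require Import measurable_realfun showcase.summability.

Set Implicit Arguments.
Unset Strict Implicit.
Unset Printing Implicit Defensive.

Import Order.TTheory GRing.Theory Num.Theory.
Import numFieldNormedType.Exports.
Import ComplexField.Normc.

Local Open Scope classical_set_scope.
Local Open Scope ring_scope.

Definition integers (R : realType) : {pred R} := fun x => x \is a Num.int.

Lemma integers_zmod_closed (R : realType) : zmod_closed (@integers R).
Proof. by split=> [|x y]; [exact: rpred0|exact: rpredB]. Qed.

HB.instance Definition _ (R : realType) :=
  GRing.isZmodClosed.Build R (@integers R) (@integers_zmod_closed R).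

(* R / Z: quotient group, quotient topology, Borel sigma-algebra. *)
Definition circle (R : realType) : Type :=
  quotient_topology (Quotient.quot (@integers R)).

HB.instance Definition _ (R : realType) := GRing.Zmodule.copy (circle R)
  (Quotient.quot (@integers R)).
HB.instance Definition _ (R : realType) := PointedTopological.copy (circle R)
  (quotient_topology (Quotient.quot (@integers R))).
HB.instance Definition _ (R : realType) :=
  @isMeasurable.Build (sigma_display (@open (circle R))) (circle R)
    <<s @open (circle R) >>
    (@sigma_algebra0 _ setT _) (@sigma_algebraC (circle R) _)
    (@sigma_algebra_bigcup _ setT _).

Definition circle_proj (R : realType) (x : R) : circle R := (\pi x)%qT.

Lemma circle_proj_continuous (R : realType) : continuous (@circle_proj R).
Proof. exact: pi_continuous. Qed.

Lemma measurable_circle_proj (R : realType) :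
  measurable_fun [set: R] (@circle_proj R).
Proof.
apply: (@measurability _ _ _ (circle R) _ _ (@open (circle R))) => //.
move=> _ [U oU <-]; rewrite setTI; apply: open_measurable.
by apply: open_comp => // x _; exact: circle_proj_continuous.
Qed.

(* Normalized Lebesgue measure: image of Lebesgue measure on [0, 1[. *)
Definition circle_lebesgue (R : realType) (A : set (circle R)) : \bar R :=
  lebesgue_measure ((@circle_proj R @^-1` A) `&` `[0, 1[%classic).
Arguments circle_lebesgue : clear implicits.

Section circle_lebesgue_probability.
Variable R : realType.

Let m01 : measurable (`[0, 1[%classic : set R).
Proof. exact: measurable_itv. Qed.

Let lebE : circle_lebesgue R =
  pushforward (mrestr lebesgue_measure m01) (@circle_proj R).
Proof. by []. Qed.

Let leb0 : circle_lebesgue R set0 = 0%E.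
Proof. by rewrite /circle_lebesgue preimage_set0 set0I measure0. Qed.

Let leb_ge0 A : (0 <= circle_lebesgue R A)%E.
Proof. exact: measure_ge0. Qed.

Let leb_sigma_additive : semi_sigma_additive (circle_lebesgue R).
Proof.
move=> F mF tF mUF; rewrite lebE.
have mF' i : measurable (@circle_proj R @^-1` F i).
  by rewrite -[X in measurable X]setTI; exact: measurable_circle_proj.
rewrite /pushforward preimage_bigcup.
apply: (@measure_semi_sigma_additive _ _ _ (mrestr lebesgue_measure m01)) => //.
- apply/trivIsetP => /= i j _ _ ij; rewrite -preimage_setI.
  by move/trivIsetP : tF => /(_ _ _ _ _ ij) ->//; rewrite preimage_set0.
- exact: bigcupT_measurable.
Qed.

HB.instance Definition _ := isMeasure.Build _ _ _ (circle_lebesgue R)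
  leb0 leb_ge0 leb_sigma_additive.

Let leb_setT : circle_lebesgue R [set: circle R] = 1%E.
Proof.
rewrite /circle_lebesgue preimage_setT setTI lebesgue_measure_itv/= lte_fin.
by rewrite ltr01 -EFinD subr0.
Qed.

HB.instance Definition _ :=
  Measure_isProbability.Build _ _ _ (circle_lebesgue R) leb_setT.

End circle_lebesgue_probability.

(* The Borel structure of C is that of R x R. *)
Definition reim (R : realType) (z : R[i]) : R * R :=
  (complex.Re z, complex.Im z).

Definition cmeasurable_fun (R : realType) d (T : measurableType d)
    (h : T -> R[i]) : Prop :=
  measurable_fun [set: T] (@reim R \o h).

Section complex_L2.
Context (R : realType) d (T : measurableType d).
Variable m : {measure set T -> \bar R}.
Implicit Types g h : T -> R[i].

Definition cintegral h : R[i] :=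
  Complex (\int[m]_x complex.Re (h x)) (\int[m]_x complex.Im (h x)).

Definition L2sqnorm h : \bar R := (\int[m]_x (normc (h x) ^+ 2)%:E)%E.

Definition in_L2 h : Prop := cmeasurable_fun h /\ (L2sqnorm h < +oo)%E.

Definition L2inner g h : R[i] := cintegral (fun x => g x * conjc (h x)).

(* Orthonormal family whose finite linear combinations are dense in L2(m).    *)
Definition orthonormal_basis (A : set int) (e : int -> T -> R[i]) : Prop :=
  [/\ forall n, A n -> in_L2 (e n),
      forall n k, A n -> A k -> L2inner (e n) (e k) = (n == k)%:R &
      forall h, in_L2 h -> forall eps : R, 0 < eps ->
        exists (J : {fset int}) (c : int -> R[i]),
          [set` J] `<=` A /\
          (L2sqnorm (fun x => (h x - \sum_(n <- J) c n * e n x)%R) < eps%:E)%E].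

(* x is the sum in L2(m) of the family (u_n)_{n in A}: convergence of the     *)
(* partial sums along the net of finite subsets of A.                         *)
Definition is_L2_sum (A : set int) (u : int -> T -> R[i]) (x : T -> R[i]) :
    Prop :=
  in_L2 x /\
  (fun J : {fset int} => L2sqnorm (fun w => x w - \sum_(n <- J | n \in A) u n w))
    @ totally --> 0%E.

End complex_L2.

Section gaussian.
Context (R : realType) d (Omega : measurableType d).
Variable P : probability Omega R.

(* Law N(0, 1/2) x N(0, 1/2) on C = R x R: E z = 0, E |z|^2 = 1, E z^2 = 0.    *)
(* The second argument of normal_prob is the standard deviation.              *)
Definition std_complex_gaussian (z : Omega -> R[i]) : Prop :=
  cmeasurable_fun z /\
  forall B : set (R * R), measurable B ->
    P ((@reim R \o z) @^-1` B) =
    (normal_prob 0 (Num.sqrt (2^-1)) \x normal_prob 0 (Num.sqrt (2^-1)))%E B.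

Definition mutually_independent (A : set int) (Z : int -> Omega -> R[i]) :
    Prop :=
  forall (J : {fset int}) (B : int -> set (R * R)),
    [set` J] `<=` A -> (forall n, n \in J -> measurable (B n)) ->
    P (\bigcap_(n in [set` J]) ((@reim R \o Z n) @^-1` B n)) =
    (\prod_(n <- J) P ((@reim R \o Z n) @^-1` B n))%E.

Definition iid_std_complex_gaussian (A : set int) (Z : int -> Omega -> R[i]) :
    Prop :=
  (forall n, A n -> std_complex_gaussian (Z n)) /\ mutually_independent A Z.

End gaussian.

Definition cfun_continuous (R : realType) (f : circle R -> R[i]) : Prop :=
  continuous (f : circle R -> R[i]^o).

(* X f t = \sum_(n in A) <f_t, e_n> Z_n for f in C(T), where f_t(u) = f(t+u). *)
Definition pisier_process (R : realType)
    (mu : {measure set (circle R) -> \bar R})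
    d (Omega : measurableType d) (P : probability Omega R)
    (A : set int) (e : int -> circle R -> R[i]) (Z : int -> Omega -> R[i])
    (X : (circle R -> R[i]) -> circle R -> Omega -> R[i]) : Prop :=
  [/\ orthonormal_basis mu A e,
      iid_std_complex_gaussian P A Z &
      forall f, cfun_continuous f -> forall t,
        is_L2_sum P A
          (fun n w => L2inner mu (fun u => f (t + u)) (e n) * Z n w) (X f t)].

Section paths.
Context (R : realType) d (Omega : measurableType d).
Variable P : probability Omega R.
Implicit Types X Y : circle R -> Omega -> R[i].

(* When X t is a random variable, so is Y t for the completion of P.          *)
Definition is_version X Y : Prop := forall t, \forall w \ae P, Y t w = X t w.

(* Doob separability: there are a countable dense set S and a null set off    *)
(* which each (t, Y t w) is a limit of points (s, Y s w) with s in S.         *)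
Definition separable_process Y : Prop :=
  exists S : set (circle R), [/\ countable S, dense S &
    \forall w \ae P, forall t,
      closure [set (s, Y s w : R[i]^o) | s in S] (t, Y t w : R[i]^o)].

Definition bounded_paths Y : Prop :=
  \forall w \ae P, exists M : R, forall t, normc (Y t w) <= M.

End paths.

(* The class P(mu), when X is a pisier_process for mu; it does not depend on  *)
(* the data (P, A, e, Z, X) realizing the process.                            *)
Definition pisier_class (R : realType) d (Omega : measurableType d)
    (P : probability Omega R)
    (X : (circle R -> R[i]) -> circle R -> Omega -> R[i]) :
    set (circle R -> R[i]) :=
  [set f | cfun_continuous f /\
    exists Y, [/\ is_version P (X f) Y, separable_process P Y &
                  bounded_paths P Y]].

Definition is_arc (R : realType) (I : set (circle R)) : Prop :=
  exists J : interval R, I = @circle_proj R @` [set` J].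

Definition has_density (R : realType)
    (mu : {measure set (circle R) -> \bar R}) (phi : circle R -> R) : Prop :=
  [/\ measurable_fun [set: circle R] phi, forall u, 0 <= phi u &
      forall B, measurable B ->
        mu B = (\int[circle_lebesgue R]_(u in B) (phi u)%:E)%E].

(* Main.v *)
Require Import Defs.
From HB Require Import structures.
From mathcomp Require Import all_boot all_order all_algebra.
From mathcomp Require Import finmap complex.
From mathcomp Require Import all_classical all_reals all_analysis.
From mathcomp Require Import measurable_realfun showcase.summability zify ring lra.

Set Implicit Arguments.
Unset Strict Implicit.
Unset Printing Implicit Defensive.

Import Order.TTheory GRing.Theory Num.Theory.
Import numFieldNormedType.Exports.
Import ComplexField.Normc.

Local Open Scope classical_set_scope.
Local Open Scope ring_scope.

(** The kernel of [X_f] is [K_mu(s, t) = \int f(s + u) conj(f(t + u)) dmu(u)].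
If Lebesgue measure is bounded by [C mu] on an arc, then, since finitely many
translates of this arc cover the circle, the Lebesgue integral of a nonnegative
continuous function is at most [C] times the sum of the [mu]-integrals of
finitely many of its translates ([arc_dominated], [density_dominated]). Applied
to [|\sum_j a_j f(t_j + u)|^2] this says that, as a quadratic form in [a], the
Lebesgue kernel at the points [t_j] is at most [C] times a sum over [k] of the
[mu]-kernels at the points [t_j + al_k].

For Gaussian vectors, domination of the covariances gives a comparison of the
maxima: if [V] has the larger covariance, then [V] has the law of [U + W] and of
[U - W], with [W] independent of [U]; whenever [|U_j| > l], one of
[|U_j + W_j|] and [|U_j - W_j|] exceeds [l], so that
[P(max |U_j| > l) <= 2 P(max |V_j| > l)] ([tail_dom]). The law of a linear image of a
standard Gaussian vector depends only on the Gram matrix of its coefficients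
([tail_gram]): two matrices with the same Gram matrix differ by a product of
reflections ([gram_isotropic]), and reflections preserve the Gaussian law
([isotropic_reflect]) because plane rotations do ([gauss2_rotation]).

To apply this to the processes, both series are truncated. Bessel's inequality
bounds the quadratic form of the truncated Lebesgue process from above, and the
completeness of the basis bounds that of the truncated [mu]-process from below,
up to a small multiple of the identity which a small independent noise absorbs
([tail_partial_mx_transfer]). In the limit, tail bounds for the maximum of the
[mu]-process over finite sets become tail bounds for the Lebesgue process, with
constants independent of the number of points ([exceeds_some_transfer]). If the
first process has a bounded version, its suprema over countable sets are tight
([pisier_class_tight]), hence so are those of the second one over the rational
points, which is therefore almost surely bounded there
([pisier_class_bounded_transfer]).

Finally the Lebesgue process is continuous in probability
([pisier_process_increment], by the same comparison with one Gaussian variable),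
so that each of its values is almost surely a limit of its values at rational
points. Replacing the exceptional values by limits of values at rational points,
which exist when the path is bounded there, yields a separable bounded version
([pisier_class_of_bounded]). *)

(** * Rotations of the plane preserve Lebesgue measure *)

Section lebesgue_plane.
Context {R : realType}.
Notation leb := lebesgue_measure.
Implicit Types (a b c s : R).

Lemma lebesgue_measureD a (A : set R) : measurable A ->
  pushforward leb (fun x => x + a : measurableTypeR R) A = leb A.
Proof.
move=> mA; apply/esym/lebesgue_measure_unique => //=.
  exact: measurable_funD.
move=> _ mD [[x y]] _ <-.
rewrite /pushforward.
have -> : (fun z : R => z + a) @^-1` `]x, y] = `]x - a, y - a]%classic.
  by apply/seteqP; split=> z /=; rewrite !in_itv/= ltrBlDr lerBrDr.
rewrite !lebesgue_measure_itv/= !lte_fin ltrD2r opprB.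
by case: ifP => // _; rewrite -!EFinD; congr EFin; ring.
Qed.

Lemma ge0_integral_translate a (f : R -> \bar R) : measurable_fun setT f ->
  (forall x, 0 <= f x)%E ->
  (\int[leb]_x (f \o +%R^~ a) x = \int[leb]_x f x)%E.
Proof.
move=> mf f0.
have mD : measurable_fun [set: measurableTypeR R]
    (fun x : measurableTypeR R => x + a : measurableTypeR R).
  exact: measurable_funD.
rewrite -[LHS](ge0_integral_pushforward mD leb measurableT)//.
by apply: eq_measure_integral => A mA _; exact: lebesgue_measureD.
Qed.

Notation iint F := (\int[leb]_x \int[leb]_y F (x, y))%E.

Lemma iint_shear2 a (F : R * R -> \bar R) : measurable_fun setT F ->
  (forall z, 0 <= F z)%E -> (iint (fun z => F (z.1, (z.2 + a * z.1)%R)) = iint F).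
Proof.
move=> mF F0; apply: eq_integral => x _ /=.
rewrite (@ge0_integral_translate _ (fun y => F (x, y)))//.
exact: measurableT_comp.
Qed.

Lemma iint_shear1 a (F : R * R -> \bar R) : measurable_fun setT F ->
  (forall z, 0 <= F z)%E -> (iint (fun z => F ((z.1 + a * z.2)%R, z.2)) = iint F).
Proof.
move=> mF F0.
have mG : measurable_fun setT (fun z : R * R => F (z.1 + a * z.2, z.2)).
  apply: measurableT_comp => //.
  apply: measurable_fun_pair => //; apply: measurable_funD => //.
  exact: measurable_funM.
pose G := fun z : R * R => F (z.1 + a * z.2, z.2).
transitivity (\int[leb]_y \int[leb]_x G (x, y))%E.
  exact: (fubini_tonelli (m1 := leb) (m2 := leb) _ mG).
transitivity (\int[leb]_y \int[leb]_x F (x, y))%E; last first.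
  exact/esym/(fubini_tonelli (m1 := leb) (m2 := leb) _ mF).
apply: eq_integral => y _.
rewrite -(@ge0_integral_translate (a * y) (fun x => F (x, y)))//.
exact: measurableT_comp.
Qed.

(** A rotation is a product of three shears as soon as its sine does not vanish,
and a shear preserves Lebesgue measure by Tonelli and translation invariance. *)
Lemma iint_rotation c s (F : R * R -> \bar R) : s != 0 -> c ^+ 2 + s ^+ 2 = 1 ->
  measurable_fun setT F -> (forall z, 0 <= F z)%E ->
  (iint (fun z => F (c * z.1 + s * z.2, - s * z.1 + c * z.2)%R) = iint F).
Proof.
move=> s0 cs1 mF F0.
(* b is the slope of the two outer shears, that is tan (theta / 2) *)
pose b := (1 - c) / s.
have m2 a : measurable_fun [set: R * R] (fun z => (z.1, z.2 + a * z.1)).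
  by apply: measurable_fun_pair => //; apply: measurable_funD => //; exact: measurable_funM.
have m1 a : measurable_fun [set: R * R] (fun z => (z.1 + a * z.2, z.2)).
  by apply: measurable_fun_pair => //; apply: measurable_funD => //; exact: measurable_funM.
rewrite -(iint_shear1 b mF F0).
rewrite -(@iint_shear2 (- s) (fun z => F (z.1 + b * z.2, z.2)))//; last first.
  by apply: (measurableT_comp mF); exact: m1.
rewrite -(@iint_shear1 b (fun z => F (z.1 + b * (z.2 + - s * z.1), z.2 + - s * z.1)))//; last first.
  by apply: (measurableT_comp mF); exact: (measurableT_comp (m1 b) (m2 (- s))).
have sb : s * b = 1 - c by rewrite /b mulrC divfK.
apply: eq_integral => x _; apply: eq_integral => y _ /=; congr (F (_, _)).
  have sbc : b * (1 + c) = s.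
    by apply: (mulfI s0); rewrite mulrA sb; move: cs1; rewrite !expr2; lra.
  have -> : x + b * y + b * (y + - s * (x + b * y)) =
    (1 - s * b) * x + (2 - s * b) * b * y by ring.
  rewrite sb (_ : (2 - (1 - c)) * b = b * (1 + c)); last by ring.
  by rewrite sbc; ring.
have -> : y + - s * (x + b * y) = - s * x + (1 - s * b) * y by ring.
by rewrite sb; ring.
Qed.

End lebesgue_plane.

(** * Rotation invariance of the product of two centered Gaussian laws *)

Section density.
Local Open Scope ereal_scope.
Context d (T : measurableType d) (R : realType).
Variables (m nu : {measure set T -> \bar R}) (p : T -> R).
Hypotheses (mp : measurable_fun setT p) (p0 : forall x, (0 <= p x)%R).
Hypothesis nuE : forall A, measurable A -> nu A = \int[m]_(x in A) (p x)%:E.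

Import HBNNSimple.

(** Both sides are continuous along increasing limits of simple functions, which
reduces the formula to indicators, where it is the definition of a density. *)
Lemma ge0_integral_density (f : T -> \bar R) :
  measurable_fun setT f -> (forall x, 0 <= f x) ->
  \int[nu]_x f x = \int[m]_x (f x * (p x)%:E).
Proof.
move=> mf f0; pose f_ := nnsfun_approx measurableT mf.
have fp0 n x : 0 <= (f_ n x)%:E * (p x)%:E by rewrite mule_ge0// lee_fin.
have mfp n : measurable_fun setT (fun x => (f_ n x)%:E * (p x)%:E).
  by apply: emeasurable_funM; exact/measurable_EFinP.
transitivity (limn (fun n => \int[nu]_x (f_ n x)%:E)).
  rewrite -monotone_convergence//.
  - apply: eq_integral => y _ /=; apply/esym/cvg_lim => //.
    by apply: cvg_nnsfun_approx.
  - by move=> n; exact/measurable_EFinP/measurable_funP.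
  - by move=> n y _; rewrite lee_fin.
  - by move=> y _ a b ab; rewrite lee_fin; exact/lefP/nd_nnsfun_approx.
transitivity (limn (fun n => \int[m]_x ((f_ n x)%:E * (p x)%:E))); last first.
  rewrite -monotone_convergence//.
  - apply: eq_integral => y _ /=; apply/cvg_lim => //.
    by apply: cvgeZr => //; exact: cvg_nnsfun_approx.
  - move=> y _ a b ab; rewrite lee_wpmul2r// ?lee_fin//.
    exact/lefP/nd_nnsfun_approx.
congr (limn _); apply/funext => n.
under eq_integral do rewrite fimfunE -fsumEFin//.
rewrite [RHS](eq_integral (fun x => \sum_(k \in range (f_ n))
    ((k * \1_(f_ n @^-1` [set k]) x)%:E * (p x)%:E))); last first.
  move=> x _; rewrite [in LHS]fimfunE -fsumEFin// -ge0_mule_fsuml//.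
  by move=> k; exact: nnfun_muleindic_ge0.
rewrite ge0_integral_fsum//; last 2 first.
- by move=> y; exact/measurable_EFinP/measurable_funM.
- by move=> y x _; rewrite nnfun_muleindic_ge0.
rewrite ge0_integral_fsum//; last 2 first.
- move=> y; apply: emeasurable_funM; last exact/measurable_EFinP.
  exact/measurable_EFinP/measurable_funM.
- by move=> y x _; rewrite mule_ge0 ?nnfun_muleindic_ge0// lee_fin.
apply: eq_fsbigr => r _; rewrite integralZl_indic_nnsfun// integral_indic//=.
rewrite setIT.
have [r0|r0] := leP 0%R r; last first.
  rewrite preimage_nnfun0// measure0 mule0 integral0_eq// => x _.
  by rewrite indic0 mulr0 mul0e.
under eq_integral do rewrite EFinM -muleA.
rewrite ge0_integralZl//; last 2 first.
- by apply: emeasurable_funM; exact/measurable_EFinP.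
- by move=> x _; rewrite mule_ge0 ?lee_fin.
rewrite nuE//; congr (_ * _); rewrite integral_mkcond; apply: eq_integral => x _.
by rewrite /patch indicE; case: ifP => _; rewrite ?mul1e ?mul0e.
Qed.

End density.

Lemma ge0_integral_opp (R : realType) (f : R -> \bar R) : measurable_fun setT f ->
  (forall x, 0 <= f x)%E ->
  (\int[lebesgue_measure]_x (f \o -%R) x = \int[lebesgue_measure]_x f x)%E.
Proof.
move=> mf f0.
have mN : measurable_fun [set: measurableTypeR R]
  (-%R : measurableTypeR R -> measurableTypeR R) by exact: measurable_funN.
rewrite -[LHS](ge0_integral_pushforward mN lebesgue_measure measurableT)//.
by apply: eq_measure_integral => A mA _; exact: lebesgue_measureN.
Qed.

Section gauss_plane.
Context {R : realType}.
Variable sg : R.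
Hypothesis sg0 : sg != 0.
Notation leb := lebesgue_measure.
Notation nu := (normal_prob 0 sg).
Notation p := (normal_pdf 0 sg).

Let pE (x : R) : p x = normal_peak sg * expR (- x ^+ 2 / (sg ^+ 2 *+ 2)).
Proof. by rewrite normal_pdfE// /normal_fun subr0. Qed.

Let mp : measurable_fun setT (p : R -> R).
Proof. exact: measurable_normal_pdf. Qed.

Lemma gauss2E (D : set (R * R)) : measurable D ->
  (nu \x nu)%E D = (\int[leb]_x \int[leb]_y (\1_D (x, y) * (p x * p y))%:E)%E.
Proof.
move=> mD; rewrite /product_measure1.
rewrite (@ge0_integral_density _ _ _ leb nu p mp)//=; last 2 first.
- by move=> x; exact: normal_pdf_ge0.
- exact: measurable_fun_xsection.
apply: eq_integral => x _ /=.
rewrite {1}/normal_prob -ge0_integralZr//=; last 4 first.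
- exact: measurable_xsection.
- exact/measurable_EFinP/measurable_funTS.
- by move=> y _; rewrite lee_fin normal_pdf_ge0.
- by rewrite lee_fin normal_pdf_ge0.
rewrite integral_mkcond; apply: eq_integral => y _.
rewrite /patch mem_xsection indicE; case: ifPn => _; rewrite ?mul1r ?mul0r//.
by rewrite mulrC EFinM.
Qed.

(** The density of the product is a function of the Euclidean norm, and the
rotation preserves both this norm and Lebesgue measure. *)
Lemma gauss2_rotation (c s : R) (D : set (R * R)) : s != 0 ->
  c ^+ 2 + s ^+ 2 = 1 -> measurable D ->
  (nu \x nu)%E ((fun z => (c * z.1 + s * z.2, - s * z.1 + c * z.2)) @^-1` D) =
  (nu \x nu)%E D.
Proof.
move=> s0 cs mD.
pose rho (z : R * R) := (c * z.1 + s * z.2, - s * z.1 + c * z.2).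
have mrho : measurable_fun [set: R * R] rho.
  by apply: measurable_fun_pair; apply: measurable_funD; exact: measurable_funM.
have mD' : measurable (rho @^-1` D).
  by rewrite -[X in measurable X]setTI; exact: mrho.
rewrite -/rho (gauss2E mD) (gauss2E mD').
pose F (z : R * R) := (\1_D z * (p z.1 * p z.2))%:E.
have mF : measurable_fun setT F.
  apply/measurable_EFinP; apply: measurable_funM; first exact: measurable_indic.
  by apply: measurable_funM; exact: measurableT_comp.
have F0 z : (0 <= F z)%E by rewrite lee_fin mulr_ge0// mulr_ge0// normal_pdf_ge0.
transitivity (\int[leb]_x \int[leb]_y (F \o rho) (x, y))%E; last first.
  exact: (iint_rotation s0 cs mF F0).
apply: eq_integral => x _; apply: eq_integral => y _.
rewrite /F/= !indicE; congr (_ * _)%:E.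
rewrite !pE mulrACA [RHS]mulrACA; congr (_ * _); rewrite -!expRD; congr expR.
rewrite -!mulrDl; congr (_ / _).
rewrite -[LHS]mulr1 -cs; ring.
Qed.

Lemma normal_prob_opp (B : set R) : measurable B -> nu (-%R @^-1` B) = nu B.
Proof.
move=> mB; rewrite /normal_prob.
rewrite integral_mkcond [RHS]integral_mkcond.
rewrite -[RHS]ge0_integral_opp.
- apply: eq_integral => x _ /=; rewrite /patch.
  have -> : (x \in (-%R @^-1` B)) = (- x \in B) by apply/idP/idP; rewrite !inE.
  by case: ifP => // _; rewrite !pE sqrrN.
- apply/(measurable_restrictT _ mB); apply: measurable_funTS.
  exact/measurable_EFinP.
- by move=> x; rewrite /patch; case: ifP => // _; rewrite lee_fin normal_pdf_ge0.
Qed.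

End gauss_plane.

(** * Reflections preserve the standard Gaussian law *)

(** The variance 1/2 is that of the real and imaginary parts of a standard
complex Gaussian variable. *)
Definition gauss1 (R : realType) : probability (measurableTypeR R) R :=
  normal_prob (0 : R) (Num.sqrt (2^-1 : R)).

Definition gaussian_vector (R : realType) d (T : measurableType d)
    (P : probability T R) n (Z : T -> 'rV[R]_n) : Prop :=
  (forall i, measurable_fun setT (fun w => Z w 0 i)) /\
  (forall B : 'I_n -> set R, (forall i, measurable (B i)) ->
     P [set w | forall i, B i (Z w 0 i)] = (\prod_i gauss1 R (B i))%E).

Lemma std_normal (R : realType) : Num.sqrt (2^-1 : R) != 0.
Proof. by rewrite gt_eqF// sqrtr_gt0 invr_gt0 ltr0n. Qed.

Lemma gauss2X (R : realType) (A B : set R) : measurable A -> measurable B ->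
  ((gauss1 R \x gauss1 R) (A `*` B) = gauss1 R A * gauss1 R B)%E.
Proof. by move=> mA mB; exact: product_measure1E. Qed.

Section rectangles.
Context d1 d2 (T1 : measurableType d1) (T2 : measurableType d2) (R : realType).
Variables (m1 m2 : {measure set (T1 * T2) -> \bar R}).

(** Rectangles form a pi-system that generates the product sigma-algebra. *)
Lemma rectangle_measure_unique :
  (forall A B, measurable A -> measurable B -> m1 (A `*` B) = m2 (A `*` B)) ->
  (m1 setT < +oo)%E -> forall D, measurable D -> m1 D = m2 D.
Proof.
move=> m12 fin D mD.
pose C : set (set (T1 * T2)) :=
  [set C | exists A, measurable A /\ exists B, measurable B /\ C = A `*` B].
apply: (measure_unique C (fun=> setT)) => //.
- rewrite measurable_prod_measurableType //; congr (<<s _ >>).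
  rewrite predeqE; split => [[A mA [B mB <-]]|[A [mA [B [mB ->]]]]].
    by exists A; split => //; exists B.
  by exists A => //; exists B.
- move=> /= _ _ [X1 [mX1 [X2 [mX2 ->]]]] [Y1 [mY1 [Y2 [mY2 ->]]]].
  rewrite -setXI; exists (X1 `&` Y1); split; first exact: measurableI.
  by exists (X2 `&` Y2); split => //; exact: measurableI.
- by move=> _; exists setT; split => //; exists setT; split => //; rewrite setXTT.
- by rewrite bigcup_const//; exists 0%N.
- by move=> A [A1 [mA1 [A2 [mA2 ->]]]]; exact: m12.
Qed.

End rectangles.

Section isotropy.
Context {R : realType} (n : nat).
Implicit Types (x v : 'rV[R]_n) (i j k : 'I_n) (c s : R).

(** The law of a Gaussian vector is only known here through boxes, so that
invariance under [phi] is phrased on all probability spaces at once. *)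
Definition isotropic (phi : 'rV[R]_n -> 'rV[R]_n) : Prop :=
  forall d (T : measurableType d) (P : probability T R) (Z : T -> 'rV[R]_n),
    gaussian_vector P Z -> gaussian_vector P (phi \o Z).

Definition givens i j c s x : 'rV[R]_n :=
  \row_k (if k == i then c * x 0 i + s * x 0 j
          else if k == j then - s * x 0 i + c * x 0 j else x 0 k).

Lemma measurable_box d (T : measurableType d) (Z : T -> 'rV[R]_n) (Q : pred 'I_n) (B : 'I_n -> set R) :
  (forall i, measurable_fun setT (fun w => Z w 0 i)) -> (forall i, measurable (B i)) ->
  measurable [set w | forall i, Q i -> B i (Z w 0 i)].
Proof.
move=> mZ mB.
have -> : [set w | forall i, Q i -> B i (Z w 0 i)] =
    \bigcap_(i in [set i | Q i]) ((fun w => Z w 0 i) @^-1` B i).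
  by apply/seteqP; split=> w /= h i; exact: h.
apply: fin_bigcap_measurable; first exact: finite_finset.
by move=> i _; rewrite -[X in measurable X]setTI; exact: mZ.
Qed.

(** Two coordinates, jointly, are independent of the others: boxes only give
rectangles [D], and a general planar set [D] is reached by uniqueness of measures. *)
Lemma gaussian_pair d (T : measurableType d) (P : probability T R) (Z : T -> 'rV[R]_n)
    i j (B : 'I_n -> set R) (D : set (R * R)) :
  gaussian_vector P Z -> i != j -> (forall k, measurable (B k)) -> measurable D ->
  P [set w | (forall k, (k != i) && (k != j) -> B k (Z w 0 k)) /\ D (Z w 0 i, Z w 0 j)] =
  ((\prod_(k | (k != i) && (k != j)) gauss1 R (B k)) * (gauss1 R \x gauss1 R) D)%E.
Proof.
move=> [mZ PZ] ij mB mD.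
set E := [set w | forall k, (k != i) && (k != j) -> B k (Z w 0 k)].
have mE : measurable E by exact: measurable_box.
pose g w : measurableTypeR R * measurableTypeR R := (Z w 0 i, Z w 0 j).
have mg : measurable_fun setT g by apply: measurable_fun_pair; exact: mZ.
set r := (\prod_(k | _) _)%E.
have r0 : (0 <= r)%E by apply: prode_ge0 => k _; exact: measure_ge0.
have rfin : r \is a fin_num by apply: prode_fin_num => k _; exact: (fin_num_measure (gauss1 R) _ (mB k)).
have fr0 : 0 <= fine r by exact: fine_ge0.
pose m1 : {measure set (measurableTypeR R * measurableTypeR R) -> \bar R} := @measure_function_pushforward__canonical__measure_function_Measure _ _ _ _ _ (mrestr P mE) g mg.
pose gg : {measure set (measurableTypeR R * measurableTypeR R) -> \bar R} := (gauss1 R \x gauss1 R)%E.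
pose m2 : {measure set (measurableTypeR R * measurableTypeR R) -> \bar R} := mscale (NngNum fr0) gg.
suff m12 : m1 D = m2 D.
  transitivity (m1 D); last by rewrite m12 /m2 /= /mscale/= fineK.
  rewrite /m1/= /pushforward /mrestr; congr (P _).
  by apply/seteqP; split=> w /= [].
apply: rectangle_measure_unique => //; last first.
  rewrite /m1/= /pushforward /mrestr preimage_setT setTI.
  by rewrite ltey_eq fin_num_measure.
move=> A0 B0 mA0 mB0.
pose B' k : set R := if k == i then A0 else if k == j then B0 else B k.
have mB' k : measurable (B' k).
  by rewrite /B'; case: ifP => _; [exact: mA0|case: ifP => _; [exact: mB0|exact: mB]].
have -> : m1 (A0 `*` B0) = P [set w | forall k, B' k (Z w 0 k)].
  rewrite /m1/= /pushforward /mrestr; congr (P _); apply/seteqP; split=> w /=.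
    move=> [[/= Ai Bj] Ew] k; rewrite /B'.
    case: eqP => [->//|/eqP ki]; case: eqP => [->//|/eqP kj].
    by apply: Ew; rewrite ki kj.
  move=> h; split; first split => /=.
  - by have := h i; rewrite /B' eqxx.
  - by have := h j; rewrite /B' eqxx eq_sym (negbTE ij).
  - by move=> k /andP[ki kj]; have := h k; rewrite /B' (negbTE ki) (negbTE kj).
rewrite PZ// (bigD1 i)//= (bigD1 j)/=; last by rewrite eq_sym.
rewrite /m2/= /mscale/= fineK// /gg/= gauss2X//.
rewrite {1 2}/B' eqxx eq_sym (negbTE ij) eqxx muleA [RHS]muleC; congr (_ * _)%E.
by apply: eq_bigr => k /andP[ki kj]; rewrite /B' (negbTE ki) (negbTE kj).
Qed.

Lemma gaussian_pair_box d (T : measurableType d) (P : probability T R) (Z : T -> 'rV[R]_n)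
    i j (B : 'I_n -> set R) (f : R * R -> R * R):
  gaussian_vector P Z -> i != j -> (forall k, measurable (B k)) ->
  measurable_fun setT f ->
  (forall D, measurable D -> (gauss1 R \x gauss1 R)%E (f @^-1` D) = (gauss1 R \x gauss1 R)%E D) ->
  P [set w | (forall k, (k != i) && (k != j) -> B k (Z w 0 k)) /\
     (B i `*` B j) (f (Z w 0 i, Z w 0 j))] =
  (\prod_k gauss1 R (B k))%E.
Proof.
move=> gZ ij mB mf fP.
have mij : measurable (B i `*` B j) by exact: measurableX.
have mD : measurable (f @^-1` (B i `*` B j)).
  by rewrite -[X in measurable X]setTI; exact: mf.
rewrite (gaussian_pair gZ ij mB mD) fP// gauss2X//.
rewrite [RHS](bigD1 i)//= [in RHS](bigD1 j)/=; last by rewrite eq_sym.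
by rewrite muleC -muleA.
Qed.

Lemma isotropic_givens i j c s : i != j -> s != 0 -> c ^+ 2 + s ^+ 2 = 1 ->
  isotropic (givens i j c s).
Proof.
move=> ij s0 cs d T P Z gZ; have [mZ PZ] := gZ; split.
  move=> k; rewrite /givens/=; under eq_fun do rewrite mxE.
  have [_|_] := eqVneq k i; first by apply: measurable_funD; exact: measurable_funM.
  have [_|_] := eqVneq k j; last exact: mZ.
  by apply: measurable_funD; exact: measurable_funM.
move=> B mB.
pose f (z : R * R) := (c * z.1 + s * z.2, - s * z.1 + c * z.2).
have mf : measurable_fun setT f.
  by apply: measurable_fun_pair; apply: measurable_funD; exact: measurable_funM.
rewrite -(gaussian_pair_box gZ ij mB mf); last first.
  by move=> D mD; exact: (gauss2_rotation (std_normal R) s0 cs mD).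
congr (P _); apply/seteqP; split=> w /=.
  move=> h; split.
    by move=> k /andP[ki kj]; have := h k; rewrite mxE (negbTE ki) (negbTE kj).
  split => /=; first by have := h i; rewrite mxE eqxx.
  by have := h j; rewrite mxE eqxx eq_sym (negbTE ij).
move=> [h [/= hi hj]] k; rewrite mxE.
case: eqP => [->//|/eqP ki]; case: eqP => [->//|/eqP kj].
by apply: h; rewrite ki kj.
Qed.

Definition flip i x : 'rV[R]_n := \row_k (if k == i then - x 0 k else x 0 k).

Lemma isotropic_flip i : isotropic (flip i).
Proof.
move=> d T P Z [mZ PZ]; split.
  move=> k; rewrite /flip/=; under eq_fun do rewrite mxE.
  by have [_|_] := eqVneq k i; [exact: measurable_funN|exact: mZ].
move=> B mB.
pose B' k := if k == i then -%R @^-1` B i else B k.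
have mB' k : measurable (B' k).
  rewrite /B'; case: ifP => // _; rewrite -[X in measurable X]setTI.
  exact: (measurable_funN (@measurable_id _ _ _)).
transitivity (P [set w | forall k, B' k (Z w 0 k)]).
  congr (P _); apply/seteqP; split=> w /= h k; have := h k; rewrite /B' !mxE.
    by case: eqP => [->|].
  by case: eqP => [->|].
rewrite PZ//; apply: eq_bigr => k _; rewrite /B'; case: eqP => [->|//].
exact: (normal_prob_opp (std_normal R)).
Qed.

Definition dot x v : R := \sum_k x 0 k * v 0 k.

Definition reflect_row v x := x - (2 * dot x v) *: v.

Lemma isotropic_comp phi psi : isotropic phi -> isotropic psi ->
  isotropic (phi \o psi).
Proof. by move=> h1 h2 d T P Z gZ; exact/h1/h2. Qed.

Lemma givensK i j c s x : i != j -> c ^+ 2 + s ^+ 2 = 1 ->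
  givens i j c (- s) (givens i j c s x) = x.
Proof.
move=> ij cs; apply/rowP => k; rewrite !mxE !eqxx [j == i]eq_sym (negbTE ij).
case: eqP => [->|_]; last case: eqP => [->|//]; rewrite -[RHS]mul1r -cs; ring.
Qed.

Lemma dot_givens i j c s x v : i != j -> c ^+ 2 + s ^+ 2 = 1 ->
  dot (givens i j c s x) (givens i j c s v) = dot x v.
Proof.
move=> ij cs; have ji : j != i by rewrite eq_sym.
rewrite /dot (bigD1 i)//= (bigD1 j)//= [RHS](bigD1 i)//= [in RHS](bigD1 j)//=.
rewrite !addrA; congr (_ + _); last first.
  by apply: eq_bigr => k /andP[ki kj]; rewrite !mxE (negbTE ki) (negbTE kj).
rewrite !mxE !eqxx (negbTE ji).
transitivity ((c ^+ 2 + s ^+ 2) * (x 0 i * v 0 i + x 0 j * v 0 j)); first ring.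
by rewrite cs mul1r.
Qed.

(** Reflections are conjugate to each other by the rotations that map their
axes onto each other. *)
Lemma reflect_givens i j c s v x : i != j -> c ^+ 2 + s ^+ 2 = 1 ->
  reflect_row v x =
  givens i j c (- s) (reflect_row (givens i j c s v) (givens i j c s x)).
Proof.
move=> ij cs; rewrite /reflect_row dot_givens//.
set t := 2 * _.
rewrite -[in LHS](givensK x ij cs) -{1}(givensK v ij cs).
by apply/rowP => k; rewrite !mxE !eqxx; case: eqP => _; last case: eqP => _; ring.
Qed.

(** Induction on the number of coordinates in the support of [v]: a rotation in
the plane of the first and the last of them makes the last one vanish, and
conjugates the reflection to one with a smaller support. When [v] is a basis
vector, the reflection is a change of sign. *)
Lemma isotropic_reflect v : dot v v = 1 -> isotropic (reflect_row v).
Proof.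
suff H m : (forall v, (forall k, (m <= k)%N -> v 0 k = 0) -> dot v v = 1 ->
    isotropic (reflect_row v)).
  by apply: (H n) => k; rewrite leqNgt ltn_ord.
elim: m {v} => [v v0|[|m] IH v vm v1].
- rewrite /dot big1 => [/eqP|k _]; first by rewrite eq_sym oner_eq0.
  by rewrite v0// mul0r.
- have [i0|i0] := pselect (exists i : 'I_n, (i : nat) = 0%N); last first.
    have := v1; rewrite /dot big1 => [/eqP|k _]; first by rewrite eq_sym oner_eq0.
    by rewrite vm ?mul0r// lt0n; apply/eqP => k0; apply: i0; exists k.
  have [i i00] := i0.
  have vk k : k != i -> v 0 k = 0.
    by move=> ki; rewrite vm// lt0n -i00.
  have dotv x : dot x v = x 0 i * v 0 i.
    by rewrite /dot (bigD1 i)//= big1 ?addr0// => k /vk ->; rewrite mulr0.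
  have -> : reflect_row v = flip i; last exact: isotropic_flip.
  apply/funext => x; apply/rowP => k; rewrite !mxE dotv.
  move: v1; rewrite dotv -expr2 => vi.
  case: eqP => [->|/eqP/vk ->]; last by rewrite mulr0 subr0.
  by rewrite -!mulrA -expr2 vi; ring.
have [[j jm]|nj] := pselect (exists j : 'I_n, (j : nat) = m.+1); last first.
  apply: IH => // k; rewrite leq_eqVlt => /orP[/eqP mk|]; last exact: vm.
  by exfalso; apply: nj; exists k.
have [vj|vj] := eqVneq (v 0 j) 0.
  apply: IH => // k; rewrite leq_eqVlt => /orP[/eqP mk|]; last exact: vm.
  by rewrite -vj; congr (v 0 _); apply: val_inj; rewrite /= jm.
have n0 : (0 < n)%N by rewrite (leq_ltn_trans _ (ltn_ord j)).
pose i := Ordinal n0.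
have ij : i != j by rewrite -val_eqE/= jm.
(* the rotation maps (v_0, v_j) to (rho, 0) *)
pose rho := Num.sqrt (v 0 i ^+ 2 + v 0 j ^+ 2).
have rho2 : rho ^+ 2 = v 0 i ^+ 2 + v 0 j ^+ 2.
  by rewrite sqr_sqrtr// addr_ge0// sqr_ge0.
have rho0 : rho != 0.
  rewrite gt_eqF// sqrtr_gt0 ltr_wpDl ?sqr_ge0//.
  by rewrite exprn_even_gt0.
pose c := v 0 i / rho; pose s := v 0 j / rho.
have s0 : s != 0 by rewrite mulf_neq0// invr_eq0.
have cs : c ^+ 2 + s ^+ 2 = 1.
  by rewrite !expr_div_n -mulrDl -rho2 divff// expf_neq0.
have -> : reflect_row v =
    givens i j c (- s) \o (reflect_row (givens i j c s v) \o givens i j c s).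
  by apply/funext => x /=; rewrite -reflect_givens.
apply: isotropic_comp; first by apply: isotropic_givens; rewrite ?oppr_eq0 ?sqrrN.
apply: isotropic_comp; last exact: isotropic_givens.
apply: IH; last by rewrite dot_givens.
move=> k mk; rewrite mxE ifF; last by apply/eqP => ki; move: mk; rewrite ki.
case: eqP => [_|/eqP kj]; first by rewrite /c /s; ring.
by rewrite vm// ltn_neqAle mk andbT -jm eq_sym.
Qed.

End isotropy.

(** * Gram matrices determine matrices up to reflections *)

Section gram.
Context {R : realType}.

(** The variance, up to the factor 1/2, of the linear form [a] of the Gaussian
vector whose coefficient matrix is [M]. *)
Definition sqn n p (M : 'M[R]_(n, p)) (a : 'cV[R]_p) : R :=
  \sum_i (M *m a) i 0 ^+ 2.

Lemma sqnE n p (M : 'M[R]_(n, p)) a :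
  sqn M a = (a^T *m (M^T *m M) *m a) 0 0.
Proof.
rewrite mulmxA -trmx_mul -mulmxA mxE; apply: eq_bigr => i _.
by rewrite !mxE expr2.
Qed.

Definition householder n (v : 'cV[R]_n) : 'M[R]_n := 1%:M - 2 *: (v *m v^T).

Lemma householder_orth n (v : 'cV[R]_n) : (v^T *m v) 0 0 = 1 ->
  (householder v)^T *m householder v = 1%:M.
Proof.
move=> v1.
have vv : v *m v^T *m (v *m v^T) = v *m v^T.
  rewrite mulmxA -(mulmxA v) [v^T *m v]mx11_scalar v1.
  by rewrite mulmx1.
have tr : (householder v)^T = householder v.
  by rewrite /householder linearB/= linearZ/= trmx1 trmx_mul trmxK.
rewrite tr /householder mulmxBl mul1mx -scalemxAl mulmxBr mulmx1 -scalemxAr vv.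
by apply/matrixP => i j; rewrite !mxE; ring.
Qed.

Lemma isotropic_mul n (Q : 'M[R]_n) (Q' : 'M[R]_n) :
  isotropic (mulmx^~ Q) -> isotropic (mulmx^~ Q') -> isotropic (mulmx^~ (Q *m Q')).
Proof.
move=> h h'; have -> : (mulmx^~ (Q *m Q')) = (mulmx^~ Q') \o (mulmx^~ Q) :> ('rV_n -> 'rV_n).
  by apply/funext => x /=; rewrite mulmxA.
exact: isotropic_comp.
Qed.

Lemma isotropic_householder n (v : 'cV[R]_n) : (v^T *m v) 0 0 = 1 ->
  isotropic (mulmx^~ (householder v)).
Proof.
move=> v1.
have -> : (mulmx^~ (householder v)) = reflect_row v^T.
  apply/funext => x; rewrite /reflect_row /householder mulmxBr mulmx1 -scalemxAr.
  rewrite mulmxA [x *m v]mx11_scalar mul_scalar_mx scalerA; congr (_ - (_ * _) *: _).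
  by rewrite mxE; apply: eq_bigr => k _; rewrite mxE.
apply: isotropic_reflect.
by rewrite -v1 mxE; apply: eq_bigr => k _; rewrite mxE.
Qed.

(** The reflection along [a - b] exchanges two vectors [a] and [b] of equal length
and fixes the vectors that have the same inner product with both. *)
Lemma householder_swap n (a b : 'cV[R]_n) (c := a - b)
    (r := Num.sqrt ((c^T *m c) 0 0)) :
  a^T *m a = b^T *m b -> a != b ->
  let H := householder (r^-1 *: c) in
  [/\ ((r^-1 *: c)^T *m (r^-1 *: c)) 0 0 = 1, H *m a = b &
      forall x : 'cV_n, a^T *m x = b^T *m x -> H *m x = x].
Proof.
move=> ab nab H.
have cx (x : 'cV[R]_n) : (c^T *m x) 0 0 = (a^T *m x) 0 0 - (b^T *m x) 0 0.
  by rewrite /c linearB/= mulmxBl !mxE.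
have cc : (c^T *m c) 0 0 = \sum_i c i 0 ^+ 2.
  by rewrite mxE; apply: eq_bigr => i _; rewrite mxE expr2.
have cc0 : 0 < (c^T *m c) 0 0.
  rewrite lt_def cc sumr_ge0 ?andbT; last by move=> i _; exact: sqr_ge0.
  apply: contra nab; rewrite psumr_eq0; last by move=> i _; exact: sqr_ge0.
  move=> /allP h; rewrite -subr_eq0; apply/eqP/colP => i; rewrite !mxE.
  by have := h i (mem_index_enum _); rewrite /c !mxE sqrf_eq0 => /eqP.
have r2 : r ^+ 2 = (c^T *m c) 0 0 by rewrite sqr_sqrtr// ltW.
have r0 : r != 0 by rewrite gt_eqF// sqrtr_gt0.
have HE (x : 'cV[R]_n) : H *m x = x - (2 * (r ^- 2 * (c^T *m x) 0 0)) *: c.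
  have HH : H = 1%:M - (2 * r ^- 2) *: (c *m c^T).
    rewrite /H /householder [(r^-1 *: c)^T]linearZ/= -scalemxAl -scalemxAr !scalerA.
    by rewrite -mulrA -invfM -expr2.
  rewrite HH mulmxBl mul1mx -scalemxAl -mulmxA [c^T *m x]mx11_scalar mul_mx_scalar.
  by rewrite scalerA mulrA [_%:M 0 0]mxE eqxx mulr1n.
split.
- rewrite [(r^-1 *: c)^T]linearZ/= -scalemxAl -scalemxAr scalerA mxE -r2 -invfM -expr2.
  by rewrite mulVf// expf_neq0.
- have ca : 2 * (c^T *m a) 0 0 = r ^+ 2.
    have -> : r ^+ 2 = (c^T *m a) 0 0 - (c^T *m b) 0 0.
      by rewrite r2; transitivity ((c^T *m (a - b)) 0 0); rewrite // mulmxBr !mxE.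
    rewrite !cx.
    rewrite ab -[(a^T *m b) 0 0](_ : (b^T *m a) 0 0 = _); first by ring.
    by rewrite -[in LHS](trmxK a) -trmx_mul mxE.
  rewrite HE mulrCA ca mulVf ?expf_neq0// scale1r /c.
  by rewrite opprB addrC subrK.
- move=> x abx; rewrite HE cx abx subrr !mulr0 scale0r.
  exact: subr0.
Qed.

(** The columns of [M1] are moved onto those of [M2] one at a time, by
reflections. Equality of the Gram matrices says that the two current columns
have the same length, and that the reflection exchanging them fixes the columns
that are already in place. *)
Lemma gram_isotropic n p (M1 M2 : 'M[R]_(n, p)) : M1^T *m M1 = M2^T *m M2 ->
  exists Q : 'M[R]_n, isotropic (mulmx^~ Q) /\ Q *m M1 = M2.
Proof.
move=> M12.
suff H k : (k <= p)%N -> exists Q : 'M[R]_n, [/\ isotropic (mulmx^~ Q),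
    (Q *m M1)^T *m (Q *m M1) = M2^T *m M2 &
    forall j : 'I_p, (j < k)%N -> col j (Q *m M1) = col j M2].
  have [Q [h _ hc]] := H p (leqnn p); exists Q; split => //.
  apply/matrixP => i j; have /colP/(_ i) := hc j (ltn_ord j).
  by rewrite !mxE.
have gramE (M : 'M[R]_(n, p)) i j : (col i M)^T *m col j M = ((M^T *m M) i j)%:M.
  rewrite [LHS]mx11_scalar; congr (_ %:M); rewrite !mxE.
  by apply: eq_bigr => l _; rewrite !mxE.
elim: k => [_|k IH kp].
  exists 1%:M; split; [|by rewrite mul1mx|by []].
  move=> d T P Z gZ; rewrite (_ : _ \o Z = Z)//.
  by apply/funext => w /=; rewrite mulmx1.
have [Q [h hg hc]] := IH (ltnW kp).
pose K := Ordinal kp.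
have [e|ne] := eqVneq (col K (Q *m M1)) (col K M2).
  exists Q; split => // j; rewrite ltnS leq_eqVlt => /orP[/eqP jk|]; last exact: hc.
  by have -> : j = K by exact: val_inj.
have [|v1 Ha Hx] := householder_swap _ ne.
  by rewrite !gramE hg.
set v := _ *: _ in v1 Ha Hx.
exists (householder v *m Q); split.
- by apply: isotropic_mul => //; exact: isotropic_householder.
- rewrite -mulmxA trmx_mul -mulmxA (mulmxA _ (householder v)).
  by rewrite householder_orth// mul1mx.
- move=> j; rewrite -mulmxA.
  have -> : col j (householder v *m (Q *m M1)) = householder v *m col j (Q *m M1).
    by rewrite colE [in RHS]colE !mulmxA.
  rewrite ltnS leq_eqVlt => /orP[/eqP jk|jk].
    by have -> : j = K by exact: val_inj.
  rewrite hc// Hx// -(hc j jk) !gramE hg.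
  by rewrite (hc j jk) gramE.
Qed.

(** Cholesky factorization, by induction on the size. A positive semidefinite form
with a null diagonal entry has a null row there, so that the degenerate case
needs no pivoting. *)
Lemma psd_gram p (S : 'M[R]_p) : S^T = S ->
  (forall a : 'cV_p, 0 <= (a^T *m S *m a) 0 0) ->
  exists G : 'M[R]_p, G^T *m G = S.
Proof.
elim: p S => [|p IH] S St S0; first by exists 0; apply/matrixP => -[].
rewrite -[p.+1]/(1 + p)%N in S St S0 *.
pose al := S 0 0; pose v := dlsubmx S; pose S1 := drsubmx S.
have SE : S = block_mx al%:M v^T v S1.
  have -> : v^T = ursubmx S by rewrite /v trmx_dlsub St.
  have -> : al%:M = ulsubmx S; last by rewrite submxK.
  by rewrite [RHS]mx11_scalar !mxE; congr ((S _ _)%:M); apply: val_inj.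
have S1t : S1^T = S1 by rewrite /S1 trmx_drsub St.
clearbody al v S1.
have quad (t : R) (b : 'cV_p) : 0 <= al * t ^+ 2 + 2 * t * (v^T *m b) 0 0 + (b^T *m S1 *m b) 0 0.
  have := S0 (col_mx t%:M b); rewrite SE tr_col_mx mul_row_block mul_row_col.
  have -> : b^T *m v = ((v^T *m b) 0 0)%:M.
    by rewrite -[LHS]trmxK trmx_mul trmxK [v^T *m b]mx11_scalar tr_scalar_mx !mxE.
  rewrite !mulmxDl -[t%:M^T *m v^T *m b]mulmxA [v^T *m b]mx11_scalar.
  rewrite [b^T *m S1 *m b]mx11_scalar.
  rewrite tr_scalar_mx -!scalar_mxM -!raddfD/= !(mxE _ _ 0 0) !eqxx !mulr1n.
  by move=> /le_trans; apply; rewrite le_eqVlt; apply/orP; left; apply/eqP; ring.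
have al0 : 0 <= al by have := quad 1 0; rewrite trmx0 !mulmx0 !mxE; lra.
(* when al = 0 the form is affine in t, and takes the value -1 at the t below
   unless v = 0 *)
have v0 : al = 0 -> v = 0.
  move=> alz; apply/colP => k; rewrite mxE; apply/eqP/negPn/negP => vk.
  have := quad (- ((S1 k k + 1) / (2 * v k 0))) (delta_mx k 0).
  rewrite -colE mxE -mulmxA -colE trmx_delta -rowE !mxE alz.
  rewrite (_ : _ + _ = -1); first by rewrite ler0N1.
  by field; rewrite vk.
pose be := Num.sqrt al.
have be2 : be ^+ 2 = al by rewrite sqr_sqrtr.
have beV : be * be^-1 *: v^T = v^T.
  have [b0|b0] := eqVneq be 0; last by rewrite divff// scale1r.
  by rewrite v0 ?trmx0 ?scaler0// -be2 b0 expr0n.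
(* the Schur complement; 0^-1 = 0 makes it S1 when al = 0 *)
have St1 : (S1 - be ^- 2 *: (v *m v^T))^T = S1 - be ^- 2 *: (v *m v^T).
  by rewrite linearB/= linearZ/= trmx_mul trmxK S1t.
have [b|G GE] := IH _ St1.
  have := quad (- (be ^- 2 * (v^T *m b) 0 0)) b.
  rewrite mulmxBr mulmxBl -scalemxAr -scalemxAl !mulmxA -(mulmxA _ v^T).
  rewrite [b^T *m v](_ : _ = (v^T *m b)^T); last by rewrite trmx_mul trmxK.
  rewrite [v^T *m b]mx11_scalar tr_scalar_mx mul_scalar_mx !mxE eqxx mulr1n.
  set q := (v^T *m b) 0 0; set s := (b^T *m S1 *m b) 0 0.
  have [b0|b0] := eqVneq be 0; first by rewrite b0 expr0n/= invr0; nra.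
  rewrite -be2 => /le_trans; apply; rewrite le_eqVlt; apply/orP; left; apply/eqP.
  by field.
exists (block_mx be%:M (be^-1 *: v^T) 0 G).
rewrite tr_block_mx mulmx_block trmx0 !mul0mx !mulmx0 !addr0 GE SE !tr_scalar_mx.
rewrite -scalar_mxM -expr2 be2 mul_scalar_mx scalerA beV mul_mx_scalar.
rewrite linearZ/= trmxK scalerA -[X in block_mx _ _ X _]trmxK linearZ/= beV trmxK.
by rewrite -scalemxAl -scalemxAr scalerA -invfM -expr2 be2 addrC subrK.
Qed.

End gram.

(** * The law of the maximum of a linear image of a Gaussian vector *)

Section law.
Context {R : realType}.

(* tuples carry the product sigma-algebra *)
Let tup n (v : 'rV[R]_n) : n.-tuple R := [tuple v 0 i | i < n].

Let boxes n : set (set (n.-tuple R)) :=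
  [set E | exists B : 'I_n -> set R, (forall i, measurable (B i)) /\
     E = [set t | forall i, B i (tnth t i)]].

Let measurable_boxes n : measurable = <<s @boxes n >>.
Proof.
apply/seteqP; split.
  apply: smallest_sub; first exact: smallest_sigma_algebra.
  rewrite -bigcup_seq; apply: bigcup_sub => /= i _ _ [B mB <-]; apply: sub_sigma_algebra.
  exists (fun k => if k == i then B else setT); split.
    by move=> k; case: ifP.
  apply/seteqP; split=> t /=; first by move=> [_ Bt] k; case: eqP => [->|].
  by move=> /(_ i); rewrite eqxx.
apply: smallest_sub; first exact: sigma_algebra_measurable.
move=> _ [B [mB ->]].
have -> : [set t : n.-tuple R | forall i, B i (tnth t i)] =
    \bigcap_(i in [set: 'I_n]) ((fun t => tnth t i) @^-1` B i).
  by apply/seteqP; split=> t /= h i; [move=> _; exact: h|exact: (h i I)].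
apply: fin_bigcap_measurable; first exact: finite_finset.
move=> i _; rewrite -[X in measurable X]setTI.
exact: (measurable_tnth i).
Qed.

Let measurable_tup n d (T : measurableType d) (Z : T -> 'rV[R]_n) :
  (forall i, measurable_fun setT (fun w => Z w 0 i)) ->
  measurable_fun setT (@tup n \o Z).
Proof.
move=> mZ; apply/measurable_fun_tnthP => i.
by rewrite (_ : _ \o _ = (fun w => Z w 0 i))//; apply/funext => w /=; rewrite tnth_mktuple.
Qed.

Lemma gaussian_law n d (T : measurableType d) (P : probability T R) (Z : T -> 'rV[R]_n)
    d' (T' : measurableType d') (P' : probability T' R) (Z' : T' -> 'rV[R]_n)
    (E : set (n.-tuple R)) :
  gaussian_vector P Z -> gaussian_vector P' Z' -> measurable E ->
  P [set w | E (tup (Z w))] = P' [set w | E (tup (Z' w))].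
Proof.
move=> [mZ PZ] [mZ' PZ'] mE.
pose m1 : {measure set (n.-tuple R) -> \bar R} :=
  @measure_function_pushforward__canonical__measure_function_Measure _ _ _ _ _ P _ (measurable_tup mZ).
pose m2 : {measure set (n.-tuple R) -> \bar R} :=
  @measure_function_pushforward__canonical__measure_function_Measure _ _ _ _ _ P' _ (measurable_tup mZ').
have box d0 (T0 : measurableType d0) (Z0 : T0 -> 'rV[R]_n) B :
    (@tup n \o Z0) @^-1` [set t | forall i, B i (tnth t i)] = [set w | forall i, B i (Z0 w 0 i)].
  by apply/seteqP; split=> w /= h i; have := h i; rewrite tnth_mktuple.
suff : m1 E = m2 E by [].
apply: (measure_unique (@boxes n) (fun=> setT)) => //.
- exact: measurable_boxes.
- move=> _ _ [B [mB ->]] [C [mC ->]]; exists (fun i => B i `&` C i); split.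
    by move=> i; exact: measurableI.
  apply/seteqP; split=> t /=; first by move=> [hB hC] i.
  by move=> h; split=> i; have [] := h i.
- move=> _; exists (fun=> setT); split => //.
  by apply/seteqP; split.
- by rewrite bigcup_const//; exists 0%N.
- by move=> _ [B [mB ->]]; rewrite /m1 /m2 /= /pushforward !box PZ// PZ'.
- by move=> k; rewrite /m1/= /pushforward preimage_setT probability_setT ltry.
Qed.

Definition exceeds p (v : 'rV[R]_p) (l : R) : Prop := exists j, l < `|v 0 j|.

Lemma measurable_exceeds n p (M : 'M[R]_(n, p)) l d (T : measurableType d) (Z : T -> 'rV[R]_n) :
  (forall i, measurable_fun setT (fun w => Z w 0 i)) ->
  measurable [set w | exceeds (Z w *m M) l].
Proof.
move=> mZ.
have -> : [set w | exceeds (Z w *m M) l] =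
    \bigcup_(j in [set: 'I_p]) [set w | l < `|(Z w *m M) 0 j|].
  by apply/seteqP; split=> w /= [j]; [exists j|move=> _; exists j].
apply: fin_bigcup_measurable; first exact: finite_finset.
move=> j _; rewrite -[X in measurable X]setTI.
have mf : measurable_fun setT (fun w => `|(Z w *m M) 0 j|).
  apply: measurableT_comp => //; under eq_fun do rewrite mxE.
  apply: measurable_sum => i; exact: measurable_funM.
have -> : [set w | l < `|(Z w *m M) 0 j|] =
    (fun w => `|(Z w *m M) 0 j|) @^-1` `]l, +oo[%classic.
  by apply/seteqP; split=> w /=; rewrite in_itv/= andbT.
exact: mf.
Qed.

(** The law of a Gaussian vector is determined by its values on boxes, which is
what allows one to change the probability space. *)
Lemma exceeds_law n p (M : 'M[R]_(n, p)) l
    d (T : measurableType d) (P : probability T R) (Z : T -> 'rV[R]_n)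
    d' (T' : measurableType d') (P' : probability T' R) (Z' : T' -> 'rV[R]_n) :
  gaussian_vector P Z -> gaussian_vector P' Z' ->
  P [set w | exceeds (Z w *m M) l] = P' [set w | exceeds (Z' w *m M) l].
Proof.
move=> gZ gZ'; pose row (t : n.-tuple R) : 'rV[R]_n := \row_i tnth t i.
have rowK (v : 'rV[R]_n) : row (tup v) = v.
  by apply/rowP => i; rewrite mxE tnth_mktuple.
have mE : measurable [set t | exceeds (row t *m M) l].
  apply: measurable_exceeds => i; under eq_fun do rewrite mxE.
  exact: measurable_tnth.
have := gaussian_law gZ gZ' mE.
rewrite [X in P X = _ -> _](_ : _ = [set w | exceeds (Z w *m M) l]); last first.
  by apply/seteqP; split=> w /=; rewrite rowK.
rewrite [X in _ = P' X -> _](_ : _ = [set w | exceeds (Z' w *m M) l])//.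
by apply/seteqP; split=> w /=; rewrite rowK.
Qed.

(** A probability space that carries a standard Gaussian vector in dimension [n].
The carrier and its display depend on [n], which is why they are fields. *)
Record gauss_space n := GaussSpace {
  gs_disp : measure_display;
  gs_type : measurableType gs_disp;
  gs_prob : probability gs_type R;
  gs_vec : gs_type -> 'rV[R]_n;
  gs_gauss : gaussian_vector gs_prob gs_vec }.
Arguments gs_vec {n} g.

Lemma gauss_space0 : gaussian_vector (gauss1 R) (fun=> 0 : 'rV[R]_0).
Proof.
split=> [[]//|B mB]; rewrite big_ord0 -[RHS](probability_setT (gauss1 R)).
by congr (gauss1 R _); apply/seteqP; split=> // w _ [].
Qed.

Lemma gaussian_vector_snoc n d (T : measurableType d) (P : probability T R) (Z : T -> 'rV[R]_n) :
  gaussian_vector P Z ->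
  gaussian_vector (P \x gauss1 R)%E (fun w => row_mx (w.2%:M : 'rV[R]_1) (Z w.1)).
Proof.
move=> [mZ PZ]; split.
  move=> i; case: (split_ordP i) => k ->.
    under eq_fun do rewrite row_mxEl mxE (ord1 k) eqxx mulr1n.
    exact: measurable_snd.
  under eq_fun do rewrite row_mxEr.
  exact: (measurableT_comp (mZ k)).
move=> B mB.
rewrite big_split_ord/= big_ord1 -PZ//.
pose A := [set w | forall i, B (rshift 1 i) (Z w 0 i)].
transitivity ((P \x gauss1 R)%E (A `*` B (lshift n 0))).
  congr (product_measure1 _ _ _); apply/seteqP; split=> w /=.
    move=> h; split; first by move=> i; have := h (rshift 1 i); rewrite row_mxEr.
    by have := h (lshift n 0); rewrite row_mxEl mxE eqxx mulr1n.
  move=> [hA hB] i; case: (split_ordP i) => k ->; last by rewrite row_mxEr; exact: hA.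
  by rewrite row_mxEl mxE (ord1 k) eqxx mulr1n.
rewrite muleC; apply: product_measure1E; last exact: mB.
have -> : A = [set w | forall i, true -> B (rshift 1 i) (Z w 0 i)].
  by apply/seteqP; split=> w /= h i; [move=> _; exact: h|exact: (h i)].
exact: (@measurable_box _ _ _ _ Z xpredT (fun i => B (rshift 1 i)) mZ (fun i => mB _)).
Qed.

Fixpoint gauss_space_of n : gauss_space n :=
  match n with
  | 0 => GaussSpace gauss_space0
  | n'.+1 => GaussSpace (gaussian_vector_snoc (gs_gauss (gauss_space_of n')))
  end.

(** The reference model makes [tail] a function of the matrix alone; by [tailE]
it may be computed with any Gaussian vector. *)
Definition tail n p (M : 'M[R]_(n, p)) (l : R) : \bar R :=
  gs_prob (gauss_space_of n) [set w | exceeds (gs_vec (gauss_space_of n) w *m M) l].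

Lemma tailE n p (M : 'M[R]_(n, p)) l d (T : measurableType d) (P : probability T R)
    (Z : T -> 'rV[R]_n) : gaussian_vector P Z ->
  P [set w | exceeds (Z w *m M) l] = tail M l.
Proof. by move=> gZ; exact: exceeds_law (gs_gauss _). Qed.

End law.
Arguments gs_vec {R n} g.
Arguments gauss_space_of {R} n.

(** * Comparison of Gaussian tails *)

Lemma cvge0_lt (R : realType) (I : Type) (F : set_system I) {FF : Filter F}
    (f : I -> \bar R) (e : R) :
  f @ F --> 0%E -> 0 < e -> \forall x \near F, (f x < e%:E)%E.
Proof.
move=> f0 e0; apply: (f0 [set y | (y < e%:E)%E]); apply: open_nbhs_nbhs; split.
  exact: open_ereal_lt_ereal.
by rewrite /= lte_fin.
Qed.

Lemma measure_decreasing_small d (T : measurableType d) (R : realType)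
    (P : probability T R) (F : (set T)^nat) (e : R) :
  (forall k, measurable (F k)) -> nonincreasing_seq F -> P (\bigcap_k F k) = 0%E ->
  0 < e -> exists k, (P (F k) < e%:E)%E.
Proof.
move=> mF dF F0 e0.
have fin : (P (F 0%N) < +oo)%E by rewrite (le_lt_trans (probability_le1 _ (mF _)))// ltry.
have := nonincreasing_cvg_mu fin mF (bigcapT_measurable mF) dF.
rewrite [X in _ --> X]F0 => /cvge0_lt/(_ e0)[k _ /(_ k (leqnn k)) h].
by exists k.
Qed.

Section tails.
Context {R : realType}.

Lemma gaussian_vector_lsub n1 n2 d (T : measurableType d) (P : probability T R)
    (Z : T -> 'rV[R]_(n1 + n2)) :
  gaussian_vector P Z -> gaussian_vector P (fun w => lsubmx (Z w)).
Proof.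
move=> [mZ PZ]; split; first by move=> i; under eq_fun do rewrite mxE; exact: mZ.
move=> B mB.
pose B' (i : 'I_(n1 + n2)) := if fintype.split i is inl k then B k else setT.
have B'l k : B' (lshift n2 k) = B k by rewrite /B' (unsplitK (inl k)).
have B'r k : B' (rshift n1 k) = setT by rewrite /B' (unsplitK (inr k)).
transitivity (P [set w | forall i, B' i (Z w 0 i)]).
  congr (P _); apply/seteqP; split=> w /= h i.
    case: (split_ordP i) => k ->; first by have := h k; rewrite B'l mxE.
    by rewrite B'r.
  by have := h (lshift n2 i); rewrite B'l mxE.
rewrite PZ; last by move=> i; rewrite /B'; case: fintype.split => // k.
rewrite big_split_ord/= [X in (_ * X)%E]big1 ?mule1; last first.
  by move=> k _; rewrite B'r; exact: (probability_setT (gauss1 R)).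
by apply: eq_bigr => k _; rewrite B'l.
Qed.

Lemma gaussian_vector_rsub n1 n2 d (T : measurableType d) (P : probability T R)
    (Z : T -> 'rV[R]_(n1 + n2)) :
  gaussian_vector P Z -> gaussian_vector P (fun w => rsubmx (Z w)).
Proof.
move=> [mZ PZ]; split; first by move=> i; under eq_fun do rewrite mxE; exact: mZ.
move=> B mB.
pose B' (i : 'I_(n1 + n2)) := if fintype.split i is inr k then B k else setT.
have B'l k : B' (lshift n2 k) = setT by rewrite /B' (unsplitK (inl k)).
have B'r k : B' (rshift n1 k) = B k by rewrite /B' (unsplitK (inr k)).
transitivity (P [set w | forall i, B' i (Z w 0 i)]).
  congr (P _); apply/seteqP; split=> w /= h i.
    case: (split_ordP i) => k ->; last by have := h k; rewrite B'r mxE.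
    by rewrite B'l.
  by have := h (rshift n1 i); rewrite B'r mxE.
rewrite PZ; last by move=> i; rewrite /B'; case: fintype.split => // k.
rewrite big_split_ord/= [X in (X * _)%E]big1 ?mul1e; last first.
  by move=> k _; rewrite B'l; exact: (probability_setT (gauss1 R)).
by apply: eq_bigr => k _; rewrite B'r.
Qed.

Let gs_meas n p (M : 'M[R]_(n, p)) l :
  measurable [set w | exceeds (gs_vec (@gauss_space_of R n) w *m M) l].
Proof. by apply: measurable_exceeds; case: (gs_gauss (@gauss_space_of R n)). Qed.

Lemma tail_isotropic n p (M : 'M[R]_(n, p)) (Q : 'M[R]_n) l :
  isotropic (mulmx^~ Q) -> tail (Q *m M) l = tail M l.
Proof.
move=> iQ; rewrite -(tailE M l (iQ _ _ _ _ (gs_gauss (gauss_space_of n)))).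
by rewrite /tail; congr (gs_prob _ _); apply/seteqP; split=> w /=; rewrite mulmxA.
Qed.

Lemma tail_col_mx0 n1 n2 p (M : 'M[R]_(n1, p)) l :
  tail (col_mx M (0 : 'M[R]_(n2, p))) l = tail M l.
Proof.
rewrite -(tailE M l (gaussian_vector_lsub (gs_gauss (gauss_space_of (n1 + n2))))).
have E (x : 'rV[R]_(n1 + n2)) : x *m col_mx M (0 : 'M[R]_(n2, p)) = lsubmx x *m M.
  by rewrite -[in LHS](hsubmxK x) mul_row_col mulmx0 addr0.
by rewrite /tail; congr (gs_prob _ _); apply/seteqP; split=> w /=; rewrite E.
Qed.

Lemma tail_col_0mx n1 n2 p (M : 'M[R]_(n2, p)) l :
  tail (col_mx (0 : 'M[R]_(n1, p)) M) l = tail M l.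
Proof.
rewrite -(tailE M l (gaussian_vector_rsub (gs_gauss (gauss_space_of (n1 + n2))))).
have E (x : 'rV[R]_(n1 + n2)) : x *m col_mx (0 : 'M[R]_(n1, p)) M = rsubmx x *m M.
  by rewrite -[in LHS](hsubmxK x) mul_row_col mulmx0 add0r.
by rewrite /tail; congr (gs_prob _ _); apply/seteqP; split=> w /=; rewrite E.
Qed.

(** After padding both matrices by zeros to a common height, the one is obtained
from the other by reflections, which preserve the law of the Gaussian vector. *)
Lemma tail_gram n1 n2 p (M1 : 'M[R]_(n1, p)) (M2 : 'M[R]_(n2, p)) l :
  M1^T *m M1 = M2^T *m M2 -> tail M1 l = tail M2 l.
Proof.
move=> M12; rewrite -(tail_col_mx0 n2 M1) -(tail_col_0mx n1 M2).
have [|Q [iQ <-]] := @gram_isotropic R _ _ (col_mx M1 (0 : 'M[R]_(n2, p))) (col_mx (0 : 'M[R]_(n1, p)) M2).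
  by rewrite !tr_col_mx !mul_row_col !trmx0 !mulmx0 addr0 add0r.
by rewrite tail_isotropic.
Qed.

Lemma exceeds_add p (x y : 'rV[R]_p) l1 l2 : exceeds (x + y) (l1 + l2) ->
  exceeds x l1 \/ exceeds y l2.
Proof.
move=> [j h]; have [hx|hx] := ltP l1 `|x 0 j|; first by left; exists j.
right; exists j; rewrite ltNge; apply/negP => hy.
move: h; rewrite ltNge => /negP; apply; rewrite mxE.
by rewrite (le_trans (ler_normD _ _))// lerD.
Qed.

(** [x] is the midpoint of [x + y] and [x - y]. *)
Lemma exceeds_avg p (x y : 'rV[R]_p) l : exceeds x l ->
  exceeds (x + y) l \/ exceeds (x - y) l.
Proof.
move=> [j h].
have [hx|hx] := ltP l `|(x + y) 0 j|; first by left; exists j.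
right; exists j; rewrite ltNge; apply/negP => hy.
move: h; rewrite ltNge => /negP; apply.
have e : (x + y) 0 j + (x - y) 0 j = 2 * x 0 j by rewrite !mxE; ring.
have := le_trans (ler_normD _ _) (lerD hx hy).
by rewrite e normrM ger0_norm//; lra.
Qed.

Lemma tail_col_mx n1 n2 p (M1 : 'M[R]_(n1, p)) (M2 : 'M[R]_(n2, p)) l1 l2 :
  (tail (col_mx M1 M2) (l1 + l2) <= tail M1 l1 + tail M2 l2)%E.
Proof.
have gl := gaussian_vector_lsub (gs_gauss (@gauss_space_of R (n1 + n2))).
have gr := gaussian_vector_rsub (gs_gauss (@gauss_space_of R (n1 + n2))).
rewrite -(tailE M1 l1 gl) -(tailE M2 l2 gr).
have m1 := measurable_exceeds M1 l1 gl.1; have m2 := measurable_exceeds M2 l2 gr.1.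
apply: le_trans (measureU2 _ m1 m2); apply: le_measure; rewrite ?inE//.
- exact: measurableU.
- move=> w /=; rewrite -{1}(hsubmxK (gs_vec _ w)) mul_row_col; exact: exceeds_add.
Qed.

(** The comparison principle. Let [G] satisfy [G^T G = M2^T M2 - M1^T M1]. If [U]
and [W] are independent Gaussian vectors with covariances given by [M1] and [G],
both [U + W] and [U - W] have the law given by [M2], and at least one of them
exceeds the level that [U] exceeds. Anderson's inequality would replace the
factor 2 by 1; for boundedness of the paths the constant is irrelevant. *)
Lemma tail_dom n1 n2 p (M1 : 'M[R]_(n1, p)) (M2 : 'M[R]_(n2, p)) l :
  (forall a, sqn M1 a <= sqn M2 a) -> (tail M1 l <= tail M2 l + tail M2 l)%E.
Proof.
move=> M12.
have [||G GE] := @psd_gram R p (M2^T *m M2 - M1^T *m M1).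
- by rewrite linearB/= !trmx_mul !trmxK.
- move=> a; rewrite mulmxBr mulmxBl !mxE subr_ge0.
  by have := M12 a; rewrite !sqnE !mxE.
have e1 : tail (col_mx M1 G) l = tail M2 l.
  by apply: tail_gram; rewrite tr_col_mx mul_row_col GE addrC subrK.
have e2 : tail (col_mx M1 (- G)) l = tail M2 l.
  apply: tail_gram; rewrite tr_col_mx mul_row_col [(- G)^T]linearN/= mulmxN mulNmx opprK.
  by rewrite GE addrC subrK.
have gl := gaussian_vector_lsub (gs_gauss (@gauss_space_of R (n1 + p))).
rewrite -{1}e1 -e2 -(tailE M1 l gl).
apply: le_trans (measureU2 _ _ _); [apply: le_measure; rewrite ?inE//|exact: gs_meas..].
- exact: measurable_exceeds gl.1.
- by apply: measurableU; exact: gs_meas.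
- move=> w /=; rewrite -{2 3}(hsubmxK (gs_vec _ w)) !mul_row_col.
  by rewrite mulmxN; exact: exceeds_avg.
Qed.

Lemma tailZ n p (M : 'M[R]_(n, p)) k l : 0 < k -> tail (k *: M) (k * l) = tail M l.
Proof.
move=> k0; rewrite /tail; congr (gs_prob _ _); apply/seteqP.
have E (x : 'rV[R]_n) j : `|(x *m (k *: M)) 0 j| = k * `|(x *m M) 0 j|.
  by rewrite -scalemxAr [in LHS]mxE normrM gtr0_norm.
by split=> w /= [j h]; exists j; move: h; rewrite E ltr_pM2l.
Qed.

Lemma tail_le n p (M : 'M[R]_(n, p)) l l' : l <= l' -> (tail M l' <= tail M l)%E.
Proof.
move=> ll; apply: le_measure; rewrite ?inE//; [exact: gs_meas..|].
by move=> w /= [j h]; exists j; exact: le_lt_trans h.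
Qed.

(** The events decrease to the empty set, because a finite family is bounded. *)
Lemma tail_cvg0 n p (M : 'M[R]_(n, p)) (e : R) : 0 < e ->
  exists L, forall l, L <= l -> (tail M l <= e%:E)%E.
Proof.
move=> e0.
pose F (k : nat) := [set w | exceeds (gs_vec (gauss_space_of n) w *m M) k%:R].
have mF k : measurable (F k) by exact: gs_meas.
have F0 : \bigcap_k F k = set0.
  apply/seteqP; split=> // w /= h.
  pose s : R := \sum_j `|(gs_vec (gauss_space_of n) w *m M) 0 j|.
  have s0 : 0 <= s by apply: sumr_ge0.
  have [j] := h (Num.bound s) I.
  apply/negP; rewrite -leNgt (le_trans _ (ltW (archi_boundP s0)))//.
  by rewrite /s (bigD1 j)//= lerDl sumr_ge0.
have dF : nonincreasing_seq F.
  move=> a b ab; apply/subsetPset => w /= [j h]; exists j.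
  by apply: le_lt_trans h; rewrite ler_nat.
have PF0 : gs_prob (gauss_space_of n) (\bigcap_k F k) = 0%E by rewrite F0 measure0.
have [k Fk] := measure_decreasing_small mF dF PF0 e0.
by exists k%:R => l kl; exact: le_trans (tail_le M kl) (ltW Fk).
Qed.

End tails.

(** * Complex Gaussian families as real Gaussian vectors *)

Section complex_parts.
Context {R : realType}.
Implicit Types x y z : R[i].
Notation Re := (@complex.Re R).
Notation Im := (@complex.Im R).

Lemma complexP x y : Re x = Re y -> Im x = Im y -> x = y.
Proof. by case: x => a b; case: y => c d /= -> ->. Qed.

Lemma ReD x y : Re (x + y) = Re x + Re y. Proof. by case: x; case: y. Qed.
Lemma ImD x y : Im (x + y) = Im x + Im y. Proof. by case: x; case: y. Qed.
Lemma ReN x : Re (- x) = - Re x. Proof. by case: x. Qed.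
Lemma ImN x : Im (- x) = - Im x. Proof. by case: x. Qed.
Lemma ReB x y : Re (x - y) = Re x - Re y. Proof. by rewrite ReD ReN. Qed.
Lemma ImB x y : Im (x - y) = Im x - Im y. Proof. by rewrite ImD ImN. Qed.
Lemma ReM x y : Re (x * y) = Re x * Re y - Im x * Im y.
Proof. by case: x; case: y. Qed.
Lemma ImM x y : Im (x * y) = Re x * Im y + Im x * Re y.
Proof. by case: x; case: y => a b c d /=; rewrite addrC. Qed.
Lemma Re_conjc x : Re (conjc x) = Re x. Proof. by case: x. Qed.
Lemma Im_conjc x : Im (conjc x) = - Im x. Proof. by case: x. Qed.

Lemma Re_sum I (s : seq I) (Q : pred I) (F : I -> R[i]) :
  Re (\sum_(i <- s | Q i) F i) = \sum_(i <- s | Q i) Re (F i).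
Proof. by apply: big_morph => //; exact: ReD. Qed.

Lemma Im_sum I (s : seq I) (Q : pred I) (F : I -> R[i]) :
  Im (\sum_(i <- s | Q i) F i) = \sum_(i <- s | Q i) Im (F i).
Proof. by apply: big_morph => //; exact: ImD. Qed.

Definition complexE := (ReD, ImD, ReN, ImN, ReM, ImM, Re_conjc, Im_conjc).

Lemma sqr_normc x : normc x ^+ 2 = Re x ^+ 2 + Im x ^+ 2.
Proof. by case: x => a b /=; rewrite sqr_sqrtr// addr_ge0// sqr_ge0. Qed.

Lemma normc_ge0 x : 0 <= normc x.
Proof. by case: x => a b; exact: sqrtr_ge0. Qed.

Lemma normr_Re_le x : `|Re x| <= normc x.
Proof.
rewrite -(ler_pXn2r (ltn0Sn 1)) ?nnegrE ?normc_ge0// sqr_normc.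
by rewrite real_normK ?num_real// lerDl sqr_ge0.
Qed.

Lemma normc_le_add x : normc x <= `|Re x| + `|Im x|.
Proof.
rewrite -(ler_pXn2r (ltn0Sn 1)) ?nnegrE ?normc_ge0 ?addr_ge0// sqr_normc.
rewrite sqrrD !real_normK ?num_real//.
have : 0 <= `|Re x| * `|Im x| *+ 2 by rewrite mulrn_wge0// mulr_ge0.
lra.
Qed.

End complex_parts.
Notation Re := (@complex.Re _).
Notation Im := (@complex.Im _).

Section complex_gaussian.
Context {R : realType} d (Omega : measurableType d) (P : probability Omega R).
Variables (A : set int) (Z : int -> Omega -> R[i]).
Hypothesis iidZ : iid_std_complex_gaussian P A Z.

Definition reim_row q (s : 'I_q -> int) (w : Omega) : 'rV[R]_(q + q) :=
  row_mx (\row_i Re (Z (s i) w)) (\row_i Im (Z (s i) w)).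

(** Independence is stated for families of planar sets indexed by distinct
integers; a box in dimension [2 q] is such a family, made of rectangles. *)
Lemma gaussian_vector_reim q (s : 'I_q -> int) : injective s ->
  (forall i, A (s i)) -> gaussian_vector P (reim_row s).
Proof.
move=> sI sA; have [gZ indZ] := iidZ; split.
  move=> i; have [mZ _] := gZ _ (sA (match fintype.split i with inl k => k | inr k => k end)).
  case: (split_ordP i) mZ => k ->; rewrite ?(unsplitK (inl k)) ?(unsplitK (inr k)) => mZ.
    under eq_fun do rewrite row_mxEl mxE.
    exact: (measurableT_comp measurable_fst mZ).
  under eq_fun do rewrite row_mxEr mxE.
  exact: (measurableT_comp measurable_snd mZ).
move=> B mB.
pose J : {fset int} := [fset n in codom s]%fset.
pose C n : set (R * R) := if [pick i | s i == n] is Some i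
  then B (lshift q i) `*` B (rshift q i) else setT.
have mC n : measurable (C n).
  by rewrite /C; case: pickP => // i _; exact: measurableX.
have Cs i : C (s i) = B (lshift q i) `*` B (rshift q i).
  rewrite /C; case: pickP => [k /eqP/sI ->//|/(_ i)]; by rewrite eqxx.
have JA : [set` J] `<=` A.
  by move=> n /=; rewrite !inE => /mapP[i _ ->]; exact: sA.
transitivity (P (\bigcap_(n in [set` J]) ((@reim R \o Z n) @^-1` C n))).
  congr (P _); apply/seteqP; split=> w /=.
    move=> h n /=; rewrite !inE => /mapP[i _ ->]; rewrite Cs; split=> /=.
      by have := h (lshift q i); rewrite row_mxEl mxE.
    by have := h (rshift q i); rewrite row_mxEr mxE.
  move=> h i; case: (split_ordP i) => k ->.
    have : C (s k) (reim (Z (s k) w)) by apply: h; rewrite /= !inE; exact: codom_f.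
    by rewrite Cs row_mxEl mxE => -[].
  have : C (s k) (reim (Z (s k) w)) by apply: h; rewrite /= !inE; exact: codom_f.
  by rewrite Cs row_mxEr mxE => -[].
rewrite indZ//.
have -> : (\prod_(n <- J) P ((@reim R \o Z n) @^-1` C n))%E =
    (\prod_(i < q) P ((@reim R \o Z (s i)) @^-1` C (s i)))%E.
  rewrite (perm_big (codom s)); last first.
    apply: uniq_perm; [exact: fset_uniq|by rewrite map_inj_uniq ?enum_uniq|].
    by move=> n; rewrite !inE.
  by rewrite big_map enumT.
rewrite big_split_ord/= -big_split/=; apply: eq_bigr => i _.
by rewrite (gZ _ (sA i)).2// Cs; exact: gauss2X.
Qed.

(** The sign comes from [Re (c * z) = Re c * Re z - Im c * Im z]. *)
Definition coef_mx q p (c : 'I_q -> 'I_p -> R[i]) : 'M[R]_(q + q, p) :=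
  col_mx (\matrix_(i, j) Re (c i j)) (\matrix_(i, j) - Im (c i j)).

Lemma reim_row_coef_mx q p (s : 'I_q -> int) (c : 'I_q -> 'I_p -> R[i]) w j :
  (reim_row s w *m coef_mx c) 0 j = Re (\sum_i c i j * Z (s i) w).
Proof.
rewrite mul_row_col !mxE Re_sum -big_split/=; apply: eq_bigr => i _.
by rewrite !mxE !complexE; ring.
Qed.

End complex_gaussian.

Lemma sqn_coef_mx (R : realType) q p (c : 'I_q -> 'I_p -> R[i]) (a : 'cV[R]_p) :
  sqn (coef_mx c) a = \sum_i normc (\sum_j (a j 0)%:C%C * c i j) ^+ 2.
Proof.
rewrite /sqn big_split_ord/= -big_split/=; apply: eq_bigr => i _.
rewrite mul_col_mx !(col_mxEu, col_mxEd) sqr_normc Re_sum Im_sum !mxE.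
congr (_ ^+ 2 + _).
  by apply: eq_bigr => j _; rewrite !mxE !complexE/=; ring.
rewrite -[RHS]sqrrN -sumrN; congr (_ ^+ 2).
by apply: eq_bigr => j _; rewrite !mxE !complexE/=; ring.
Qed.

Lemma sqn_col_mx (R : realType) n1 n2 p (M1 : 'M[R]_(n1, p)) (M2 : 'M[R]_(n2, p)) a :
  sqn (col_mx M1 M2) a = sqn M1 a + sqn M2 a.
Proof.
rewrite /sqn big_split_ord/=; congr (_ + _); apply: eq_bigr => i _.
  by rewrite mul_col_mx col_mxEu.
by rewrite mul_col_mx col_mxEd.
Qed.

Lemma sqnZ (R : realType) n p (k : R) (M : 'M[R]_(n, p)) a :
  sqn (k *: M) a = k ^+ 2 * sqn M a.
Proof.
by rewrite /sqn mulr_sumr; apply: eq_bigr => i _; rewrite -scalemxAl mxE exprMn.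
Qed.

(** Independent copies of the vectors given by [M0] and the [F k] are added up:
the variances add, and the sum exceeds the total level only if one of the
terms exceeds its share of it. *)
Lemma tail_stack (R : realType) q p (F : nat -> 'M[R]_(q, p)) n0 (M0 : 'M[R]_(n0, p))
    (l0 l : R) N :
  exists n (M : 'M[R]_(n, p)),
    (forall a, sqn M a = sqn M0 a + \sum_(k < N) sqn (F k) a) /\
    (tail M (l0 + l *+ N) <= tail M0 l0 + \sum_(k < N) tail (F k) l)%E.
Proof.
elim: N => [|N [n [M [sM tM]]]].
  by exists n0, M0; split=> [a|]; rewrite ?big_ord0 ?addr0// mulr0n addr0 adde0.
exists (n + q)%N, (col_mx M (F N)); split=> [a|].
  by rewrite sqn_col_mx sM big_ord_recr/= addrA.
rewrite mulrSr addrA big_ord_recr/= addeA.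
by apply: le_trans (tail_col_mx _ _ _ _) _; exact: leeD2r.
Qed.

(** * Hilbert space calculus in complex square-integrable functions *)

Section L2.
Context {R : realType} d (T : measurableType d) (m : {measure set T -> \bar R}).
Implicit Types g h : T -> R[i].

Lemma cmeasurableP h : cmeasurable_fun h <->
  measurable_fun setT (Re \o h) /\ measurable_fun setT (Im \o h).
Proof.
split=> [mh|[mr mi]]; last exact: measurable_fun_pair.
by split; [exact: (measurableT_comp measurable_fst mh)|
           exact: (measurableT_comp measurable_snd mh)].
Qed.

Lemma measurable_sqr_normc h : cmeasurable_fun h ->
  measurable_fun setT (fun x => normc (h x) ^+ 2).
Proof.
move=> /cmeasurableP[mr mi]; under eq_fun do rewrite sqr_normc.
by apply: measurable_funD; exact: measurable_funX.
Qed.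

Definition cintegrable h : Prop :=
  m.-integrable setT (EFin \o (Re \o h)) /\ m.-integrable setT (EFin \o (Im \o h)).

Lemma cintegralD g h : cintegrable g -> cintegrable h ->
  cintegral m (fun x => g x + h x) = cintegral m g + cintegral m h.
Proof.
move=> [g1 g2] [h1 h2]; apply: complexP; rewrite ?complexE/= -RintegralD//.
  by apply: eq_Rintegral => x _; rewrite complexE.
by apply: eq_Rintegral => x _; rewrite complexE.
Qed.

Lemma cintegralZ (c : R[i]) h : cintegrable h ->
  cintegral m (fun x => c * h x) = c * cintegral m h.
Proof.
move=> [h1 h2].
have Z (k : R) f : m.-integrable setT (EFin \o f) -> m.-integrable setT (EFin \o (fun x => k * f x)).
  move=> /(integrableZl measurableT k); congr (_.-integrable _ _).
apply: complexP; rewrite complexE/= -!RintegralZl// -?RintegralB -?RintegralD//; try exact: Z.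
  by apply: eq_Rintegral => x _; rewrite complexE.
by apply: eq_Rintegral => x _; rewrite complexE.
Qed.

Lemma cintegral0 : cintegral m (fun=> 0) = 0.
Proof. by apply: complexP; rewrite /= /Rintegral integral0. Qed.

Lemma cintegral_conj h : cintegrable h ->
  cintegral m (fun x => conjc (h x)) = conjc (cintegral m h).
Proof.
move=> [h1 h2]; apply: complexP; rewrite complexE/=.
  by apply: eq_Rintegral => x _; rewrite complexE.
rewrite -mulN1r -RintegralZl//.
by apply: eq_Rintegral => x _; rewrite complexE mulN1r.
Qed.

Lemma in_L2_integrable h : in_L2 m h -> m.-integrable setT (fun x => (normc (h x) ^+ 2)%:E).
Proof.
move=> [mh fh]; apply/integrableP; split.
  exact/measurable_EFinP/measurable_sqr_normc.
by under eq_integral do rewrite gee0_abs ?lee_fin ?sqr_ge0//.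
Qed.

Lemma in_L2_le g h : cmeasurable_fun g ->
  m.-integrable setT (fun x => (normc (h x) ^+ 2)%:E) ->
  (forall x, normc (g x) <= normc (h x)) -> in_L2 m g.
Proof.
move=> mg ih gh; split => //.
have /integrableP[mh] := ih; apply: le_lt_trans; apply: ge0_le_integral => //.
- by move=> x _; rewrite lee_fin sqr_ge0.
- exact/measurable_EFinP/measurable_sqr_normc.
- exact: measurableT_comp.
- move=> x _; rewrite gee0_abs ?lee_fin ?sqr_ge0//.
  by rewrite lerXn2r ?nnegrE ?normc_ge0.
Qed.

Lemma cmeasurableD g h : cmeasurable_fun g -> cmeasurable_fun h ->
  cmeasurable_fun (fun x => g x + h x).
Proof.
move=> /cmeasurableP[g1 g2] /cmeasurableP[h1 h2]; apply/cmeasurableP; split.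
  by under [_ \o _]eq_fun do rewrite /= complexE; exact: measurable_funD.
by under [_ \o _]eq_fun do rewrite /= complexE; exact: measurable_funD.
Qed.

Lemma cmeasurableM g h : cmeasurable_fun g -> cmeasurable_fun h ->
  cmeasurable_fun (fun x => g x * h x).
Proof.
move=> /cmeasurableP[g1 g2] /cmeasurableP[h1 h2]; apply/cmeasurableP; split.
  under [_ \o _]eq_fun do rewrite /= complexE.
  by apply: measurable_funB; exact: measurable_funM.
under [_ \o _]eq_fun do rewrite /= complexE.
by apply: measurable_funD; exact: measurable_funM.
Qed.

Lemma cmeasurable_cst (c : R[i]) : cmeasurable_fun (cst c : T -> R[i]).
Proof. exact: (measurable_cst (reim c)). Qed.

Lemma sqr_normcD (x y : R[i]) : normc (x + y) ^+ 2 <= 2 * (normc x ^+ 2 + normc y ^+ 2).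
Proof.
rewrite !sqr_normc !complexE.
have := sqr_ge0 (Re x - Re y); have := sqr_ge0 (Im x - Im y); nra.
Qed.

Lemma L2sqnormD g h : cmeasurable_fun g -> cmeasurable_fun h ->
  (L2sqnorm m (fun x => (g x + h x)%R) <= 2%:E * (L2sqnorm m g + L2sqnorm m h))%E.
Proof.
move=> mg mh; rewrite /L2sqnorm -ge0_integralD//; last 4 first.
- by move=> x _; rewrite lee_fin sqr_ge0.
- exact/measurable_EFinP/measurable_sqr_normc.
- by move=> x _; rewrite lee_fin sqr_ge0.
- exact/measurable_EFinP/measurable_sqr_normc.
rewrite -ge0_integralZl//; last 2 first.
- by apply: emeasurable_funD; exact/measurable_EFinP/measurable_sqr_normc.
- by move=> x _; rewrite adde_ge0// lee_fin sqr_ge0.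
apply: ge0_le_integral => //.
- by move=> x _; rewrite lee_fin sqr_ge0.
- exact/measurable_EFinP/measurable_sqr_normc/cmeasurableD.
- apply: emeasurable_funM => //.
  by apply: emeasurable_funD; exact/measurable_EFinP/measurable_sqr_normc.
- by move=> x _; rewrite -EFinD -EFinM lee_fin sqr_normcD.
Qed.

Lemma in_L2D g h : in_L2 m g -> in_L2 m h -> in_L2 m (fun x => g x + h x).
Proof.
move=> [mg fg] [mh fh]; split; first exact: cmeasurableD.
apply: le_lt_trans (L2sqnormD mg mh) _.
by rewrite lte_mul_pinfty// ?lee_fin// lte_add_pinfty.
Qed.

Lemma L2sqnormZ (c : R[i]) h : cmeasurable_fun h ->
  L2sqnorm m (fun x => (c * h x)%R) = ((normc c ^+ 2)%:E * L2sqnorm m h)%E.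
Proof.
move=> mh; rewrite /L2sqnorm -ge0_integralZl//; last 3 first.
- exact/measurable_EFinP/measurable_sqr_normc.
- by move=> x _; rewrite lee_fin sqr_ge0.
- by rewrite lee_fin sqr_ge0.
by apply: eq_integral => x _; rewrite -EFinM -exprMn -normcM.
Qed.

Lemma in_L2Z (c : R[i]) h : in_L2 m h -> in_L2 m (fun x => c * h x).
Proof.
move=> [mh fh]; split; first exact: cmeasurableM (cmeasurable_cst c) mh.
by rewrite L2sqnormZ// lte_mul_pinfty// lee_fin sqr_ge0.
Qed.

Lemma in_L2_0 : in_L2 m (fun=> 0).
Proof.
split; first exact: cmeasurable_cst.
by rewrite /L2sqnorm integral0_eq// => x _; rewrite normc0 expr0n.
Qed.

Lemma in_L2_sum I (s : seq I) (Q : pred I) (F : I -> T -> R[i]) :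
  (forall i, Q i -> in_L2 m (F i)) -> in_L2 m (fun x => \sum_(i <- s | Q i) F i x).
Proof.
move=> hF; elim: s => [|i s IH].
  by under eq_fun do rewrite big_nil; exact: in_L2_0.
under eq_fun do rewrite big_cons.
case Qi : (Q i) => //.
by apply: in_L2D => //; exact: hF.
Qed.

Lemma in_L2B g h : in_L2 m g -> in_L2 m h -> in_L2 m (fun x => g x - h x).
Proof.
move=> hg hh; under eq_fun do rewrite -mulN1r.
by apply: in_L2D => //; exact: in_L2Z.
Qed.

Lemma cintegrable_inner g h : in_L2 m g -> in_L2 m h ->
  cintegrable (fun x => g x * conjc (h x)).
Proof.
move=> hg hh.
have /cmeasurableP[g1 g2] := hg.1; have /cmeasurableP[h1 h2] := hh.1.
have ig := in_L2_integrable hg; have ih := in_L2_integrable hh.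
have igh := integrableD measurableT ig ih.
split; apply: (le_integrable measurableT _ _ igh).
- apply/measurable_EFinP; under [_ \o _]eq_fun do rewrite /= !complexE.
  by apply: measurable_funB; apply: measurable_funM => //; exact: measurable_funN.
- move=> x _ /=; rewrite lee_fin [leRHS]ger0_norm ?addr_ge0 ?sqr_ge0//.
  rewrite !sqr_normc !complexE ler_norml; apply/andP; split.
    have := sqr_ge0 (Re (g x) + Re (h x)); have := sqr_ge0 (Im (g x) + Im (h x)); nra.
  have := sqr_ge0 (Re (g x) - Re (h x)); have := sqr_ge0 (Im (g x) - Im (h x)); nra.
- apply/measurable_EFinP; under [_ \o _]eq_fun do rewrite /= !complexE.
  by apply: measurable_funD; apply: measurable_funM => //; exact: measurable_funN.
- move=> x _ /=; rewrite lee_fin [leRHS]ger0_norm ?addr_ge0 ?sqr_ge0//.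
  rewrite !sqr_normc !complexE ler_norml; apply/andP; split.
    have := sqr_ge0 (Re (g x) - Im (h x)); have := sqr_ge0 (Im (g x) + Re (h x)); nra.
  have := sqr_ge0 (Re (g x) + Im (h x)); have := sqr_ge0 (Im (g x) - Re (h x)); nra.
Qed.

Lemma L2innerDl g1 g2 h : in_L2 m g1 -> in_L2 m g2 -> in_L2 m h ->
  L2inner m (fun x => g1 x + g2 x) h = L2inner m g1 h + L2inner m g2 h.
Proof.
move=> h1 h2 hh; rewrite /L2inner -cintegralD; [|exact: cintegrable_inner..].
by congr (cintegral _ _); apply/funext => x; rewrite mulrDl.
Qed.

Lemma L2innerZl (c : R[i]) g h : in_L2 m g -> in_L2 m h ->
  L2inner m (fun x => c * g x) h = c * L2inner m g h.
Proof.
move=> hg hh; rewrite /L2inner -cintegralZ; last exact: cintegrable_inner.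
by congr (cintegral _ _); apply/funext => x; rewrite mulrA.
Qed.

Lemma L2innerC g h : in_L2 m g -> in_L2 m h ->
  L2inner m h g = conjc (L2inner m g h).
Proof.
move=> hg hh; rewrite /L2inner -cintegral_conj; last exact: cintegrable_inner.
by congr (cintegral _ _); apply/funext => x; rewrite rmorphM/= conjcK mulrC.
Qed.

Lemma L2inner_suml I (s : seq I) (F : I -> T -> R[i]) h :
  (forall i, in_L2 m (F i)) -> in_L2 m h ->
  L2inner m (fun x => \sum_(i <- s) F i x) h = \sum_(i <- s) L2inner m (F i) h.
Proof.
move=> hF hh; elim: s => [|i s IH].
  rewrite big_nil -[RHS]cintegral0; congr (cintegral _ _).
  by apply/funext => x; rewrite big_nil mul0r.
rewrite big_cons -IH -L2innerDl//; last exact: in_L2_sum.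
by congr (L2inner _ _ _); apply/funext => x; rewrite big_cons.
Qed.

Lemma L2sqnormE h : in_L2 m h -> L2sqnorm m h = (Re (L2inner m h h))%:E.
Proof.
move=> hh; rewrite /L2inner/= /Rintegral fineK; last first.
  exact: (integrable_fin_num measurableT (cintegrable_inner hh hh).1).
by apply: eq_integral => x _; rewrite sqr_normc !complexE; congr (_%:E); ring.
Qed.

Lemma Re_L2inner_ge0 h : in_L2 m h -> 0 <= Re (L2inner m h h).
Proof.
move=> hh; rewrite -lee_fin -L2sqnormE//.
by apply: integral_ge0 => x _; rewrite lee_fin sqr_ge0.
Qed.

Section bessel.
Variables (q : nat) (e : 'I_q -> T -> R[i]).
Hypothesis eL2 : forall i, in_L2 m (e i).
Hypothesis eo : forall i j, L2inner m (e i) (e j) = (i == j)%:R.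

(** Both Bessel's inequality and the optimality of the Fourier coefficients
follow by choosing the coefficients [c]. *)
Lemma L2_pythagoras h (c : 'I_q -> R[i]) (r := fun x => h x - \sum_i c i * e i x) :
  in_L2 m h ->
  Re (L2inner m r r) = Re (L2inner m h h) - \sum_i normc (L2inner m h (e i)) ^+ 2
    + \sum_i normc (c i - L2inner m h (e i)) ^+ 2.
Proof.
move=> hh; pose S x := \sum_i c i * e i x.
have hce i : in_L2 m (fun x => c i * e i x) by exact: in_L2Z.
have hS : in_L2 m S by exact: in_L2_sum.
have hr : in_L2 m r by exact: in_L2B.
have hNS : in_L2 m (fun x => (-1) * S x) by exact: in_L2Z.
have rE : r = (fun x => h x + (-1) * S x).
  by apply/funext => x; rewrite mulN1r.
have SE g : in_L2 m g -> L2inner m S g = \sum_i c i * L2inner m (e i) g.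
  move=> hg; rewrite /S L2inner_suml//.
  by apply: eq_bigr => i _; rewrite L2innerZl.
have Se i : L2inner m S (e i) = c i.
  rewrite SE// (bigD1 i)//= big1 ?addr0 ?eo ?eqxx ?mulr1// => j ji.
  by rewrite eo (negbTE ji) mulr0.
have eS i : L2inner m (e i) S = conjc (c i) by rewrite (L2innerC hS)// Se.
have er g : in_L2 m g -> Re (L2inner m g r) = Re (L2inner m g h) - Re (L2inner m g S).
  move=> hg; rewrite (L2innerC hr)// {1}rE L2innerDl// L2innerZl//.
  have [-> ->] : L2inner m h g = conjc (L2inner m g h) /\ L2inner m S g = conjc (L2inner m g S).
    by split; exact: L2innerC.
  by rewrite mulN1r !complexE; ring.
have [a aE] : exists a : 'I_q -> R[i], forall i, L2inner m h (e i) = a i.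
  by exists (fun i => L2inner m h (e i)).
have eh i : L2inner m (e i) h = conjc (a i) by rewrite -aE; exact: L2innerC.
under [X in _ = _ - X + _]eq_bigr do rewrite aE.
under [X in _ = _ + X]eq_bigr do rewrite aE.
rewrite {1}rE L2innerDl// L2innerZl// mulN1r ReB !er//.
rewrite (L2innerC hS hh) !SE// !Re_conjc !Re_sum.
rewrite -!sumrN -addrA -big_split/=; rewrite -addrA; congr (_ + _).
rewrite -!sumrN -!big_split/=; apply: eq_bigr => i _.
rewrite eh; move: (a i) (c i) (eS i) => x y ->.
by rewrite !sqr_normc !complexE; ring.
Qed.

Lemma bessel h : in_L2 m h ->
  \sum_i normc (L2inner m h (e i)) ^+ 2 <= Re (L2inner m h h).
Proof.
move=> hh; rewrite -subr_ge0.
have hce i : in_L2 m (fun x => L2inner m h (e i) * e i x) by exact: in_L2Z.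
have := @L2_pythagoras h (fun i => L2inner m h (e i)) hh.
rewrite [X in _ + X]big1 ?addr0; last by move=> i _; rewrite subrr normc0 expr0n.
by move=> <-; apply: Re_L2inner_ge0; apply: in_L2B => //; exact: in_L2_sum.
Qed.

Lemma L2sqnorm_le_residual h (c : 'I_q -> R[i]) (r := fun x => h x - \sum_i c i * e i x) :
  in_L2 m h -> Re (L2inner m h h) <=
    \sum_i normc (L2inner m h (e i)) ^+ 2 + Re (L2inner m r r).
Proof.
move=> hh; rewrite /r L2_pythagoras//.
have : 0 <= \sum_i normc (c i - L2inner m h (e i)) ^+ 2.
  by apply: sumr_ge0 => i _; rewrite sqr_ge0.
lra.
Qed.

End bessel.

End L2.

(** * Continuous functions on the circle *)

Section complex_continuity.
Context {R : realType} (T : topologicalType).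

Lemma normr_Im_le (x : R[i]) : `|Im x| <= normc x.
Proof.
rewrite -(ler_pXn2r (ltn0Sn 1)) ?nnegrE ?normc_ge0// sqr_normc.
by rewrite real_normK ?num_real// lerDr sqr_ge0.
Qed.

(** On [R[i]^o] the norm takes its values in the complex numbers; this and
[ccontinuousP] reduce continuity to real-valued statements. *)
Lemma cvg_normc (f : T -> R[i]) (u : T) (e : R) :
  (f : T -> R[i]^o) @ u --> (f u : R[i]^o) -> 0 < e -> \forall z \near u, normc (f u - f z) < e.
Proof.
move=> cf e0; have e0' : 0 < e%:C%C by rewrite ltcR.
move/cvgrPdist_lt : cf => /(_ _ e0'); apply: filterS => z.
by rewrite -[Num.norm _]/((normc (f u - f z))%:C%C) ltcR.
Qed.

Lemma cvg_Re (f : T -> R[i]) :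
  continuous (f : T -> R[i]^o) -> continuous (Re \o f).
Proof.
move=> cf u; apply/cvgrPdist_lt => e e0.
apply: filterS (cvg_normc (cf u) e0) => z.
by apply: le_lt_trans; rewrite /= -ReB; exact: normr_Re_le.
Qed.

Lemma cvg_Im (f : T -> R[i]) :
  continuous (f : T -> R[i]^o) -> continuous (Im \o f).
Proof.
move=> cf u; apply/cvgrPdist_lt => e e0.
apply: filterS (cvg_normc (cf u) e0) => z.
by apply: le_lt_trans; rewrite /= -ImB; exact: normr_Im_le.
Qed.

Lemma continuous_addr (f g : T -> R) : continuous f -> continuous g ->
  continuous (fun u => f u + g u).
Proof. by move=> cf cg u; apply: cvgD; [exact: cf|exact: cg]. Qed.

Lemma continuous_mulr (f g : T -> R) : continuous f -> continuous g ->
  continuous (fun u => f u * g u).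
Proof. by move=> cf cg u; apply: cvgM; [exact: cf|exact: cg]. Qed.

Lemma continuous_cstr (c : R) : continuous (fun _ : T => c).
Proof. by move=> u; exact: cvg_cst. Qed.

Lemma ccontinuousP (f : T -> R[i]) :
  continuous (f : T -> R[i]^o) <-> continuous (Re \o f) /\ continuous (Im \o f).
Proof.
split=> [cf|[cr ci] u]; first by split; [exact: cvg_Re|exact: cvg_Im].
apply/cvgrPdist_lt => e e0.
have [d [d0 ->]] : exists d : R, 0 < d /\ e = (d + d)%:C%C.
  exists (Re e / 2); case: e e0 => a b; rewrite ltcE /= => /andP[/eqP -> a0].
  by split; [rewrite divr_gt0|congr (_ +i* _)%C; rewrite -splitr].
have /cvgrPdist_lt/(_ _ d0) := cr u; have /cvgrPdist_lt/(_ _ d0) := ci u.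
apply: filterS2 => z; rewrite /= -ReB -ImB => h1 h2.
rewrite -[Num.norm _]/((normc (f u - f z))%:C%C) ltcR.
by rewrite (le_lt_trans (normc_le_add _))// addrC ltrD.
Qed.

Lemma ccontinuousD (f g : T -> R[i]) : continuous (f : T -> R[i]^o) ->
  continuous (g : T -> R[i]^o) -> continuous ((fun u => f u + g u) : T -> R[i]^o).
Proof.
move=> /ccontinuousP[fr fi] /ccontinuousP[gr gi]; apply/ccontinuousP.
by split; under [_ \o _]eq_fun do rewrite /= complexE; exact: continuous_addr.
Qed.

Lemma ccontinuousZ (c : R[i]) (f : T -> R[i]) :
  continuous (f : T -> R[i]^o) -> continuous ((fun u => c * f u) : T -> R[i]^o).
Proof.
move=> /ccontinuousP[fr fi]; apply/ccontinuousP.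
split; under [_ \o _]eq_fun do rewrite /= complexE -?mulNr;
  by apply: continuous_addr; apply: continuous_mulr => //; exact: continuous_cstr.
Qed.

Lemma ccontinuous_cst (c : R[i]) : continuous ((fun=> c) : T -> R[i]^o).
Proof. by move=> u; exact: cvg_cst. Qed.

End complex_continuity.

Section circle.
Context {R : realType}.
Notation pr := (@circle_proj R).
Implicit Types (x y : R) (t u a : circle R).

Lemma circle_projD x y : pr (x + y) = pr x + pr y.
Proof. exact: Quotient.pi_add. Qed.

Lemma circle_proj_eq x y : (pr x == pr y) = (x - y \is a Num.int).
Proof.
rewrite -[RHS]/(x - y \in (integers (R := R))).
by rewrite Quotient.idealrBE.
Qed.

Lemma circle_proj_int x n : n \is a Num.int -> pr (x + n) = pr x.
Proof. by move=> nint; apply/eqP; rewrite circle_proj_eq addrC addKr. Qed.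

Lemma circle_proj_surj t : exists2 x, 0 <= x < 1 & pr x = t.
Proof.
have [y <-] : exists y, pr y = t by exists (repr t); exact: reprK.
exists (y - (Num.floor y)%:~R).
  by rewrite subr_ge0 ltrBlDl floor_le/= -intrD1 floorD1_gt.
by rewrite circle_proj_int// rpredN intr_int.
Qed.

Lemma circle_continuous_lift (T : topologicalType) (f : circle R -> T) :
  continuous (f \o pr) -> continuous f.
Proof. by move=> cf; apply/(@quotient_continuous _ (Quotient.quot (@integers R))). Qed.

Lemma continuous_translate a : continuous (fun u => a + u).
Proof.
apply: circle_continuous_lift.
have [x _ <-] := circle_proj_surj a.
have -> : (fun u => pr x + u) \o pr = pr \o (fun y => x + y).
  by apply/funext => y /=; rewrite circle_projD.
move=> y; apply: continuous_comp; last exact: circle_proj_continuous.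
by apply: cvgD; [exact: cvg_cst|exact: cvg_id].
Qed.

(** The circle is the image of a segment. *)
Lemma circle_bounded (g : circle R -> R) : continuous g -> exists M, forall u, `|g u| <= M.
Proof.
move=> cg; pose G x := `|g (pr x)|.
have cG : continuous G.
  move=> x; apply: (@continuous_comp _ _ _ pr (fun u => `|g u|)).
    exact: circle_proj_continuous.
  by apply: (@continuous_comp _ _ _ g (fun z => `|z|)); [exact: cg|exact: norm_continuous].
have [c _ cM] := @EVT_max R G 0 1 ler01 (continuous_subspaceT cG).
exists (G c) => u; have [x /andP[x0 x1] <-] := circle_proj_surj u.
by apply: cM; rewrite in_itv/= x0 ltW.
Qed.

Lemma circle_continuous_measurable (g : circle R -> R) : continuous g ->
  measurable_fun setT g.
Proof.
move=> cg; apply: (measurability _ (RGenOpens.measurableE R)).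
move=> _ [_ [a [b ->]] <-]; rewrite setTI; apply: sub_sigma_algebra.
by apply: open_comp; [move=> u _; exact: cg|exact: interval_open].
Qed.

Lemma cfun_continuous_translate (f : circle R -> R[i]) t :
  cfun_continuous f -> cfun_continuous (fun u => f (t + u)).
Proof.
move=> cf u; apply: (@continuous_comp _ _ _ (fun u => t + u) (f : circle R -> R[i]^o)).
  exact: continuous_translate.
exact: cf.
Qed.

Lemma cfun_continuous_bounded (f : circle R -> R[i]) : cfun_continuous f ->
  exists M, forall u, normc (f u) <= M.
Proof.
move=> cf; have [a Ha] := circle_bounded (cvg_Re cf).
have [b Hb] := circle_bounded (cvg_Im cf).
by exists (a + b) => u; exact: le_trans (normc_le_add _) (lerD (Ha u) (Hb u)).
Qed.

Lemma cfun_continuous_measurable (f : circle R -> R[i]) : cfun_continuous f ->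
  cmeasurable_fun f.
Proof.
move=> cf; apply/cmeasurableP; split; apply: circle_continuous_measurable.
  exact: cvg_Re.
exact: cvg_Im.
Qed.

Lemma cfun_continuous_L2 (m : {finite_measure set (circle R) -> \bar R})
    (f : circle R -> R[i]) : cfun_continuous f -> in_L2 m f.
Proof.
move=> cf; have [M HM] := cfun_continuous_bounded cf.
have M0 : 0 <= M by apply: le_trans (normc_ge0 (f 0)) (HM 0).
apply: (@in_L2_le _ _ _ m f (cst M%:C%C)) => //.
- exact: cfun_continuous_measurable.
- exact: (finite_measure_integrable_cst m (normc M%:C%C ^+ 2)).
- by move=> u; rewrite (le_trans (HM u))//= expr0n/= addr0 sqrtr_sqr ler_norm.
Qed.

Lemma continuous_sqr_normc (f : circle R -> R[i]) : cfun_continuous f ->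
  continuous (fun u => normc (f u) ^+ 2).
Proof.
move=> /ccontinuousP[cr ci]; under eq_fun do rewrite sqr_normc !expr2.
by apply: continuous_addr; exact: continuous_mulr.
Qed.

Lemma cfun_continuous_sum I (s : seq I) (F : I -> circle R -> R[i]) :
  (forall i, cfun_continuous (F i)) -> cfun_continuous (fun u => \sum_(i <- s) F i u).
Proof.
move=> cF; elim: s => [|i s IH].
  by under eq_fun do rewrite big_nil; exact: ccontinuous_cst.
by under eq_fun do rewrite big_cons; exact: (ccontinuousD (cF i) IH).
Qed.

End circle.

(** * Lebesgue measure of the circle and translated arcs *)

Section circle_integral.
Context {R : realType}.
Notation pr := (@circle_proj R).
Notation leb := lebesgue_measure.
Local Open Scope ereal_scope.

Let mindic (D : set (measurableTypeR R)) : measurable D ->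
  measurable_fun [set: measurableTypeR R] (\1_D : measurableTypeR R -> R).
Proof. by move=> mD; exact: measurable_indic. Qed.

(** The normalized measure is the image of Lebesgue measure on [[0, 1[], which is
itself a measure with an indicator as density. *)
Lemma integral_circle_lebesgue (D : set (circle R)) (g : circle R -> R) :
  measurable D -> measurable_fun setT g -> (forall u, 0 <= g u)%R ->
  \int[circle_lebesgue R]_(u in D) (g u)%:E =
  \int[leb]_x (\1_(pr @^-1` D `&` `[0%R, 1%R[%classic) x * g (pr x))%:E.
Proof.
move=> mD mg g0.
have m01 : measurable (`[0%R, 1%R[%classic : set R) by exact: measurable_itv.
have mpr : measurable_fun [set: measurableTypeR R] (pr : measurableTypeR R -> circle R).
  exact: measurable_circle_proj.
pose m1 : {measure set (measurableTypeR R) -> \bar R} := mrestr leb m01.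
transitivity (\int[pushforward m1 pr]_(u in D) (g u)%:E).
  by apply: (@eq_measure_integral _ _ _ _ (measure_function_pushforward__canonical__measure_function_Measure m1 mpr)).
rewrite (ge0_integral_pushforward mpr m1 mD)//; last 2 first.
- exact/measurable_EFinP/measurable_funTS.
- by move=> u _; rewrite lee_fin.
have mD' : measurable (pr @^-1` D) by rewrite -[X in measurable X]setTI; exact: mpr.
have m1' := mindic m01.
rewrite integral_mkcond.
have nuE (A : set (measurableTypeR R)) : measurable A ->
    m1 A = \int[leb]_(x in A) (\1_(`[0%R, 1%R[%classic : set R) x)%:E.
  by move=> mA; rewrite integral_indic// setIC.
rewrite (ge0_integral_density m1' _ nuE)//; last 2 first.
- apply/(measurable_restrictT _ mD')/measurable_funTS/measurable_EFinP.
  exact: measurableT_comp.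
- by move=> x; rewrite /patch; case: ifP => // _; rewrite lee_fin.
apply: eq_integral => x _; rewrite /patch indicI/=.
rewrite [in RHS]indicE; case: ifP => h; rewrite ?mul0e ?mul1r ?mul0r//.
by rewrite -EFinM mulrC.
Qed.

Lemma circle_lebesgue_le_itv (I : set (circle R)) (a b : R) (g : circle R -> R) :
  measurable I -> measurable_fun setT g -> (forall u, 0 <= g u)%R ->
  (0 <= a)%R -> (b < 1)%R -> (forall x, (a <= x <= b)%R -> I (pr x)) ->
  \int[leb]_x (\1_(`[a, b]%classic) x * g (pr x))%:E <=
  \int[circle_lebesgue R]_(u in I) (g u)%:E.
Proof.
move=> mI mg g0 a0 b1 abI; rewrite integral_circle_lebesgue//.
have mgp : measurable_fun [set: measurableTypeR R] (fun x => g (pr x)).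
  by apply: measurableT_comp => //; exact: measurable_circle_proj.
apply: ge0_le_integral => //.
- by move=> x _; rewrite lee_fin mulr_ge0.
- apply/measurable_EFinP.
  exact: (measurable_funM (mindic (measurable_itv `[a, b])) mgp).
- have mD : measurable (pr @^-1` I `&` `[0%R, 1%R[%classic : set (measurableTypeR R)).
    apply: measurableI; last exact: measurable_itv.
    by rewrite -[X in measurable X]setTI; exact: measurable_circle_proj.
  by apply/measurable_EFinP; exact: (measurable_funM (mindic mD) mgp).
move=> x _; rewrite lee_fin ler_wpM2r// !indicE.
case: (boolP (x \in _)) => [|_]; last by [].
rewrite inE/= in_itv/= => /andP[ax xb]; rewrite mem_set//; split.
  by apply: abI; rewrite ax.
by rewrite /= in_itv/= (le_trans a0 ax) (le_lt_trans xb b1).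
Qed.

Lemma indic_itv_shift (a b c x : R) :
  (\1_(`[c, c + (b - a)]%classic) (x + (c - a)) = \1_(`[a, b]%classic) x :> R)%R.
Proof.
rewrite !indicE; congr ((_ : bool)%:R)%R; apply/idP/idP; rewrite !inE/= !in_itv/=;
  move=> /andP[h1 h2]; apply/andP; split; move: h1 h2; lra.
Qed.

(** The circle is covered by finitely many translates of an arc, so that a bound
on one arc becomes a global bound, at the price of translating the function. *)
Lemma lebesgue_le_translates (mu : {measure set (circle R) -> \bar R}) (a b C : R) :
  (a < b)%R -> (0 <= C)%R ->
  (forall g : circle R -> R, continuous g -> (forall u, 0 <= g u)%R ->
     \int[leb]_x (\1_(`[a, b]%classic) x * g (pr x))%:E <= C%:E * \int[mu]_u (g u)%:E) ->
  exists (N : nat) (al : nat -> circle R),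
    forall g : circle R -> R, continuous g -> (forall u, 0 <= g u)%R ->
    \int[circle_lebesgue R]_u (g u)%:E <=
    C%:E * \sum_(k < N) \int[mu]_u (g (al k + u)%R)%:E.
Proof.
move=> ab C0 H; pose l := (b - a)%R.
have l0 : (0 < l)%R by rewrite subr_gt0.
have [N Nl] : exists N : nat, (1 <= N%:R * l)%R.
  exists (Num.bound l^-1); rewrite -ler_pdivrMr// div1r ltW// archi_boundP//.
  by rewrite invr_ge0 ltW.
(* the translation by be k carries [a, b] onto [k l, k l + l] *)
pose be k : R := (k%:R * l - a)%R.
exists N, (fun k => pr (be k)) => g cg g0.
pose I k := `[(k%:R * l)%R, (k%:R * l + l)%R]%classic : set R.
have mg : measurable_fun setT g by exact: circle_continuous_measurable.
have mgp : measurable_fun [set: measurableTypeR R] (fun x => g (pr x)).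
  by apply: measurableT_comp => //; exact: measurable_circle_proj.
have mI k : measurable (I k) by exact: measurable_itv.
have mIg k : measurable_fun setT (fun x => (\1_(I k) x * g (pr x))%:E).
  by apply/measurable_EFinP; apply: measurable_funM => //; exact: measurable_indic.
have step k : \int[leb]_x (\1_(I k) x * g (pr x))%:E <= C%:E * \int[mu]_u (g (pr (be k) + u)%R)%:E.
  have cgk : continuous (fun u => g (pr (be k) + u)%R).
    move=> u; apply: (@continuous_comp _ _ _ (fun u => pr (be k) + u)%R g).
      exact: continuous_translate.
    exact: cg.
  apply: le_trans (H _ cgk _); last by move=> u.
  rewrite -(@ge0_integral_translate R (be k) (fun x => (\1_(I k) x * g (pr x))%:E))//; last first.
    by move=> x; rewrite lee_fin mulr_ge0.
  rewrite le_eqVlt; apply/orP; left; apply/eqP; apply: eq_integral => x _ /=.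
  rewrite (circle_projD x) (addrC (pr x)).
  by rewrite /I /be /l indic_itv_shift.
apply: (@le_trans _ _ (\sum_(k < N) \int[leb]_x (\1_(I k) x * g (pr x))%:E)); last first.
  rewrite ge0_sume_distrr; last first.
    by move=> k _; apply: integral_ge0 => u _; rewrite lee_fin.
  by apply: lee_sum => k _; exact: step.
rewrite -ge0_integral_sum//; last 2 first.
- by move=> k; exact: mIg.
- by move=> k x _; rewrite lee_fin mulr_ge0.
rewrite integral_circle_lebesgue//; apply: ge0_le_integral => //.
- by move=> x _; rewrite lee_fin mulr_ge0.
- rewrite preimage_setT setTI; apply/measurable_EFinP.
  exact: (measurable_funM (mindic (measurable_itv `[0%R, 1%R[)) mgp).
- by apply: emeasurable_sum => k; exact: mIg.
move=> x _; rewrite sumEFin lee_fin preimage_setT setTI -mulr_suml ler_wpM2r//.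
rewrite indicE; case: (boolP (x \in _)) => [|_]; last by rewrite sumr_ge0.
rewrite inE/= in_itv/= => /andP[x0 x1].
have xl0 : (0 <= x / l)%R by rewrite divr_ge0// ltW.
pose k := Num.truncn (x / l)%R.
have /andP[k1 k2] := truncn_itv xl0.
have kN : (k < N)%N.
  rewrite -(ltr_nat R); apply: le_lt_trans k1 _.
  by rewrite ltr_pdivrMr//; exact: lt_le_trans x1 Nl.
rewrite (bigD1 (Ordinal kN))//= indicE mem_set/= ?lerDl ?sumr_ge0//.
rewrite /I/= in_itv/= -ler_pdivlMr// k1/= (_ : _ + l = k.+1%:R * l)%R.
  by rewrite -ler_pdivrMr// ltW.
by rewrite -natr1 mulrDl mul1r.
Qed.

End circle_integral.

(** * Domination of Lebesgue measure by translates of another measure *)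

(** The integral of a nonnegative function is a supremum over the simple
functions below it, hence monotone in its domain. The domains are arbitrary sets
because an arc is the image of an arbitrary interval, whose measurability would
take a separate argument. *)
Lemma ge0_subset_integral_any d (T : measurableType d) (R : realType)
    (m : {measure set T -> \bar R}) (D1 D2 : set T) (f : T -> \bar R) :
  D1 `<=` D2 -> (forall x, 0 <= f x)%E ->
  (\int[m]_(x in D1) f x <= \int[m]_(x in D2) f x)%E.
Proof.
move=> D12 f0; rewrite integral_mkcond [leRHS]integral_mkcond.
have p0 (D : set T) x : (0 <= (f \_ D) x)%E by rewrite /patch; case: ifP.
rewrite !ge0_integralTE//; apply: ereal_sup_le => _ [h hf <-]; exists h => // x.
apply: le_trans (hf x) _; rewrite /patch.
case: (boolP (x \in D1)) => [|_]; last by case: ifP.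
by rewrite inE => /D12 D2x; rewrite mem_set.
Qed.

Section arcs.
Context {R : realType}.
Notation pr := (@circle_proj R).
Notation leb := lebesgue_measure.
Variable mu : {measure set (circle R) -> \bar R}.
Local Open Scope ereal_scope.

Lemma open_circle_proj (U : set R) : open U -> open (pr @` U).
Proof.
move=> oU.
suff : open (pr @^-1` (pr @` U)) by [].
have -> : pr @^-1` (pr @` U) =
    \bigcup_(n in [set: int]) ((fun z : R => z + n%:~R)%R @^-1` U).
  apply/seteqP; split=> z /=.
    move=> [u Uu /eqP]; rewrite circle_proj_eq => /intrP[n un].
    by exists n => //=; rewrite -un addrC subrK.
  move=> [n _ /= Uz]; exists (z + n%:~R)%R => //.
  by rewrite circle_proj_int// intr_int.
apply: bigcup_open => n _; apply: open_comp => // z _.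
by apply: cvgD; [exact: cvg_id|exact: cvg_cst].
Qed.

(** The only property of [mu] that the comparison of the processes uses. It is
stable under the choice of the arc, and follows from both hypotheses on [mu]. *)
Definition dominated_by_translates : Prop :=
  exists (C : R) (N : nat) (al : nat -> circle R), (0 <= C)%R /\
    forall g : circle R -> R, continuous g -> (forall u, 0 <= g u)%R ->
    \int[circle_lebesgue R]_u (g u)%:E <=
    C%:E * \sum_(k < N) \int[mu]_u (g (al k + u)%R)%:E.

(** The arc is shrunk, and translated by an integer, so as to lie inside the
fundamental domain. *)
Lemma open_arc_dominated (c e C : R) : (c < e)%R -> (0 <= C)%R ->
  (forall g : circle R -> R, continuous g -> (forall u, 0 <= g u)%R ->
     \int[circle_lebesgue R]_(u in pr @` `]c, e[) (g u)%:E <= C%:E * \int[mu]_u (g u)%:E) ->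
  dominated_by_translates.
Proof.
move=> ce C0 H.
pose x := ((c + e) / 2)%R; pose n := Num.floor x.
pose a := (x - n%:~R)%R; pose b := Num.min ((x + e) / 2 - n%:~R)%R ((a + 1) / 2)%R.
have a0 : (0 <= a)%R by rewrite subr_ge0 floor_le.
have a1 : (a < 1)%R by rewrite ltrBlDl -intrD1 floorD1_gt.
have ab : (a < b)%R by rewrite lt_min; apply/andP; split; move: ce a1; rewrite /a /x; lra.
have b1 : (b < 1)%R by rewrite gt_min; apply/orP; right; lra.
have mK : measurable (pr @` `]c, e[%classic).
  by apply: sub_sigma_algebra; apply: open_circle_proj; exact: interval_open.
have [|N [al Hal]] := @lebesgue_le_translates R mu a b C ab C0; last by exists C, N, al.
move=> g cg g0; apply: le_trans (H g cg g0).
apply: circle_lebesgue_le_itv => //; first exact: circle_continuous_measurable.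
move=> y /andP[ay yb]; exists (y + n%:~R)%R; last by rewrite circle_proj_int// intr_int.
have : (y <= (x + e) / 2 - n%:~R)%R by rewrite (le_trans yb)// ge_min lexx.
by rewrite /= in_itv/=; move: ay ce; rewrite /a /x => ay ce h; apply/andP; split; lra.
Qed.

(** An arc of positive measure contains an open arc, since an interval with at
most one point projects to a null set. *)
Lemma arc_dominated (I : set (circle R)) (C : R) : is_arc I ->
  0 < circle_lebesgue R I -> (0 < C)%R ->
  (forall g : circle R -> R, continuous g -> (forall u, 0 <= g u)%R ->
     \int[circle_lebesgue R]_(u in I) (g u)%:E <= C%:E * \int[mu]_(u in I) (g u)%:E) ->
  dominated_by_translates.
Proof.
move=> [J IJ] I0 C0 H.
have [[x [y [Jx Jy xy]]]|nxy] := pselect (exists x y, [/\ [set` J] x, [set` J] y & x < y]%R).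
  apply: (open_arc_dominated xy (ltW C0)) => g cg g0.
  have g0' u : 0 <= (g u)%:E by rewrite lee_fin.
  have sub : pr @` `]x, y[ `<=` I.
    rewrite IJ => _ [z /= zxy <-]; exists z => //.
    move: zxy; rewrite in_itv/= => /andP[xz zy].
    by apply: (interval_is_interval Jx Jy); rewrite (ltW xz) (ltW zy).
  apply: le_trans (ge0_subset_integral_any _ sub g0') _.
  apply: le_trans (H g cg g0) _; rewrite lee_wpmul2l// ?lee_fin ?(ltW C0)//.
  exact: ge0_subset_integral_any.
have J1 x y : [set` J] x -> [set` J] y -> x = y.
  move=> Jx Jy; apply/eqP; rewrite eq_le; apply/andP.
  by split; rewrite leNgt; apply/negP => xy; apply: nxy; [exists y, x|exists x, y].
exfalso; move: I0; rewrite /circle_lebesgue.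
have [->|/set0P[z zI]] := eqVneq (pr @^-1` I `&` `[0%R, 1%R[%classic) set0.
  by rewrite measure0 ltxx.
have -> : pr @^-1` I `&` `[0%R, 1%R[%classic = [set z].
  apply/seteqP; split=> [w|_ ->//].
  move: zI; rewrite IJ => -[/= [z1 Jz1 z1z]]; rewrite in_itv/= => z01.
  move=> [/= [w1 Jw1 w1w]]; rewrite in_itv/= => w01.
  have : pr w == pr z by rewrite -w1w -z1z (J1 _ _ Jw1 Jz1).
  rewrite circle_proj_eq => /intrP[k wz].
  have : (-1 < k < 1)%R.
    by rewrite -!(ltr_int R) -wz rmorphN/=; move: z01 w01 => /andP[? ?] /andP[? ?]; apply/andP; split; lra.
  move=> k11; have k0 : k = 0%R by move: k11; case: k {wz} => [[|k]|k] /andP[].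
  by apply/eqP; rewrite -subr_eq0 wz k0.
by rewrite lebesgue_measure_set1 ltxx.
Qed.

(** A density that is continuous and positive at a point is bounded below by a
positive constant on a small open arc around it. *)
Lemma density_dominated (phi : circle R -> R) (I : set (circle R)) :
  has_density mu phi -> open I -> I !=set0 -> {within I, continuous phi} ->
  (forall u, I u -> 0 < phi u)%R -> dominated_by_translates.
Proof.
move=> [mphi phi0 muE] oI [u0 Iu0] cphi phip.
have [z _ zu0] := circle_proj_surj u0.
have Iz : I (pr z) by rewrite zu0.
pose c := (phi (pr z) / 2)%R.
have c0 : (0 < c)%R by rewrite divr_gt0// phip.
have [e e0 He] : exists2 e : R, (0 < e)%R & forall x, (`|z - x| < e)%R -> (c < phi (pr x))%R.
  have /(_ (pr z)) cz : {in I, continuous phi} by rewrite -continuous_open_subspace.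
  have /cvgrPdist_lt/(_ _ c0) : (phi \o pr) x @[x --> z] --> (phi \o pr) z.
    apply: continuous_comp; first exact: circle_proj_continuous.
    by apply: cz; rewrite inE.
  move=> /nbhs_ballP[e e0 He]; exists e => // x /He /=.
  by move=> /ltr_normlW; rewrite /c; lra.
have ze : (z - e < z + e)%R by move: e0; lra.
apply: (@open_arc_dominated (z - e)%R (z + e)%R c^-1 ze) => [|g cg g0].
  by rewrite invr_ge0 ltW.
set K := pr @` _.
have mK : measurable K.
  by apply: sub_sigma_algebra; apply: open_circle_proj; exact: interval_open.
have mg : measurable_fun setT g by exact: circle_continuous_measurable.
rewrite lee_pdivlMl//.
rewrite (@ge0_integral_density _ _ _ (circle_lebesgue R) mu phi mphi)//; last first.
  exact/measurable_EFinP.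
apply: le_trans (@ge0_subset_integral_any _ _ _ (circle_lebesgue R) K setT _ _ _) => //; last first.
  by move=> u; rewrite mule_ge0// lee_fin.
rewrite -ge0_integralZl//; last 3 first.
- exact/measurable_EFinP/measurable_funTS.
- by move=> u _; rewrite lee_fin.
- by rewrite lee_fin ltW.
apply: ge0_le_integral => //.
- by move=> u _; rewrite mule_ge0 ?lee_fin// ltW.
- apply/measurable_funTS/emeasurable_funM => //; exact/measurable_EFinP.
- apply/measurable_funTS/emeasurable_funM; exact/measurable_EFinP.
move=> _ [x /= + <-]; rewrite in_itv/= => /andP[x1 x2].
rewrite muleC lee_wpmul2l ?lee_fin// ltW// He//.
by rewrite ltr_norml; apply/andP; split; move: x1 x2; lra.
Qed.

End arcs.

(** * Approximation of the process by finite partial sums *)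

Section chebyshev.
Context {R : realType} d (T : measurableType d) (P : probability T R).

Lemma measurable_normc_gt (h : T -> R[i]) (l : R) : cmeasurable_fun h ->
  measurable [set w | l < normc (h w)].
Proof.
move=> mh.
have [l0|l0] := ltP l 0.
  rewrite (_ : [set w | _] = setT)//; apply/seteqP; split=> // w _ /=.
  exact: lt_le_trans l0 (normc_ge0 _).
have -> : [set w | l < normc (h w)] =
    (fun w => normc (h w) ^+ 2) @^-1` `]l ^+ 2, +oo[%classic.
  apply/seteqP; split=> w /=; rewrite in_itv/= andbT;
    by rewrite ltr_pXn2r ?nnegrE ?normc_ge0.
by rewrite -[X in measurable X]setTI; exact: (measurable_sqr_normc mh).
Qed.

Lemma chebyshev_normc (h : T -> R[i]) (l e : R) : 0 < l -> cmeasurable_fun h ->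
  (L2sqnorm P h <= (l ^+ 2 * e)%:E)%E -> (P [set w | (l < normc (h w))%R] <= e%:E)%E.
Proof.
move=> l0 mh he; have l2 : 0 < l ^+ 2 by rewrite exprn_gt0.
have mE := measurable_normc_gt l mh.
rewrite -(@lee_pmul2l _ (l ^+ 2)%:E)// -EFinM; apply: le_trans he.
rewrite -integral_cst// integral_mkcond; apply: ge0_le_integral => //.
- by move=> w _; rewrite /patch; case: ifP => // _; rewrite lee_fin ltW.
- by apply/(measurable_restrictT _ mE); exact: measurable_cst.
- exact/measurable_EFinP/measurable_sqr_normc.
move=> w _; rewrite /patch; case: ifPn => [|_]; last by rewrite lee_fin sqr_ge0.
by rewrite inE/= => lw; rewrite lee_fin lerXn2r ?nnegrE ?(ltW l0) ?normc_ge0// ltW.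
Qed.

Definition exceeds_some p (h : 'I_p -> T -> R[i]) (l : R) : set T :=
  [set w | exists j, l < normc (h j w)].

Lemma measurable_exceeds_some p (h : 'I_p -> T -> R[i]) l :
  (forall j, cmeasurable_fun (h j)) -> measurable (exceeds_some h l).
Proof.
move=> mh.
have -> : exceeds_some h l = \bigcup_(j in [set: 'I_p]) [set w | l < normc (h j w)].
  by apply/seteqP; split=> w /= [j]; [exists j|move=> _; exists j].
apply: fin_bigcup_measurable; first exact: finite_finset.
by move=> j _; exact: measurable_normc_gt.
Qed.

Lemma exceeds_some_le p (h : 'I_p -> T -> R[i]) l (e : R) :
  (forall j, cmeasurable_fun (h j)) ->
  (forall j, (P [set w | (l < normc (h j w))%R] <= e%:E)%E) ->
  (P (exceeds_some h l) <= (e *+ p)%:E)%E.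
Proof.
move=> mh he.
elim: p h mh he => [|p IH] h mh he.
  rewrite (_ : exceeds_some h l = set0) ?measure0 ?mulr0n//.
  by apply/seteqP; split=> // w [[]].
have -> : exceeds_some h l =
    [set w | l < normc (h ord0 w)] `|` exceeds_some (fun j => h (lift ord0 j)) l.
  apply/seteqP; split=> w /=.
    move=> [j]; case: (unliftP ord0 j) => [k ->|->]; [by right; exists k|by left].
  by move=> [|[k]]; [exists ord0|exists (lift ord0 k)].
apply: le_trans (measureU2 _ _ _) _; first exact: measurable_normc_gt.
  exact: measurable_exceeds_some.
rewrite mulrS EFinD; apply: leeD => //.
  exact: he.
exact: (IH _ (fun j => mh _) (fun j => he _)).
Qed.

End chebyshev.

Lemma nth_fset_inj (J : {fset int}) : injective (fun i : 'I_(size J) => nth 0 J i).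
Proof. by move=> i k /eqP; rewrite nth_uniq ?fset_uniq// => /eqP/val_inj. Qed.

Section orthonormal.
Context {R : realType} d (T : measurableType d) (m : {measure set T -> \bar R}).
Variables (A : set int) (e : int -> T -> R[i]).
Hypothesis be : orthonormal_basis m A e.

Lemma bessel_ord q (s : 'I_q -> int) h : injective s -> (forall i, A (s i)) ->
  in_L2 m h ->
  \sum_i normc (L2inner m h (e (s i))) ^+ 2 <= Re (L2inner m h h).
Proof.
move=> sI sA hh; have [eL2 eo _] := be.
apply: bessel => // [i|i j]; first exact: eL2.
by rewrite eo//; congr (_%:R); rewrite (inj_eq sI).
Qed.

Lemma bessel_fset (J : {fset int}) h : [set` J] `<=` A -> in_L2 m h ->
  \sum_(n <- J) normc (L2inner m h (e n)) ^+ 2 <= Re (L2inner m h h).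
Proof.
move=> JA hh; rewrite (big_nth 0) big_mkord.
apply: (@bessel_ord _ (fun i : 'I_(size J) => nth 0 J i)) => // [i k|i].
  exact: nth_fset_inj.
by apply: JA; rewrite /= mem_nth.
Qed.

Definition residual (J : {fset int}) h : T -> R[i] :=
  fun x => h x - \sum_(n <- J) L2inner m h (e n) * e n x.

Lemma residual_fset (J : {fset int}) h : [set` J] `<=` A -> in_L2 m h ->
  in_L2 m (residual J h) /\
  Re (L2inner m (residual J h) (residual J h)) = Re (L2inner m h h) - \sum_(n <- J) normc (L2inner m h (e n)) ^+ 2.
Proof.
move=> JA hh; have [eL2 eo _] := be.
pose s (i : 'I_(size J)) := nth 0 J i.
have sI : injective s by exact: nth_fset_inj.
have sA i : A (s i) by apply: JA; rewrite /= mem_nth.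
have eo' i j : L2inner m (e (s i)) (e (s j)) = (i == j)%:R.
  by rewrite eo//; congr (_%:R); rewrite (inj_eq sI).
have eL2' i : in_L2 m (e (s i)) by exact: eL2.
have rE : residual J h = (fun x => h x - \sum_i L2inner m h (e (s i)) * e (s i) x).
  by apply/funext => x; rewrite /residual (big_nth 0) big_mkord.
split.
  by rewrite rE; apply: in_L2B => //; apply: in_L2_sum => i _; exact: in_L2Z.
rewrite rE (L2_pythagoras eL2' eo')// (big_nth 0) big_mkord.
by rewrite [X in _ + X]big1 ?addr0// => i _; rewrite subrr normc0 expr0n.
Qed.

(** The orthogonal projection on the span of finitely many basis vectors is at
least as good an approximation as the one provided by density, and enlarging
the set of vectors can only improve it. *)
Lemma residual_small h (dl : R) : in_L2 m h -> 0 < dl ->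
  exists2 J0 : {fset int}, [set` J0] `<=` A &
    forall J : {fset int}, [set` J] `<=` A -> (J0 `<=` J)%fset ->
    Re (L2inner m (residual J h) (residual J h)) <= dl.
Proof.
move=> hh dl0; have [eL2 eo dens] := be.
have [J0 [c [J0A hJ0]]] := dens h hh dl dl0.
exists J0 => // J JA J0J; rewrite (residual_fset JA hh).2.
pose s (i : 'I_(size J0)) := nth 0 J0 i.
have sI : injective s by exact: nth_fset_inj.
have sA i : A (s i) by apply: J0A; rewrite /= mem_nth.
have eo' i j : L2inner m (e (s i)) (e (s j)) = (i == j)%:R.
  by rewrite eo//; congr (_%:R); rewrite (inj_eq sI).
have eL2' i : in_L2 m (e (s i)) by exact: eL2.
have := L2sqnorm_le_residual eL2' eo' (fun i => c (s i)) hh.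
set r0 := (fun x => h x - _) => h1.
have r0L2 : in_L2 m r0.
  by apply: in_L2B => //; apply: in_L2_sum => i _; exact: in_L2Z.
have h2 : Re (L2inner m r0 r0) < dl.
  rewrite -lte_fin -L2sqnormE//; apply: le_lt_trans hJ0.
  rewrite le_eqVlt; apply/orP; left; apply/eqP; congr (L2sqnorm _ _).
  by apply/funext => x; rewrite /r0 (big_nth 0) big_mkord.
have h3 : \sum_i normc (L2inner m h (e (s i))) ^+ 2 <=
    \sum_(n <- J) normc (L2inner m h (e n)) ^+ 2.
  rewrite [X in X <= _](_ : _ = \sum_(n <- J0) normc (L2inner m h (e n)) ^+ 2); last first.
    by rewrite [RHS](big_nth 0) big_mkord.
  rewrite [leRHS](big_fsetID _ (mem J0))/= (_ : [fset x in J | x \in J0]%fset = J0).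
    by rewrite lerDl sumr_ge0// => n _; rewrite sqr_ge0.
  by apply/fsetP => n; rewrite !inE andbC; case: (boolP (n \in J0)) => //= /(fsubsetP J0J).
by move: h1 h2 h3; rewrite /r0; lra.
Qed.

End orthonormal.

Section approximation.
Context {R : realType} (m : {finite_measure set (circle R) -> \bar R}).
Context d (Omega : measurableType d) (P : probability Omega R).
Variables (A : set int) (e : int -> circle R -> R[i]) (Z : int -> Omega -> R[i]).
Variable X : (circle R -> R[i]) -> circle R -> Omega -> R[i].
Hypothesis HX : pisier_process m P A e Z X.

Lemma pisier_process_measurable f t : cfun_continuous f -> cmeasurable_fun (X f t).
Proof. by move=> cf; have [_ _ /(_ f cf t)[[]]] := HX. Qed.

Definition partial (J : {fset int}) f t : Omega -> R[i] := fun w =>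
  \sum_(n <- J) L2inner m (fun u => f (t + u)) (e n) * Z n w.

Lemma measurable_partial (J : {fset int}) f t : [set` J] `<=` A ->
  cmeasurable_fun (partial J f t).
Proof.
move=> JA; have [_ [gZ _] _] := HX; rewrite /partial.
have : forall n, n \in (J : seq int) -> A n by move=> n nJ; exact: JA.
elim: (J : seq int) => [|n s IH] sA.
  by under eq_fun do rewrite big_nil; exact: cmeasurable_cst.
under eq_fun do rewrite big_cons.
apply: cmeasurableD; last by apply: IH => k ks; apply: sA; rewrite inE ks orbT.
apply: cmeasurableM; first exact: cmeasurable_cst.
by have [] := gZ _ (sA n (mem_head _ _)).
Qed.

Lemma cmeasurable_error (J : {fset int}) f t : cfun_continuous f -> [set` J] `<=` A ->
  cmeasurable_fun (fun w => X f t w - partial J f t w).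
Proof.
move=> cf JA; under eq_fun do rewrite -mulN1r.
apply: cmeasurableD; first exact: pisier_process_measurable.
by apply: cmeasurableM; [exact: cmeasurable_cst|exact: measurable_partial].
Qed.

(** The defining series converges in mean square, hence in probability. *)
Lemma pisier_process_approx1 f t (l eta : R) : cfun_continuous f -> 0 < l -> 0 < eta ->
  exists2 J0 : {fset int}, [set` J0] `<=` A &
    forall J : {fset int}, [set` J] `<=` A -> (J0 `<=` J)%fset ->
    (P [set w | (l < normc (X f t w - partial J f t w))%R] <= eta%:E)%E.
Proof.
move=> cf l0 eta0; have [_ _ /(_ f cf t)[_ cX]] := HX.
have l2 : 0 < l ^+ 2 * eta by rewrite mulr_gt0// exprn_gt0.
have [J0 _ hJ0] := @cvge0_lt R _ totally (@totally_filter _) _ _ cX l2.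
exists [fset n in J0 | n \in A]%fset => [n /=|J JA J0J].
  by rewrite !inE => /andP[_]; rewrite inE.
have hJ : (J0 `<=` (J0 `|` J))%fset by exact: fsubsetUl.
apply: chebyshev_normc => //; first exact: cmeasurable_error.
apply: le_trans (ltW (hJ0 _ hJ)); rewrite le_eqVlt; apply/orP; left; apply/eqP.
congr (L2sqnorm _ _); apply/funext => w; congr (_ - _); rewrite /partial.
rewrite -[RHS]big_filter; apply: perm_big; apply: uniq_perm.
- exact: fset_uniq.
- by rewrite filter_uniq// fset_uniq.
move=> n; rewrite mem_filter in_fsetU; apply/idP/idP.
  by move=> nJ; rewrite nJ orbT andbT inE; exact: JA.
move=> /andP[nA /orP[nJ0|//]]; apply: (fsubsetP J0J).
by rewrite !inE/= nJ0.
Qed.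

(** Finitely many points share one finite set of frequencies, for which both the
process and the translates of [f] are well approximated. *)
Lemma pisier_process_approx f (I : finType) (t : I -> circle R) (l eta dl : R) :
  cfun_continuous f -> 0 < l -> 0 < eta -> 0 < dl ->
  exists J : {fset int}, [/\ [set` J] `<=` A,
    forall j, (P [set w | (l < normc (X f (t j) w - partial J f (t j) w))%R] <= eta%:E)%E &
    forall j, Re (L2inner m (residual m e J (fun u => f (t j + u)))
                            (residual m e J (fun u => f (t j + u)))) <= dl].
Proof.
move=> cf l0 eta0 dl0; have [be _ _] := HX.
have hf j : in_L2 m (fun u => f (t j + u)).
  by apply: cfun_continuous_L2; exact: cfun_continuous_translate.
pose J1 j := s2val (cid2 (pisier_process_approx1 (t j) cf l0 eta0)).
have J1A j := s2valP (cid2 (pisier_process_approx1 (t j) cf l0 eta0)).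
have HJ1 j := s2valP' (cid2 (pisier_process_approx1 (t j) cf l0 eta0)).
pose J2 j := s2val (cid2 (residual_small be (hf j) dl0)).
have J2A j := s2valP (cid2 (residual_small be (hf j) dl0)).
have HJ2 j := s2valP' (cid2 (residual_small be (hf j) dl0)).
pose J : {fset int} := [fset n in flatten [seq (J1 j ++ J2 j : seq int) | j <- enum I]]%fset.
have inJ n : (n \in J) = (n \in flatten [seq (J1 j ++ J2 j : seq int) | j <- enum I]).
  by rewrite !inE.
have JA : [set` J] `<=` A.
  move=> n /=; rewrite inJ => /flattenP[s /mapP[j _ ->]].
  by rewrite mem_cat => /orP[/J1A|/J2A].
exists J; split=> // j; [apply: HJ1|apply: HJ2] => //; apply/fsubsetP => n nJ;
  rewrite inJ; apply/flattenP; exists (J1 j ++ J2 j : seq int).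
- by apply/mapP; exists j; rewrite ?mem_enum.
- by rewrite mem_cat nJ.
- by apply/mapP; exists j; rewrite ?mem_enum.
- by rewrite mem_cat nJ orbT.
Qed.

End approximation.

(** * Matrices of the partial sums *)

(** Sum of the inequalities [2 a_i x_j a_j x_i <= a_i^2 x_j^2 + a_j^2 x_i^2]. *)
Lemma cauchy_schwarz_sum (R : realType) p (a x : 'I_p -> R) :
  (\sum_j a j * x j) ^+ 2 <= (\sum_j a j ^+ 2) * \sum_j x j ^+ 2.
Proof.
rewrite expr2 !big_distrlr/=.
have -> : \sum_i \sum_j a i ^+ 2 * x j ^+ 2 =
    \sum_i \sum_j (a i ^+ 2 * x j ^+ 2 + a j ^+ 2 * x i ^+ 2) / 2.
  transitivity ((\sum_i \sum_j a i ^+ 2 * x j ^+ 2) / 2 +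
                (\sum_j \sum_i a i ^+ 2 * x j ^+ 2) / 2).
    by rewrite [in X in _ = _ + X / _]exchange_big/= -splitr.
  rewrite !mulr_suml -big_split/=; apply: eq_bigr => i _.
  by rewrite !mulr_suml -big_split/=; apply: eq_bigr => j _; rewrite -mulrDl.
apply: ler_sum => i _; apply: ler_sum => j _.
by have := sqr_ge0 (a i * x j - a j * x i); lra.
Qed.

Lemma normc_cauchy_schwarz (R : realType) p (a : 'I_p -> R) (z : 'I_p -> R[i]) :
  normc (\sum_j (a j)%:C%C * z j) ^+ 2 <= (\sum_j a j ^+ 2) * \sum_j normc (z j) ^+ 2.
Proof.
rewrite sqr_normc Re_sum Im_sum.
rewrite (eq_bigr (fun j => a j * Re (z j))); last first.
  by move=> j _; rewrite complexE /= mul0r subr0.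
rewrite [X in _ + X ^+ 2](eq_bigr (fun j => a j * Im (z j))); last first.
  by move=> j _; rewrite complexE /= mul0r addr0.
apply: le_trans (lerD (cauchy_schwarz_sum _ _) (cauchy_schwarz_sum _ _)) _.
rewrite -mulrDr -big_split/=; apply: ler_wpM2l; first by apply: sumr_ge0 => j _; exact: sqr_ge0.
by apply: ler_sum => j _; rewrite -sqr_normc.
Qed.

Lemma Re_mulNi (R : realType) (x : R[i]) : Re (- 'i%C * x) = Im x.
Proof. by case: x => a b /=; rewrite oppr0 mul0r mulN1r opprK add0r. Qed.

Section real_part.
Context {R : realType} d (T : measurableType d) (P : probability T R).

(** Real parts after multiplication by [c0], where [c0] is 1 or [- 'i], recover
both coordinates of a complex process as a real Gaussian vector. *)
Definition re_exceeds p (h : 'I_p -> T -> R[i]) (c0 : R[i]) (l : R) : set T :=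
  [set w | exists j, l < `|Re (c0 * h j w)|].

Lemma measurable_re_exceeds p (h : 'I_p -> T -> R[i]) c0 l :
  (forall j, cmeasurable_fun (h j)) -> measurable (re_exceeds h c0 l).
Proof.
move=> mh.
have -> : re_exceeds h c0 l = \bigcup_(j in [set: 'I_p]) [set w | l < `|Re (c0 * h j w)|].
  by apply/seteqP; split=> w /= [j]; [exists j|move=> _; exists j].
apply: fin_bigcup_measurable; first exact: finite_finset.
move=> j _; have [mRe _] := (cmeasurableP _).1 (cmeasurableM (cmeasurable_cst c0) (mh j)).
have -> : [set w | l < `|Re (c0 * h j w)|] = (fun w => `|Re (c0 * h j w)|) @^-1` `]l, +oo[%classic.
  by apply/seteqP; split=> w /=; rewrite in_itv/= andbT.
rewrite -[X in measurable X]setTI.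
exact: (measurableT_comp (@normr_measurable R setT) mRe).
Qed.

Lemma exceeds_some_approx p (g h : 'I_p -> T -> R[i]) l :
  exceeds_some g (l + l) `<=` exceeds_some (fun j w => g j w - h j w) l `|` exceeds_some h l.
Proof.
move=> w [j hj]; have [gl|gl] := ltP l (normc (g j w - h j w)); first by left; exists j.
right; exists j; have := le_normcD (g j w - h j w) (h j w).
by rewrite subrK; lra.
Qed.

Lemma exceeds_some_re p (h : 'I_p -> T -> R[i]) l :
  exceeds_some h (l + l) `<=` re_exceeds h 1 l `|` re_exceeds h (- 'i%C) l.
Proof.
move=> w [j hj]; have := normc_le_add (h j w) => hle.
have [gl|gl] := ltP l `|Re (h j w)|; first by left; exists j; rewrite mul1r.
right; exists j; rewrite Re_mulNi.
by lra.
Qed.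

Lemma re_exceeds_sub p (h : 'I_p -> T -> R[i]) c0 l : normc c0 = 1 ->
  re_exceeds h c0 l `<=` exceeds_some h l.
Proof.
move=> c1 w [j hj]; exists j; apply: lt_le_trans hj _.
by apply: le_trans (normr_Re_le _) _; rewrite normcM c1 mul1r.
Qed.

End real_part.

Section partial_matrix.
Context {R : realType} (m : {finite_measure set (circle R) -> \bar R}).
Context d (Omega : measurableType d) (P : probability Omega R).
Variables (A : set int) (e : int -> circle R -> R[i]) (Z : int -> Omega -> R[i]).
Hypothesis be : orthonormal_basis m A e.
Hypothesis iidZ : iid_std_complex_gaussian P A Z.

(** The coefficient matrix of the real Gaussian vector formed by the real parts
of [c0] times the partial sums at the points [t j]. *)
Definition partial_mx (J : {fset int}) f p (t : 'I_p -> circle R) (c0 : R[i]) :=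
  coef_mx (fun (i : 'I_(size J)) j =>
    c0 * L2inner m (fun u => f (t j + u)) (e (nth 0 J i))).

Lemma reim_row_partial_mx (J : {fset int}) f p (t : 'I_p -> circle R) (c0 : R[i]) w j :
  (reim_row Z (fun i : 'I_(size J) => nth 0 J i) w *m partial_mx J f t c0) 0 j =
  Re (c0 * partial m e Z J f (t j) w).
Proof.
rewrite reim_row_coef_mx /partial (big_nth 0) big_mkord mulr_sumr.
by congr (Re _); apply: eq_bigr => i _; rewrite mulrA.
Qed.

Lemma tail_partial_mx (J : {fset int}) f p (t : 'I_p -> circle R) (c0 : R[i]) l :
  [set` J] `<=` A ->
  P (re_exceeds (fun j => partial m e Z J f (t j)) c0 l) = tail (partial_mx J f t c0) l.
Proof.
move=> JA; pose s (i : 'I_(size J)) := nth 0 J i.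
have sI : injective s by exact: nth_fset_inj.
have sA i : A (s i) by apply: JA; rewrite /= mem_nth.
rewrite -(tailE _ _ (gaussian_vector_reim iidZ sI sA)); congr (P _).
have E := reim_row_partial_mx J f t c0.
by apply/seteqP; split=> w [j]; exists j; rewrite ?E// -E.
Qed.

Definition combine f p (t : 'I_p -> circle R) (a : 'cV[R]_p) : circle R -> R[i] :=
  fun u => \sum_j (a j 0)%:C%C * f (t j + u).

Lemma combine_continuous f p (t : 'I_p -> circle R) a : cfun_continuous f ->
  cfun_continuous (combine f t a).
Proof.
move=> cf; apply: cfun_continuous_sum => j.
by apply: ccontinuousZ; exact: cfun_continuous_translate.
Qed.

Lemma sqn_partial_mx (J : {fset int}) f p (t : 'I_p -> circle R) (c0 : R[i]) a :
  cfun_continuous f -> [set` J] `<=` A -> normc c0 = 1 ->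
  sqn (partial_mx J f t c0) a =
  \sum_(n <- J) normc (L2inner m (combine f t a) (e n)) ^+ 2.
Proof.
move=> cf JA c1; have [eL2 _ _] := be.
have hf j : in_L2 m (fun u => f (t j + u)).
  by apply: cfun_continuous_L2; exact: cfun_continuous_translate.
rewrite sqn_coef_mx [RHS](big_nth 0) big_mkord; apply: eq_bigr => i _.
have eL : in_L2 m (e (nth 0 J i)) by apply: eL2; apply: JA; rewrite /= mem_nth.
rewrite /combine L2inner_suml//; last by move=> j; exact: in_L2Z.
rewrite (_ : \sum_j _ = c0 * \sum_(j < p) (a j 0)%:C%C *
    L2inner m (fun u => f (t j + u)) (e (nth 0 J i))).
  rewrite normcM c1 mul1r; congr (normc _ ^+ 2); apply: eq_bigr => j _.
  by rewrite L2innerZl.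
by rewrite mulr_sumr; apply: eq_bigr => j _; rewrite mulrCA.
Qed.

(** Bessel's inequality: the quadratic form of a partial sum is bounded by the
squared norm of the combination of translates, whatever the basis. *)
Lemma sqn_partial_mx_le (J : {fset int}) f p (t : 'I_p -> circle R) (c0 : R[i]) a :
  cfun_continuous f -> [set` J] `<=` A -> normc c0 = 1 ->
  ((sqn (partial_mx J f t c0) a)%:E <= L2sqnorm m (combine f t a))%E.
Proof.
move=> cf JA c1; rewrite sqn_partial_mx//.
have hh : in_L2 m (combine f t a).
  by apply: cfun_continuous_L2; exact: combine_continuous.
by rewrite L2sqnormE// lee_fin; apply: bessel_fset be _ _ JA hh.
Qed.

Lemma L2sqnorm_combine_le p (r : 'I_p -> circle R -> R[i]) (a : 'cV[R]_p) dl :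
  (forall j, in_L2 m (r j)) -> (forall j, Re (L2inner m (r j) (r j)) <= dl) ->
  (L2sqnorm m (fun u => (\sum_j (a j 0)%:C%C * r j u)%R) <=
    ((\sum_j a j 0 ^+ 2) * (dl *+ p))%:E)%E.
Proof.
move=> hr rdl.
have s0 : 0 <= \sum_j a j 0 ^+ 2 by apply: sumr_ge0 => j _; exact: sqr_ge0.
have mr j : measurable_fun setT (fun u => (normc (r j u) ^+ 2)%:E).
  by apply/measurable_EFinP/measurable_sqr_normc; have [] := hr j.
apply: (@le_trans _ _ (\int[m]_u ((\sum_j a j 0 ^+ 2)%:E * \sum_j (normc (r j u) ^+ 2)%:E))%E).
  apply: ge0_le_integral => //.
  - by move=> u _; rewrite lee_fin sqr_ge0.
  - apply/measurable_EFinP/measurable_sqr_normc.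
    suff [] : in_L2 m (fun u => \sum_j (a j 0)%:C%C * r j u) by [].
    by apply: in_L2_sum => j _; exact: in_L2Z.
  - by apply: measurable_funeM; apply: emeasurable_sum => j.
  by move=> u _; rewrite sumEFin -EFinM lee_fin normc_cauchy_schwarz.
rewrite ge0_integralZl//; last first.
- by move=> u _; apply: sume_ge0 => j _; rewrite lee_fin sqr_ge0.
- by apply: emeasurable_sum => j.
rewrite ge0_integral_sum//; last by move=> j u _; rewrite lee_fin sqr_ge0.
rewrite EFinM; apply: lee_wpmul2l; first by rewrite lee_fin.
have -> : dl *+ p = \sum_(j < p) dl by rewrite sumr_const card_ord.
rewrite -sumEFin; apply: lee_sum => j _.
by have := L2sqnormE (hr j); rewrite /L2sqnorm => ->; rewrite lee_fin.
Qed.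

(** Conversely, the partial sum captures the squared norm up to the residuals,
with an error proportional to the Euclidean norm of the coefficients. *)
Lemma sqn_partial_mx_ge (J : {fset int}) f p (t : 'I_p -> circle R) (c0 : R[i]) a dl :
  cfun_continuous f -> [set` J] `<=` A -> normc c0 = 1 ->
  (forall j, Re (L2inner m (residual m e J (fun u => f (t j + u)))
                           (residual m e J (fun u => f (t j + u)))) <= dl) ->
  (L2sqnorm m (combine f t a) <=
    (sqn (partial_mx J f t c0) a + (\sum_j a j 0 ^+ 2) * (dl *+ p))%:E)%E.
Proof.
move=> cf JA c1 rdl; have [eL2 _ _] := be.
have hf j : in_L2 m (fun u => f (t j + u)).
  by apply: cfun_continuous_L2; exact: cfun_continuous_translate.
have hh : in_L2 m (combine f t a).
  by apply: cfun_continuous_L2; exact: combine_continuous.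
have [rL2 rE] := residual_fset be JA hh.
rewrite L2sqnormE// lee_fin sqn_partial_mx// -lerBlDl -rE -lee_fin -L2sqnormE//.
pose r j := residual m e J (fun u => f (t j + u)).
have rL j : in_L2 m (r j) by exact: (residual_fset be JA (hf j)).1.
have {}rdl j : Re (L2inner m (r j) (r j)) <= dl by exact: rdl.
have -> : residual m e J (combine f t a) = (fun u => \sum_j (a j 0)%:C%C * r j u).
  apply/funext => u; rewrite /r /residual {1}/combine; clear r rL rdl.
  under [RHS]eq_bigr do rewrite mulrBr.
  rewrite big_split/= sumrN; congr (_ - _).
  under [RHS]eq_bigr do rewrite mulr_sumr.
  rewrite exchange_big/=; rewrite !big_seq; apply: eq_bigr => n nJ.
  have eL : in_L2 m (e n) by apply: eL2; exact: JA.
  rewrite /combine L2inner_suml//; last by move=> j; exact: in_L2Z.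
  by rewrite mulr_suml; apply: eq_bigr => j _; rewrite L2innerZl// mulrA.
by apply: L2sqnorm_combine_le.
Qed.

End partial_matrix.

(** * Transfer of tail bounds between two processes *)

Section transfer.
Context {R : realType} (mu : {finite_measure set (circle R) -> \bar R}).
Context d (Omega : measurableType d) (P : probability Omega R).
Variables (A : set int) (e : int -> circle R -> R[i]) (Z : int -> Omega -> R[i]).
Variable X : (circle R -> R[i]) -> circle R -> Omega -> R[i].
Hypothesis HX : pisier_process mu P A e Z X.
Context d' (Omega' : measurableType d') (P' : probability Omega' R).
Variables (A' : set int) (e' : int -> circle R -> R[i]) (Z' : int -> Omega' -> R[i]).
Variable X' : (circle R -> R[i]) -> circle R -> Omega' -> R[i].
Hypothesis HX' : pisier_process (circle_lebesgue R) P' A' e' Z' X'.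
Variables (C : R) (N : nat) (al : nat -> circle R).
Hypothesis C0 : 0 <= C.
Hypothesis dom : forall g : circle R -> R, continuous g -> (forall u, 0 <= g u) ->
  (\int[circle_lebesgue R]_u (g u)%:E <=
   C%:E * \sum_(k < N) \int[mu]_u (g (al k + u)%R)%:E)%E.

(** The hypothesis on the measures, applied to the squared modulus of a linear
combination of translates of [f], compares the covariance kernels as quadratic
forms. *)
Lemma L2sqnorm_combine_dom f p (t : 'I_p -> circle R) a : cfun_continuous f ->
  (L2sqnorm (circle_lebesgue R) (combine f t a) <=
   C%:E * \sum_(k < N) L2sqnorm mu (combine f (fun j => (t j + al k)%R) a))%E.
Proof.
move=> cf; apply: le_trans (dom _ _) _.
- by apply: continuous_sqr_normc; exact: combine_continuous.
- by move=> u; exact: sqr_ge0.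
rewrite le_eqVlt; apply/orP; left; apply/eqP; congr (_ * _)%E.
apply: eq_bigr => k _; apply: eq_integral => u _; congr ((normc _ ^+ 2)%:E).
by rewrite /combine; apply: eq_bigr => j _; rewrite addrA.
Qed.

Lemma sqn_partial_mx_dom f p (t : 'I_p -> circle R) c0 (J J' : {fset int}) dl a :
  cfun_continuous f -> [set` J] `<=` A -> [set` J'] `<=` A' -> normc c0 = 1 ->
  (forall k : 'I_N, forall j, Re (L2inner mu (residual mu e J (fun u => f (t j + al k + u)))
                             (residual mu e J (fun u => f (t j + al k + u)))) <= dl) ->
  sqn (partial_mx (circle_lebesgue R) e' J' f t c0) a <=
  C * \sum_(k < N) (sqn (partial_mx mu e J f (fun j => t j + al k) c0) a
                     + (\sum_j a j 0 ^+ 2) * (dl *+ p)).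
Proof.
move=> cf JA JA' c1 rdl; have [be _ _] := HX; have [be' _ _] := HX'.
rewrite -lee_fin; apply: le_trans (sqn_partial_mx_le be' t a cf JA' c1) _.
apply: le_trans (L2sqnorm_combine_dom _ _ cf) _.
rewrite EFinM lee_wpmul2l ?lee_fin// -sumEFin; apply: lee_sum => k _.
exact: (sqn_partial_mx_ge be a cf JA c1 (rdl k)).
Qed.

Lemma transfer_scale_gt0 (l : R) : 0 < l -> 0 < l / N.+1%:R / Num.sqrt (C + 1).
Proof.
move=> l0; rewrite divr_gt0//; first by rewrite divr_gt0.
by rewrite sqrtr_gt0 ltr_wpDl.
Qed.

(** The matrix that dominates consists of the partial sums at the [N] translated
families of points, scaled by [sqrt (C + 1)], and of a multiple [sg] of the
identity which absorbs the residuals. The noise [sg] is chosen first, so that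
its own tail is small; the accuracy [dl] of the approximation is chosen next.
The level is shared equally between the [N + 1] blocks. *)
Lemma tail_partial_mx_transfer f p (t : 'I_p -> circle R) (l e0 : R) :
  cfun_continuous f -> 0 < l -> 0 < e0 -> exists2 dl, 0 < dl &
  forall (J J' : {fset int}) c0,
  [set` J] `<=` A -> [set` J'] `<=` A' -> normc c0 = 1 ->
  (forall k : 'I_N, forall j, Re (L2inner mu (residual mu e J (fun u => f (t j + al k + u)))
                             (residual mu e J (fun u => f (t j + al k + u)))) <= dl) ->
  (forall k : 'I_N, (tail (partial_mx mu e J f (fun j => (t j + al k)%R) c0)
                      (l / N.+1%:R / Num.sqrt (C + 1)) <= e0%:E)%E) ->
  (tail (partial_mx (circle_lebesgue R) e' J' f t c0) l <= (e0 *+ (N.+1).*2)%:E)%E.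
Proof.
move=> cf l0 e00.
have [L0 HL0] := tail_cvg0 (1%:M : 'M[R]_p) e00.
pose L := Num.max 1 L0; have L1 : 0 < L by rewrite lt_max ltr01.
have HL : (tail (1%:M : 'M[R]_p) L <= e0%:E)%E by apply: HL0; rewrite le_max lexx orbT.
pose l1 := l / N.+1%:R; have l10 : 0 < l1 by rewrite divr_gt0.
(* sg times a standard Gaussian vector rarely exceeds l1 *)
pose sg := l1 / L; have sg0 : 0 < sg by rewrite divr_gt0.
pose K := C * (N * p)%:R + 1; have K0 : 0 < K.
  by rewrite /K ltr_wpDl// mulr_ge0.
exists (sg ^+ 2 / K) => [|J J' c0 JA JA' c1 rdl tl]; first by rewrite divr_gt0// exprn_gt0.
pose D := Num.sqrt (C + 1); have D0 : 0 < D by rewrite sqrtr_gt0 ltr_wpDl.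
pose Psi (k : nat) := partial_mx mu e J f (fun j => t j + al k) c0.
have [n [M [sqM tM]]] := tail_stack (fun k => D *: Psi k) (sg *: 1%:M : 'M[R]_p) l1 l1 N.
have -> : l = l1 + l1 *+ N by rewrite -mulrS -(mulr_natr _ N.+1) divfK// pnatr_eq0.
have tM' : (tail M (l1 + l1 *+ N) <= (e0 *+ N.+1)%:E)%E.
  apply: le_trans tM _; rewrite mulrS EFinD; apply: leeD.
    by have -> : l1 = sg * L; [rewrite divfK// gt_eqF|rewrite tailZ].
  have -> : e0 *+ N = \sum_(k < N) e0 by rewrite sumr_const card_ord.
  rewrite -sumEFin; apply: lee_sum => k _.
  have -> : l1 = D * (l1 / D) by rewrite mulrC divfK// gt_eqF.
  by rewrite tailZ//; exact: tl.
rewrite -addnn mulrnDr EFinD; apply: le_trans (leeD tM' tM').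
apply: tail_dom => a; apply: le_trans (sqn_partial_mx_dom a cf JA JA' c1 rdl) _.
rewrite sqM sqnZ big_split/= mulrDr addrC; apply: lerD.
  have -> : sqn (1%:M : 'M[R]_p) a = \sum_j a j 0 ^+ 2.
    by rewrite /sqn mul1mx.
  rewrite sumr_const card_ord -mulrnAr -mulrnA mulrCA [leRHS]mulrC.
  apply: ler_wpM2l; first by apply: sumr_ge0 => j _; exact: sqr_ge0.
  rewrite -mulr_natr mulrA mulrC mulrA [X in X * _]mulrC mulrA.
  rewrite ler_pdivrMr// mulrC; apply: ler_wpM2l; first exact: sqr_ge0.
  by rewrite /K mulnC lerDl.
rewrite mulr_sumr; apply: ler_sum => k _; rewrite sqnZ sqr_sqrtr; last exact: addr_ge0.
apply: ler_wpM2r; last by rewrite lerDl.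
by apply: sumr_ge0 => i _; exact: sqr_ge0.
Qed.

(** Partial sums replace the processes up to events of small probability; the
number of points [p] does not appear in the bound, because the errors are made
small after [p] is known. The level [4 l] is split once for the approximation
and once for the real and imaginary parts, and the constant is
[8 (N + 1) + 1 = 1 + 2 * 4 (N + 1)], with 1 for the approximation. *)
Lemma exceeds_some_transfer f p (t : 'I_p -> circle R) (l e0 : R) :
  cfun_continuous f -> 0 < l -> 0 < e0 ->
  (forall k : 'I_N, (P (exceeds_some (fun j => X f (t j + al k)%R)
     (l / N.+1%:R / Num.sqrt (C + 1) / 2)) <= e0%:E)%E) ->
  (P' (exceeds_some (fun j => X' f (t j)) ((l + l) + (l + l))) <=
     (e0 *+ (8 * N.+1).+1)%:E)%E.
Proof.
move=> cf l0 e00 Pe.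
pose l2 := l / N.+1%:R / Num.sqrt (C + 1); have l20 : 0 < l2 by exact: transfer_scale_gt0.
have [be iid _] := HX; have [be' iid' _] := HX'.
have e20 : 0 < e0 + e0 by lra.
have [dl dl0 key] := tail_partial_mx_transfer t cf l0 e20.
pose e1 := e0 / p.+1%:R; have e10 : 0 < e1 by rewrite divr_gt0.
have e1p : e1 *+ p <= e0.
  rewrite -mulr_natr mulrAC ler_pdivrMr// ler_pM2l// ler_nat//.
have l20' : 0 < l2 / 2 by rewrite divr_gt0.
have [J [JA aJ rJ]] := pisier_process_approx HX
  (fun x : 'I_N * 'I_p => t x.2 + al x.1) cf l20' e10 dl0.
have ll0 : 0 < l + l by lra.
have [J' [JA' aJ' _]] := pisier_process_approx HX' t cf ll0 e10 ltr01.
have mX f0 u : cfun_continuous f0 -> cmeasurable_fun (X f0 u) := pisier_process_measurable HX u.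
have mX' f0 u : cfun_continuous f0 -> cmeasurable_fun (X' f0 u) := pisier_process_measurable HX' u.
have mp u := measurable_partial HX f u JA.
have mp' u := measurable_partial HX' f u JA'.
have mr u := cmeasurable_error HX u cf JA.
have mr' u := cmeasurable_error HX' u cf JA'.
have tl c0 : normc c0 = 1 -> (tail (partial_mx (circle_lebesgue R) e' J' f t c0) l <=
    ((e0 + e0) *+ (N.+1).*2)%:E)%E.
  move=> c1; apply: (key J J' c0) => // [k j|k]; first exact: (rJ (k, j)).
  rewrite -/l2 -(tail_partial_mx mu e iid _ _ _ _ JA).
  apply: (@le_trans _ _ (P (exceeds_some (fun j => partial mu e Z J f (t j + al k)) l2))).
    apply: le_measure; rewrite ?inE; last exact: re_exceeds_sub.
      exact: measurable_re_exceeds.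
    exact: measurable_exceeds_some.
  have hsub := @exceeds_some_approx _ _ Omega _ (fun j => partial mu e Z J f (t j + al k))
    (fun j => X f (t j + al k)) (l2 / 2).
  rewrite -splitr in hsub.
  have mr2 j : cmeasurable_fun (fun w => partial mu e Z J f (t j + al k) w - X f (t j + al k) w).
    have := cmeasurableM (cmeasurable_cst (-1)) (mr (t j + al k)).
    by congr cmeasurable_fun; apply/funext => w; rewrite mulN1r opprB.
  apply: le_trans (le_measure P _ _ hsub) _; rewrite ?inE.
  - exact: measurable_exceeds_some.
  - by apply: measurableU; apply: measurable_exceeds_some => // j; exact: mX.
  apply: le_trans (measureU2 _ _ _) _.
  - exact: measurable_exceeds_some.
  - by apply: measurable_exceeds_some => // j; exact: mX.
  rewrite EFinD; apply: leeD; last exact: Pe.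
  apply: (@le_trans _ _ (e1 *+ p)%:E); last by rewrite lee_fin.
  apply: exceeds_some_le => // j.
  have := aJ (k, j); congr (_ <= _)%E; congr (P _).
  by apply/seteqP; split=> w /=; rewrite -opprB normcN.
apply: le_trans (le_measure P' _ _ (@exceeds_some_approx _ _ _ _ _
  (fun j => partial (circle_lebesgue R) e' Z' J' f (t j)) _)) _; rewrite ?inE.
- by apply: measurable_exceeds_some => j; exact: mX'.
- by apply: measurableU; apply: measurable_exceeds_some.
apply: le_trans (measureU2 _ _ _) _; try exact: measurable_exceeds_some.
rewrite mulrS EFinD; apply: leeD.
  apply: (@le_trans _ _ (e1 *+ p)%:E); last by rewrite lee_fin.
  by apply: exceeds_some_le.
apply: le_trans (le_measure P' _ _ (@exceeds_some_re _ _ _ _ _ _)) _; rewrite ?inE.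
- exact: measurable_exceeds_some.
- by apply: measurableU; apply: measurable_re_exceeds.
apply: le_trans (measureU2 _ _ _) _; try exact: measurable_re_exceeds.
have re_le c0 : normc c0 = 1 ->
    (P' (re_exceeds (fun j => partial (circle_lebesgue R) e' Z' J' f (t j)) c0 l) <=
     ((e0 + e0) *+ (N.+1).*2)%:E)%E.
  by move=> c1; apply: le_trans (tl _ c1); rewrite (tail_partial_mx (circle_lebesgue R) e' iid').
apply: le_trans (leeD (re_le _ _) (re_le _ _)) _.
- by rewrite normc1.
- by rewrite normcN /normc /= expr0n add0r expr1n sqrtr1.
rewrite -EFinD lee_fin -mulrnDr addnn -mulr2n -mulrnA.
by rewrite le_eqVlt; apply/orP; left; apply/eqP; congr (_ *+ _); rewrite -!muln2; lia.
Qed.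

End transfer.

(** * Tightness and almost sure boundedness along a sequence *)

Section tightness.
Context {R : realType} d (T : measurableType d) (P : probability T R).

(** The level [l] does not depend on the number of points: this is what
distinguishes tightness of the suprema from that of the marginals. *)
Definition tight (h : nat -> T -> R[i]) := forall eta, 0 < eta ->
  exists2 l, 0 < l & forall p (s : 'I_p -> nat),
    (P (exceeds_some (fun j => h (s j)) l) <= eta%:E)%E.

Lemma exceeds_some_leS p (h : 'I_p -> T -> R[i]) l l' : l <= l' ->
  exceeds_some h l' `<=` exceeds_some h l.
Proof. by move=> ll' w [j hj]; exists j; exact: le_lt_trans hj. Qed.

(** The events that the supremum exceeds [k] decrease to a null event. *)
Lemma ae_bounded_tight (h : nat -> T -> R[i]) : (forall n, cmeasurable_fun (h n)) ->
  (\forall w \ae P, exists M : R, forall n, normc (h n w) <= M) -> tight h.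
Proof.
move=> mh [B [mB PB hB]] eta eta0.
pose F k := \bigcup_n [set w | k.+1%:R < normc (h n w)].
have mF k : measurable (F k).
  by apply: bigcupT_measurable => n; exact: measurable_normc_gt.
have dF : nonincreasing_seq F.
  move=> k k' kk'; rewrite subsetEset => w [n _ /= hn]; exists n => //=.
  by apply: le_lt_trans hn; rewrite ler_nat.
have F0 : P (\bigcap_k F k) = 0%E.
  apply: (@subset_measure0 _ _ _ P _ B) => //; first exact: bigcapT_measurable.
  move=> w hw; apply: hB => /= -[M hM].
  have [n _ /=] := hw (Num.truncn `|M|) I.
  apply/negP; rewrite -leNgt; apply: le_trans (hM n) (le_trans (ler_norm _) _).
  by apply: ltW; exact: truncnS_gt.
have [k hk] := measure_decreasing_small mF dF F0 eta0.
exists k.+1%:R => // p s; apply: le_trans (ltW hk).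
apply: le_measure; rewrite ?inE//; first exact: measurable_exceeds_some.
by move=> w [j hj]; exists (s j).
Qed.

(** The supremum over the sequence is the increasing limit of finite suprema. *)
Lemma tight_ae_bounded (h : nat -> T -> R[i]) : (forall n, cmeasurable_fun (h n)) ->
  tight h -> \forall w \ae P, exists M : R, forall n, normc (h n w) <= M.
Proof.
move=> mh th.
pose G k := \bigcup_n [set w | (k : nat)%:R < normc (h n w)].
have mG k : measurable (G k).
  by apply: bigcupT_measurable => n; exact: measurable_normc_gt.
exists (\bigcap_k G k); split; first exact: bigcapT_measurable.
  apply/eqP; rewrite eq_le measure_ge0 andbT; apply/lee_addgt0Pr => eta eta0.
  rewrite add0e; have [l l0 hl] := th _ eta0.
  apply: (@le_trans _ _ (P (G (Num.truncn l).+1))).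
    by apply: le_measure; rewrite ?inE//; [exact: bigcapT_measurable|move=> w; apply].
  pose E p := exceeds_some (fun j : 'I_p => h j) l.
  have mE p : measurable (E p) by exact: measurable_exceeds_some.
  have ndE : nondecreasing_seq E.
    move=> p q pq; rewrite subsetEset => w [j hj].
    by exists (widen_ord pq j).
  have cE : P \o E @ \oo --> P (\bigcup_p E p).
    by apply: nondecreasing_cvg_mu => //; exact: bigcupT_measurable.
  apply: (@le_trans _ _ (P (\bigcup_p E p))).
    apply: le_measure; rewrite ?inE//; first exact: bigcupT_measurable.
    move=> w [n _ /= hn]; exists n.+1 => //; exists ord_max => /=.
    by apply: lt_trans hn; exact: truncnS_gt.
  rewrite -(cvg_lim _ cE)//; apply: lime_le; first by apply/cvg_ex; eexists; exact: cE.
  by apply: nearW => p; exact: hl.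
move=> w /= nM k _; apply: contrapT => nG; apply: nM; exists k%:R => n.
by rewrite leNgt; apply/negP => hn; apply: nG; exists n.
Qed.

End tightness.

(** * Continuity in probability and transfer of boundedness *)

Section bounded_transfer.
Context {R : realType} (mu : {finite_measure set (circle R) -> \bar R}).
Context d (Omega : measurableType d) (P : probability Omega R).
Variables (A : set int) (e : int -> circle R -> R[i]) (Z : int -> Omega -> R[i]).
Variable X : (circle R -> R[i]) -> circle R -> Omega -> R[i].
Hypothesis HX : pisier_process mu P A e Z X.

(** A version agrees with the process almost surely on a countable set. *)
Lemma pisier_class_tight f (tau : nat -> circle R) : pisier_class P X f ->
  tight P (fun n => X f (tau n)).
Proof.
move=> [cf [Y [vY _ bY]]]; apply: ae_bounded_tight.
  by move=> n; exact: (pisier_process_measurable HX).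
have /ae_foralln vY' : forall n, \forall w \ae P, Y (tau n) w = X f (tau n) w.
  by move=> n; exact: vY.
apply: filterS2 vY' bY => w vw [M hM].
by exists M => n; rewrite -vw.
Qed.

Context d' (Omega' : measurableType d') (P' : probability Omega' R).
Variables (A' : set int) (e' : int -> circle R -> R[i]) (Z' : int -> Omega' -> R[i]).
Variable X' : (circle R -> R[i]) -> circle R -> Omega' -> R[i].
Hypothesis HX' : pisier_process (circle_lebesgue R) P' A' e' Z' X'.
Hypothesis dom : dominated_by_translates mu.

Lemma pisier_class_tight_transfer f (tau : nat -> circle R) : pisier_class P X f ->
  tight P' (fun n => X' f (tau n)).
Proof.
move=> Xf; have [cf _] := Xf; have [C [N [al [C0 domC]]]] := dom.
move=> eta eta0; pose e0 := eta / (8 * N.+1).+1%:R.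
have e00 : 0 < e0 by rewrite divr_gt0.
have th k : tight P (fun n => X f (tau n + al k)) by exact: pisier_class_tight.
have [l l0 hl] : exists2 l, 0 < l & forall k : 'I_N, forall p (s : 'I_p -> nat),
    (P (exceeds_some (fun j => X f (tau (s j) + al k)%R) l) <= e0%:E)%E.
  elim: (N) => [|n [l l0 hl]]; first by exists 1 => // -[].
  have [l' l'0 hl'] := th n _ e00.
  exists (Num.max l l') => [|k p s]; first by rewrite lt_max l0.
  have mX j : cmeasurable_fun (X f (tau (s j) + al k)%R).
    by exact: (pisier_process_measurable HX).
  have [kn|kn] := ltnP k n.
    apply: le_trans (hl (Ordinal kn) p s); apply: le_measure; rewrite ?inE.
    - exact: measurable_exceeds_some.
    - exact: measurable_exceeds_some.
    by apply: exceeds_some_leS; rewrite le_max lexx.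
  have kE : val k = n by apply/eqP; rewrite eqn_leq kn -ltnS ltn_ord.
  have {}hl' := hl' p s; rewrite -kE in hl'; apply: le_trans hl'; apply: le_measure; rewrite ?inE.
  - exact: measurable_exceeds_some.
  - exact: measurable_exceeds_some.
  by apply: exceeds_some_leS; rewrite le_max lexx orbT.
have D0 : 0 < Num.sqrt (C + 1) by rewrite sqrtr_gt0 ltr_wpDl.
pose l2 := l * 2 * Num.sqrt (C + 1) * N.+1%:R.
have l20 : 0 < l2 by rewrite !mulr_gt0.
have l2E : l2 / N.+1%:R / Num.sqrt (C + 1) / 2 = l.
  by rewrite /l2 mulfK ?pnatr_eq0// mulfK ?gt_eqF// mulfK.
exists ((l2 + l2) + (l2 + l2)) => [|p s]; first lra.
have -> : eta = e0 *+ (8 * N.+1).+1 by rewrite -(mulr_natr e0) divfK// pnatr_eq0.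
have := exceeds_some_transfer HX HX' C0 domC (t := fun j => tau (s j)) cf l20 e00.
by rewrite l2E; apply => k; exact: hl.
Qed.

Lemma pisier_class_bounded_transfer f (tau : nat -> circle R) : pisier_class P X f ->
  \forall w \ae P', exists M : R, forall n, normc (X' f (tau n) w) <= M.
Proof.
move=> Xf; have [cf _] := Xf; apply: tight_ae_bounded.
  by move=> n; exact: (pisier_process_measurable HX').
exact: pisier_class_tight_transfer.
Qed.

End bounded_transfer.

Section increments.
Context {R : realType} (m : {finite_measure set (circle R) -> \bar R}).
Context d (Omega : measurableType d) (P : probability Omega R).
Variables (A : set int) (e : int -> circle R -> R[i]) (Z : int -> Omega -> R[i]).
Variable X : (circle R -> R[i]) -> circle R -> Omega -> R[i].
Hypothesis HX : pisier_process m P A e Z X.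

(** A special case of the comparison of a matrix with a multiple of the identity,
applied to the column matrix [M *m V] of the increment, where [M] is the matrix
of the two values and [V] is the column (1, -1). *)
Lemma partial_increment_tail (J : {fset int}) f (t : 'I_2 -> circle R) c0 (l sg : R) :
  cfun_continuous f -> [set` J] `<=` A -> normc c0 = 1 ->
  (L2sqnorm m (fun u => (f (t ord0 + u) - f (t ord_max + u))%R) <= (sg ^+ 2)%:E)%E ->
  (P [set w | (l < `|Re (c0 * (partial m e Z J f (t ord0) w - partial m e Z J f (t ord_max) w))|)%R] <=
    tail (sg%:M : 'M[R]_1) l + tail (sg%:M : 'M[R]_1) l)%E.
Proof.
move=> cf JA c1 hsg; have [be iid _] := HX.
pose s (i : 'I_(size J)) := nth 0 J i.
have sI : injective s by exact: nth_fset_inj.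
have sA i : A (s i) by apply: JA; rewrite /= mem_nth.
pose V : 'M[R]_(2, 1) := \matrix_(j, k) (if j == ord0 then 1 else -1).
pose M := partial_mx m e J f t c0.
have -> : [set w | l < `|Re (c0 * (partial m e Z J f (t ord0) w - partial m e Z J f (t ord_max) w))|] =
    [set w | exceeds (reim_row Z s w *m (M *m V)) l].
  have E w : (reim_row Z s w *m (M *m V)) 0 0 =
    Re (c0 * (partial m e Z J f (t ord0) w - partial m e Z J f (t ord_max) w)).
    rewrite mulmxA mxE big_ord_recl big_ord1 !(reim_row_partial_mx, mxE)/=.
    rewrite mulr1 mulrN1 -ReB -mulrBr; congr (Re (_ * (_ - partial _ _ _ _ _ (t _) _))).
    exact: val_inj.
  apply/seteqP; split=> w /=; last by move=> [j]; rewrite ord1 E.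
  by move=> h; exists 0; rewrite E.
rewrite (tailE _ _ (gaussian_vector_reim iid sI sA)).
apply: tail_dom => a; rewrite /sqn -mulmxA -/(sqn M _) -lee_fin.
apply: le_trans (sqn_partial_mx_le be t _ cf JA c1) _.
have -> : combine f t (V *m a) =
    (fun u => (a 0 0)%:C%C * (f (t ord0 + u) - f (t ord_max + u))).
  apply/funext => u; rewrite /combine big_ord_recl big_ord1 !mxE !big_ord1 !mxE/=.
  rewrite mul1r mulN1r mulrBr; congr (_ + _).
  rewrite raddfN/= mulNr; congr (- (_ * f (t _ + _))); exact: val_inj.
rewrite L2sqnormZ; last first.
  suff [] : in_L2 m (fun u => f (t ord0 + u) - f (t ord_max + u)) by [].
  by apply: in_L2B; apply: cfun_continuous_L2; exact: cfun_continuous_translate.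
have -> : normc (a 0 0)%:C%C ^+ 2 = a 0 0 ^+ 2 by rewrite sqr_normc/= expr0n addr0.
rewrite big_ord1 mul_scalar_mx mxE exprMn mulrC [leRHS]EFinM.
apply: lee_wpmul2l => //.
by rewrite lee_fin sqr_ge0.
Qed.

(** Continuity in probability. The variable is approximated by partial sums, for
which the comparison principle bounds the tail of the increment by that of one
centered Gaussian variable of small variance. *)
Lemma pisier_process_increment f (l eta : R) : cfun_continuous f -> 0 < l -> 0 < eta ->
  exists2 dl, 0 < dl & forall s t,
    (L2sqnorm m (fun u => (f (s + u) - f (t + u))%R) <= dl%:E)%E ->
    (P [set w | (l < normc (X f s w - X f t w))%R] <= eta%:E)%E.
Proof.
move=> cf l0 eta0; (* two approximation errors, and two tails for each of the real and imaginary
   parts; the level is split into four *)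
pose e0 := eta / 6; have e00 : 0 < e0 by rewrite divr_gt0.
pose l1 := l / 4; have l10 : 0 < l1 by rewrite divr_gt0.
have [L0 HL0] := tail_cvg0 (1%:M : 'M[R]_1) e00.
pose L := Num.max 1 L0; have L1 : 0 < L by rewrite lt_max ltr01.
have HL : (tail (1%:M : 'M[R]_1) L <= e0%:E)%E by apply: HL0; rewrite le_max lexx orbT.
pose sg := l1 / L; have sg0 : 0 < sg by rewrite divr_gt0.
exists (sg ^+ 2) => [|s t hst]; first by rewrite exprn_gt0.
pose t2 (j : 'I_2) := if j == ord0 then s else t.
have [J [JA aJ _]] := pisier_process_approx HX t2 cf l10 e00 ltr01.
have tl : (tail (sg%:M : 'M[R]_1) l1 <= e0%:E)%E.
  have -> : l1 = sg * L by rewrite divfK// gt_eqF.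
  by rewrite -scalemx1 tailZ.
pose D w := partial m e Z J f s w - partial m e Z J f t w.
pose E1 := [set w | l1 < normc (X f s w - partial m e Z J f s w)].
pose E2 := [set w | l1 < normc (X f t w - partial m e Z J f t w)].
pose E3 := [set w | l1 < `|Re (1 * D w)|].
pose E4 := [set w | l1 < `|Re (- 'i%C * D w)|].
have mE1 : measurable E1 by apply: measurable_normc_gt; exact: (cmeasurable_error HX).
have mE2 : measurable E2 by apply: measurable_normc_gt; exact: (cmeasurable_error HX).
have mD : cmeasurable_fun D.
  rewrite /D; under eq_fun do rewrite -mulN1r.
  apply: cmeasurableD; first exact: (measurable_partial HX).
  by apply: cmeasurableM; [exact: cmeasurable_cst|exact: (measurable_partial HX)].
have mRe c0 : measurable [set w | l1 < `|Re (c0 * D w)|].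
  have := @measurable_re_exceeds _ _ Omega 1 (fun _ => D) c0 l1 (fun=> mD).
  congr measurable; apply/seteqP; split=> w /=; first by move=> [].
  by move=> h; exists ord0.
have sub : [set w | l < normc (X f s w - X f t w)] `<=` (E1 `|` E2) `|` (E3 `|` E4).
  move=> w /= lw; apply: contrapT => /not_orP[/not_orP[n1 n2] /not_orP[n3 n4]].
  have {}n1 : normc (X f s w - partial m e Z J f s w) <= l1 by rewrite leNgt; exact/negP.
  have {}n2 : normc (X f t w - partial m e Z J f t w) <= l1 by rewrite leNgt; exact/negP.
  have {}n3 : `|Re (D w)| <= l1 by rewrite leNgt; apply/negP => h; apply: n3; rewrite /E3/= mul1r.
  have {}n4 : `|Im (D w)| <= l1.
    rewrite leNgt; apply/negP => h; apply: n4.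
    by rewrite /E4/= Re_mulNi.
  have n5 := normc_le_add (D w).
  have := le_normcD (X f s w - partial m e Z J f s w) (D w - (X f t w - partial m e Z J f t w)).
  have := le_normcD (D w) (- (X f t w - partial m e Z J f t w)).
  rewrite normcN.
  have -> : X f s w - partial m e Z J f s w + (D w - (X f t w - partial m e Z J f t w)) =
     X f s w - X f t w by rewrite /D; ring.
  by move: lw n1 n2 n3 n4 n5; rewrite /l1; lra.
have PE1 : (P E1 <= e0%:E)%E by exact: (aJ ord0).
have PE2 : (P E2 <= e0%:E)%E by exact: (aJ ord_max).
have PRe c0 : normc c0 = 1 -> (P [set w | (l1 < `|Re (c0 * D w)|)%R] <= e0%:E + e0%:E)%E.
  move=> c1; apply: le_trans (leeD tl tl).
  exact: (partial_increment_tail (t := t2) l1 cf JA c1 hst).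
have mU1 : measurable (E1 `|` E2) by exact: measurableU.
have mU2 : measurable (E3 `|` E4) by apply: measurableU; exact: mRe.
apply: (@le_trans _ _ (P ((E1 `|` E2) `|` (E3 `|` E4)))).
  apply: le_measure; rewrite ?inE//; last exact: measurableU.
  have := cmeasurableD (pisier_process_measurable HX s cf)
    (cmeasurableM (cmeasurable_cst (-1)) (pisier_process_measurable HX t cf)).
  under eq_fun do rewrite mulN1r.
  exact: measurable_normc_gt.
apply: le_trans (measureU2 _ mU1 mU2) _.
apply: le_trans (leeD (measureU2 _ mE1 mE2) (measureU2 _ (mRe _) (mRe _))) _.
apply: le_trans (leeD (leeD PE1 PE2) (leeD (PRe _ _) (PRe _ _))) _.
- by rewrite normc1.
- by rewrite normcN /normc /= expr0n add0r expr1n sqrtr1.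
by rewrite -!EFinD lee_fin /e0; lra.
Qed.

End increments.

(** * Limits along rational points *)

Section dense_sequence.
Context {R : realType}.

Definition rational_point (n : nat) : circle R :=
  if @choice.unpickle rat n is Some r then circle_proj (ratr r) else 0.

Lemma rational_point_approx (t : circle R) : exists u : nat -> nat,
  forall B, nbhs t B -> \forall k \near \oo, B (rational_point (u k)).
Proof.
have [x _ <-] := circle_proj_surj t.
have hr k : exists q : rat, ratr q \in `]x, (x + k.+1%:R^-1)[.
  by apply: rat_in_itvoo; rewrite ltrDl invr_gt0.
pose r k := sval (cid (hr k)); have rP k := svalP (cid (hr k)).
have cr : (fun k => ratr (r k) : R) @ \oo --> x.
  apply/cvgrPdist_lt => e e0; near=> k.
  have := rP k; rewrite in_itv/= => /andP[h1 h2].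
  rewrite ltr0_norm ?subr_lt0// opprB ltrBlDl; apply: lt_trans h2 _.
  rewrite ltrD2l; near: k; exact: near_infty_natSinv_lt (PosNum e0).
exists (fun k => choice.pickle (r k)) => B tB.
have [K _ hK] := cr _ (circle_proj_continuous tB).
exists K => // k /hK /=.
by rewrite /rational_point choice.pickleK.
Unshelve. all: by end_near. Qed.

Lemma dense_rational_point : dense (range rational_point).
Proof.
move=> O [t Ot] oO; have [u hu] := rational_point_approx t.
have [k _ /(_ k (leqnn k)) h] := hu O (open_nbhs_nbhs (conj oO Ot)).
by exists (rational_point (u k)); split=> //; exists (u k).
Qed.

End dense_sequence.

Lemma near_normcB (R : realType) (T : topologicalType) (f : T -> R[i]) (t : T) (v : nat -> T) :
  continuous (f : T -> R[i]^o) ->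
  (forall B, nbhs t B -> \forall k \near \oo, B (v k)) ->
  (fun k => (normc (f (v k) - f t) ^+ 2)%:E) @ \oo --> (0%:E : \bar R)%E.
Proof.
move=> cf cv; apply/fine_cvgP; split; first by near=> k.
rewrite (_ : _ \o _ = (fun k => normc (f (v k) - f t) ^+ 2))//.
suff c0 : (fun k => normc (f (v k) - f t)) @ \oo --> (0 : R).
  by rewrite -[X in _ --> X](mulr0 0); apply: cvgM.
apply/cvgrPdist_lt => e e0; apply: (filterS _ (cv _ (cvg_normc (cf t) e0))) => k.
by rewrite sub0r normrN ger0_norm ?normc_ge0// -normcN opprB.
Unshelve. all: by end_near. Qed.

Section circle_limits.
Context {R : realType} (m : {finite_measure set (circle R) -> \bar R}).

(** Dominated convergence, since [f] is continuous and bounded. *)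
Lemma L2_translate_near f (t : circle R) (v : nat -> circle R) (dl : R) :
  cfun_continuous f -> (forall B, nbhs t B -> \forall k \near \oo, B (v k)) -> 0 < dl ->
  \forall k \near \oo,
    (L2sqnorm m (fun u => (f (v k + u) - f (t + u))%R) <= dl%:E)%E.
Proof.
move=> cf cv dl0; have [M hM] := cfun_continuous_bounded cf.
have M0 : 0 <= M by apply: le_trans (hM 0); exact: normc_ge0.
have mf k : cmeasurable_fun (fun u => f (v k + u) - f (t + u)).
  suff [] : in_L2 m (fun u => f (v k + u) - f (t + u)) by [].
  by apply: in_L2B; apply: cfun_continuous_L2; exact: cfun_continuous_translate.
have h1 : (fun k => L2sqnorm m (fun u => f (v k + u) - f (t + u))) @ \oo --> 0%E.
  rewrite -[X in _ --> X](integral0 m setT).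
  apply: (@dominated_cvg _ _ _ m setT measurableT _ _ (fun=> ((M + M) ^+ 2)%:E)) => //.
  - by move=> k; apply/measurable_EFinP/measurable_sqr_normc.
  - move=> u _.
    have cfu := @cfun_continuous_translate R f u cf.
    have := near_normcB cfu cv; apply: cvg_trans; apply: near_eq_cvg; near=> k.
    by rewrite ![u + _]addrC.
  - exact: finite_measure_integrable_cst.
  move=> k u _; rewrite gee0_abs ?lee_fin ?sqr_ge0//.
  rewrite lerXn2r ?nnegrE ?normc_ge0 ?addr_ge0//.
  by apply: le_trans (le_normcD _ _) _; rewrite normcN lerD.
have [K _ hK] := cvge0_lt h1 dl0; exists K => // k /hK; exact: ltW.
Unshelve. all: by end_near. Qed.

End circle_limits.

(** Convergence to 0 in probability makes it a null event that all the terms from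
some rank on stay away from 0. This replaces the extraction of an almost surely
convergent subsequence. *)
Lemma ae_infinitely_close (R : realType) d (T : measurableType d) (P : probability T R)
    (h : nat -> T -> R[i]) : (forall n, cmeasurable_fun (h n)) ->
  (forall (l eta : R) K, 0 < l -> 0 < eta -> exists2 k, (K <= k)%N &
     (P [set w | (l < normc (h k w))%R] <= eta%:E)%E) ->
  \forall w \ae P, forall n K, exists2 k, (K <= k)%N & normc (h k w) <= n.+1%:R^-1.
Proof.
move=> mh hP; apply: ae_foralln => n; apply: ae_foralln => K.
pose B := \bigcap_(k in [set k | (K <= k)%N]) [set w | n.+1%:R^-1 < normc (h k w)].
have mB : measurable B.
  by apply: bigcap_measurableType => k _; exact: measurable_normc_gt.
exists B; split=> //.
  apply/eqP; rewrite eq_le measure_ge0 andbT; apply/lee_addgt0Pr => eta eta0.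
  have n0 : 0 < n.+1%:R^-1 :> R by rewrite invr_gt0.
  rewrite add0e; have [k Kk hk] := hP _ _ K n0 eta0; apply: le_trans hk.
  apply: le_measure; rewrite ?inE//; first exact: measurable_normc_gt.
  by move=> w; apply.
move=> w /= nh k /= Kk; rewrite ltNge; apply/negP => hk; apply: nh.
by exists k.
Qed.

Section graph_closure.
Context {R : realType} (T : topologicalType).
Implicit Types (h : T -> R[i]) (S : set T).

(** Separability of a path is a statement on the closure of its graph over a
countable set. *)
Definition graph_on h S : set (T * R[i]^o) := [set (s, h s : R[i]^o) | s in S].

Lemma nbhs_complexP (z : R[i]) (B : set R[i]^o) :
  nbhs (z : R[i]^o) B <-> exists2 e : R, 0 < e & forall x, normc (z - x) < e -> B x.
Proof.
split=> [|[e e0 he]].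
  move=> /nbhs_ballP[e /= e0 he]; exists (Re e).
    by case: e e0 {he} => a b; rewrite ltcE/= => /andP[].
  move=> x zx; apply: he; rewrite -ball_normE/=.
  rewrite -[Num.norm _]/((normc (z - x))%:C%C).
  by case: e e0 zx => a b; rewrite !ltcE/= => /andP[/eqP-> _] ->; rewrite eqxx.
apply/nbhs_ballP; exists e%:C%C => /=; first by rewrite ltcR.
move=> x; rewrite -ball_normE/= -[Num.norm _]/((normc (z - x))%:C%C) ltcR.
exact: he.
Qed.

Lemma closure_graph_seq h S (t : T) (v : nat -> T) z :
  (forall k, S (v k)) -> (forall B, nbhs t B -> \forall k \near \oo, B (v k)) ->
  (forall n K, exists2 k, (K <= k)%N & normc (h (v k) - z) <= n.+1%:R^-1) ->
  closure (graph_on h S) (t, z : R[i]^o).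
Proof.
move=> Sv cv hz B [[B1 B2] /= [tB1 zB2] B12].
have [e e0 he] := (nbhs_complexP _ _).1 zB2.
have [K _ hK] := cv _ tB1.
have [n hn] : exists n : nat, n.+1%:R^-1 < e.
  by have [n _ /(_ n (leqnn n)) h1] := near_infty_natSinv_lt (PosNum e0); exists n.
have [k Kk hk] := hz n K.
exists (v k, h (v k) : R[i]^o); split; first by exists (v k).
apply: B12; split=> /=; first exact: hK.
by apply: he; rewrite -normcN opprB; exact: le_lt_trans hk hn.
Qed.

Lemma closure_graph_bounded h S (M : R) t (z : R[i]) :
  (forall s, S s -> normc (h s) <= M) ->
  closure (graph_on h S) (t, z : R[i]^o) -> normc z <= M.
Proof.
move=> hM cz; rewrite leNgt; apply/negP => Mz.
pose e := normc z - M; have e0 : 0 < e by rewrite subr_gt0.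
have [|[s y] [[s' Ss' [_ <-]] [_ /= hy]]] := cz (setT `*` [set x : R[i]^o | normc (z - x) < e]).
  exists (setT, [set x : R[i]^o | normc (z - x) < e]) => //=; split; first exact: filterT.
  by apply/nbhs_complexP; exists e.
have := le_normcD (z - h s') (h s'); rewrite subrK.
by have := hM _ Ss'; move: hy; rewrite /e; lra.
Qed.

(** Bounded sequences of complex numbers have cluster points. *)
Lemma closure_graph_exists h S (t : T) (v : nat -> T) (M : R) :
  (forall k, S (v k)) -> (forall B, nbhs t B -> \forall k \near \oo, B (v k)) ->
  (forall s, S s -> normc (h s) <= M) ->
  exists z, closure (graph_on h S) (t, z : R[i]^o).
Proof.
move=> Sv cv hM; pose g k := (Re (h (v k)), Im (h (v k))).
have cK : compact (`[(- M)%R, M]%classic `*` `[(- M)%R, M]%classic : set (R * R)).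
  by apply: compact_setX; exact: segment_compact.
have [|[a b] [_ cl]] := cK (g @ \oo) _.
  exists 0%N => // k _; split; rewrite /g/= in_itv/= -ler_norml;
    apply: le_trans (hM _ (Sv k)); [exact: normr_Re_le|exact: normr_Im_le].
exists (a +i* b)%C; apply: (closure_graph_seq Sv cv) => n K.
pose e : R := n.+1%:R^-1 / 2; have e0 : 0 < e by rewrite divr_gt0// invr_gt0.
have [||[x y] [[k /= Kk gk] [/= hx hy]]] := cl [set p | exists2 k, (K <= k)%N & g k = p]
  (ball a e `*` ball b e).
- by exists K => // k /= Kk; exists k.
- by exists (ball a e, ball b e) => //=; split; exact: nbhsx_ballx.
exists k => //; apply: le_trans (normc_le_add _) _.
rewrite ReB ImB /=; case: gk => -> ->.
move: hx hy; rewrite -!ball_normE/= => hx hy.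
rewrite distrC [X in _ + X]distrC [leRHS]splitr.
by apply: lerD; exact: ltW.
Qed.

End graph_closure.

(** * Construction of a separable version *)

Section separable_version.
Context {R : realType} (m : {finite_measure set (circle R) -> \bar R}).
Context d (Omega : measurableType d) (P : probability Omega R).
Variables (A : set int) (e : int -> circle R -> R[i]) (Z : int -> Omega -> R[i]).
Variable X : (circle R -> R[i]) -> circle R -> Omega -> R[i].
Hypothesis HX : pisier_process m P A e Z X.
Variable f : circle R -> R[i].
Hypothesis cf : cfun_continuous f.

Let S : set (circle R) := range (@rational_point R).
(* all the limits of the path at t along rational points *)
Let limits t w : set R[i] :=
  [set z | closure (graph_on (fun s => X f s w) S) (t, z : R[i]^o)].

Lemma ae_limit_of_rational_points t : \forall w \ae P, limits t w (X f t w).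
Proof.
have [u hu] := rational_point_approx t; pose v k := @rational_point R (u k).
have mX s : cmeasurable_fun (X f s) by exact: (pisier_process_measurable HX).
have mD k : cmeasurable_fun (fun w => X f (v k) w - X f t w).
  under eq_fun do rewrite -mulN1r.
  by apply: cmeasurableD => //; apply: cmeasurableM => //; exact: cmeasurable_cst.
have [] := ae_infinitely_close mD (P := P).
  move=> l eta K l0 eta0; have [dl dl0 hdl] := pisier_process_increment HX cf l0 eta0.
  have [K' _ hK'] := L2_translate_near m cf hu dl0.
  exists (maxn K K'); first exact: leq_maxl.
  by apply: hdl; apply: hK'; rewrite /= leq_maxr.
move=> B [mB PB hB]; exists B; split=> // w nw; apply: hB => hw; apply: nw.
by apply: (closure_graph_seq (v := v)) => // k; exists (u k).
Qed.

(** The value of the process is kept when it is a limit along rational points,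
and is otherwise replaced by an arbitrary such limit. *)
Definition separable_version t w : R[i] :=
  if `[< limits t w (X f t w) >] then X f t w else xget 0 (limits t w).

Lemma separable_version_rational s w : S s -> separable_version s w = X f s w.
Proof.
move=> Ss; rewrite /separable_version; case: asboolP => // nh; exfalso; apply: nh.
by apply: subset_closure; exists s.
Qed.

Lemma separable_version_limit M t w : (forall n, normc (X f (rational_point n) w) <= M) ->
  limits t w (separable_version t w).
Proof.
move=> hM; rewrite /separable_version; case: asboolP => // _.
have [u hu] := rational_point_approx t.
have [||z hz] := @closure_graph_exists _ _ (fun s => X f s w) S t _ M _ hu.
- by move=> k; exists (u k).
- by move=> _ [n _ <-].
exact: (xgetPex 0 (ex_intro _ z hz)).
Qed.

(** A modification on a null event for each point, unchanged at rational points,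
makes every value a limit of values at rational points; these inherit the bound
of the path at rational points. *)
Lemma pisier_class_of_bounded :
  (\forall w \ae P, exists M : R, forall n, normc (X f (rational_point n) w) <= M) ->
  pisier_class P X f.
Proof.
move=> bX; split=> //; exists separable_version; split.
- move=> t; apply: filterS (ae_limit_of_rational_points t) => w.
  by rewrite /separable_version => /asboolT ->.
- exists S; split.
  + exact: (sub_countable (card_image_le _ _)).
  + exact: dense_rational_point.
  apply: filterS bX => w [M hM] t; have := @separable_version_limit M t w hM.
  congr closure; apply/seteqP; split=> _ [s Ss <-]; exists s => //;
    by rewrite separable_version_rational.
apply: filterS bX => w [M hM]; exists M => t.
apply: (closure_graph_bounded _ (@separable_version_limit M t w hM)).
by move=> _ [n _ <-].
Qed.

End separable_version.

Theorem theorem2 (R : realType) (mu : probability (circle R) R)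
    (* data realizing the processes X_f attached to mu *)
    (d : measure_display) (Omega : measurableType d) (P : probability Omega R)
    (A : set int) (e : int -> circle R -> R[i]) (Z : int -> Omega -> R[i])
    (X : (circle R -> R[i]) -> circle R -> Omega -> R[i])
    (HX : pisier_process mu P A e Z X)
    (* data realizing the processes X_f attached to Lebesgue measure *)
    (d' : measure_display) (Omega' : measurableType d')
    (P' : probability Omega' R)
    (A' : set int) (e' : int -> circle R -> R[i]) (Z' : int -> Omega' -> R[i])
    (X' : (circle R -> R[i]) -> circle R -> Omega' -> R[i])
    (HX' : pisier_process (circle_lebesgue R) P' A' e' Z' X') :
  ((exists (I : set (circle R)) (C : R),
      [/\ is_arc I, (0 < circle_lebesgue R I)%E, 0 < C &
          forall g : circle R -> R, continuous g -> (forall u, 0 <= g u) ->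
            (\int[circle_lebesgue R]_(u in I) (g u)%:E <=
             C%:E * \int[mu]_(u in I) (g u)%:E)%E]) ->
   pisier_class P X `<=` pisier_class P' X')
  /\
  ((exists (phi : circle R -> R) (I : set (circle R)),
      [/\ has_density mu phi, is_arc I, open I, I !=set0 &
          {within I, continuous phi} /\ (forall u, I u -> 0 < phi u)]) ->
   pisier_class P X `<=` pisier_class P' X').
Proof.
suff key : dominated_by_translates mu -> pisier_class P X `<=` pisier_class P' X'.
  split=> [[I [C [arcI I0 C0 hI]]]|[phi [I [dphi _ oI I0 [cphi phi0]]]]]; apply: key.
    exact: arc_dominated arcI I0 C0 hI.
  exact: density_dominated dphi oI I0 cphi phi0.
move=> dom f Xf; have [cf _] := Xf; apply: (pisier_class_of_bounded HX' cf).
exact: (pisier_class_bounded_transfer HX HX' dom).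
Qed.
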